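(* Let $d\ge 2$. Let $\mathcal{D}_n^A$ be the Weyl random cone of type $A_{n-1}$ built from random vectors in $\mathbb{R}^d$ that are almost surely in type $A$ general position, and let $\mathcal{D}_n^B$ be the Weyl random cone of type $B_n$ built from random vectors in $\mathbb{R}^d$ that are almost surely in type $B$ general position. Then, for $k=1,\ldots,d$, $$\mathbb{E}\,\Lambda_k(\mathcal{D}_n^A)=\frac{n!\binom{n-1}{d-k}}{(n-d+k)!}\cdot\frac{1}{D^A(n,d)},\qquad \mathbb{E}\,\Lambda_k(\mathcal{D}_n^B)=\frac{2^{d-k}\,n!\binom{n}{d-k}}{(n-d+k)!}\cdot\frac{1}{D^B(n,d)}.$$
   Context: Type $A$ general position: $y_1,\ldots,y_n\in\mathbb{R}^d$ with $n\ge d+1$ such that for every permutation $\sigma$ of $\{1,\ldots,n\}$ any $d$ of the vectors $y_{\sigma(1)}-y_{\sigma(2)},\ldots,y_{\sigma(n-1)}-y_{\sigma(n)}$ are linearly independent. Type $B$ general position: $y_1,\ldots,y_n\in\mathbb{R}^d$ with $n\ge d$ such that for every $\varepsilon\in\{\pm1\}^n$ and every permutation $\sigma$ of $\{1,\ldots,n\}$ any $d$ of the vectors $\varepsilon_1y_{\sigma(1)}-\varepsilon_2y_{\sigma(2)},\ldots,\varepsilon_{n-1}y_{\sigma(n-1)}-\varepsilon_ny_{\sigma(n)},\,\varepsilon_ny_{\sigma(n)}$ are linearly independent. For $x\in\mathbb{R}^d\setminus\{0\}$ let $x^\perp=\{v\in\mathbb{R}^d:\langle v,x\rangle=0\}$.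 The Weyl tessellation $\mathcal{W}^A(y_1,\ldots,y_n)$ (resp. $\mathcal{W}^B(y_1,\ldots,y_n)$) is the set of cones obtained as closures of the connected components of the complement in $\mathbb{R}^d$ of the union of the hyperplanes $(y_i-y_j)^\perp$, $1\le i<j\le n$ (resp. of the hyperplanes $(y_i+y_j)^\perp$, $(y_i-y_j)^\perp$, $1\le i<j\le n$, and $y_i^\perp$, $1\le i\le n$). Given (possibly dependent) random vectors $Y_1,\ldots,Y_n$ in $\mathbb{R}^d$ a.s. in type $A$ (resp. type $B$) general position, the Weyl random cone $\mathcal{D}_n^A$ (resp. $\mathcal{D}_n^B$) is obtained by choosing uniformly at random one of the cones of $\mathcal{W}=\mathcal{W}^A(Y_1,\ldots,Y_n)$ (resp. $\mathcal{W}=\mathcal{W}^B(Y_1,\ldots,Y_n)$); that is, for a functional $\varphi$ of cones its expectation at the random cone is $\mathbb{E}\big[\frac{1}{\#\mathcal{W}}\sum_{C\in\mathcal{W}}\varphi(C)\big]$. The solid angle of a cone $C\subset\mathbb{R}^d$ is $\alpha(C):=\mathbb{P}(Z\in C)$, where $Z$ is uniformly distributed on the unit sphere in the linear hull of $C$. Let $\mathcal{F}_k(C)$ be the set of $k$-dimensional faces of $C$ (faces are obtained by replacing some, possibly none, of the half-spaces defining $C$ by their boundaries), and $\Lambda_k(C):=\sum_{F\in\mathcal{F}_k(C)}\alpha(F)$. $\genfrac{[}{]}{0pt}{}{n}{k}$ and $B[n,k]$ are defined by $t(t+1)\cdots(t+n-1)=\sum_{k=1}^n\genfrac{[}{]}{0pt}{}{n}{k}t^k$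 and $(t+1)(t+3)\cdots(t+2n-1)=\sum_{k=0}^nB[n,k]t^k$, and are zero for $k$ outside $\{1,\ldots,n\}$, resp. $\{0,\ldots,n\}$. Put $D^A(m,k):=2\sum_{i\ge0}\genfrac{[}{]}{0pt}{}{m}{m-k+1+2i}$ and $D^B(m,k):=2\sum_{i\ge0}B[m,m-k+1+2i]$. *)

(* Defs.v *)
From HB Require Import structures.
From mathcomp Require Import all_boot all_order all_algebra perm.
From mathcomp Require Import finmap.
From mathcomp Require Import all_classical all_reals all_analysis.

Set Implicit Arguments.
Unset Strict Implicit.
Unset Printing Implicit Defensive.

Import Order.TTheory GRing.Theory Num.Theory.
Import numFieldNormedType.Exports.

Local Open Scope classical_set_scope.
Local Open Scope ring_scope.

Section WeylCones.
Context {R : realType} {d : nat}.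
Local Notation V := 'rV[R]_d.

Definition inner (u v : V) : R := \sum_(j < d) u 0 j * v 0 j.

Definition perp (x : V) : set V := [set v | inner v x = 0].

(* [ordS i] is [i + 1] cyclically; the wrap-around difference (the one with
   [i = n - 1]) is excluded by the condition on [S]. *)
Definition type_A_general_position (n : nat) (y : 'I_n -> V) : Prop :=
  (d < n)%N /\
  forall (s : 'S_n) (S : {set 'I_n}),
    #|S| = d -> (forall i, i \in S -> (i.+1 < n)%N) ->
    free [seq y (s i) - y (s (ordS i)) | i in S].

Definition type_B_increment (n : nat) (y : 'I_n -> V) (e : {ffun 'I_n -> bool})
    (s : 'S_n) (i : 'I_n) : V :=
  if (i.+1 < n)%N
  then (-1) ^+ e i *: y (s i) - (-1) ^+ e (ordS i) *: y (s (ordS i))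
  else (-1) ^+ e i *: y (s i).

Definition type_B_general_position (n : nat) (y : 'I_n -> V) : Prop :=
  (d <= n)%N /\
  forall (e : {ffun 'I_n -> bool}) (s : 'S_n) (S : {set 'I_n}),
    #|S| = d -> free [seq type_B_increment y e s i | i in S].

Definition tessellation (normals : set V) : set (set V) :=
  let U := ~` (\bigcup_(x in normals) perp x) in
  [set closure (connected_component U v) | v in U].

Definition normals_A (n : nat) (y : 'I_n -> V) : set V :=
  [set x | exists i j : 'I_n, (i < j)%N /\ x = y i - y j].

Definition normals_B (n : nat) (y : 'I_n -> V) : set V :=
  [set x | (exists i j : 'I_n, (i < j)%N /\ (x = y i + y j \/ x = y i - y j))
           \/ exists i : 'I_n, x = y i].

Definition weyl_tessellation_A (n : nat) (y : 'I_n -> V) : set (set V) :=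
  tessellation (normals_A y).

Definition weyl_tessellation_B (n : nat) (y : 'I_n -> V) : set (set V) :=
  tessellation (normals_B y).

(* The set of such [F] does not depend on the half-space representation of [C]
   (for a nonempty polyhedral cone it is the set of its exposed faces). *)
Definition is_face (C F : set V) : Prop :=
  exists (m : nat) (x : 'I_m -> V) (I : {set 'I_m}),
    [/\ forall i, x i != 0,
        C = [set v | forall i, inner v (x i) <= 0] &
        F = [set v | forall i, if i \in I then inner v (x i) = 0
                               else inner v (x i) <= 0]].

(* The smallest linear subspace containing [C]. *)
Definition linear_hull (C : set V) : {vspace V} :=
  xget 0%VS [set U : {vspace V} | C `<=` [set` U] /\
    forall W : {vspace V}, C `<=` [set` W] -> (U <= W)%VS].

Definition faces (k : nat) (C : set V) : set (set V) :=
  [set F | is_face C F /\ \dim (linear_hull F) = k].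

Definition unit_sphere (L : {vspace V}) : set V :=
  [set v | v \in L /\ inner v v = 1].

End WeylCones.

Definition borel (R : realType) (d : nat) :=
  g_sigma_algebraType (@open 'rV[R]_d).

Section SolidAngle.
Context {R : realType} {d : nat}.
Local Notation V := 'rV[R]_d.

(* [mu] is the uniform distribution on the unit sphere of [L]: it lives on that
   sphere and is invariant under every orthogonal matrix that preserves [L]. *)
Definition uniform_on_sphere (L : {vspace V})
    (mu : probability (borel R d) R) : Prop :=
  mu (unit_sphere L) = 1%E /\
  forall Q : 'M[R]_d, Q *m Q^T = 1%:M -> (forall v, v \in L -> v *m Q \in L) ->
  forall A : set (borel R d), measurable A ->
    mu [set v : V | A (v *m Q)] = mu A.

(* For [L] nonzero this law exists and is unique; for [L = 0], where the sphere
   is empty, the value is a dummy. *)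
Definition sphere_law (L : {vspace V}) : probability (borel R d) R :=
  get (uniform_on_sphere L).

Definition solid_angle (C : set V) : R :=
  fine (sphere_law (linear_hull C) C).

Definition Lambda (k : nat) (C : set V) : R :=
  \sum_(F \in faces k C) solid_angle F.

(* Expectation of [phi] at a cone chosen uniformly at random in the (finite)
   random collection [W]. *)
Definition expectation_uniform_cone (disp : measure_display)
    (T : measurableType disp) (P : probability T R)
    (W : T -> set (set V)) (phi : set V -> R) : \bar R :=
  expectation P (fun w => (#|` fset_set (W w)|%fset%:R)^-1
                          * \sum_(C \in W w) phi C).

End SolidAngle.

Definition stirling1 (n k : nat) : nat :=
  if (1 <= k <= n)%N
  then ((\prod_(i < n) ('X + i%:R%:P : {poly nat}))`_k)%R
  else 0%N.

Definition stirlingB (n k : nat) : nat :=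
  ((\prod_(i < n) ('X + i.*2.+1%:R%:P : {poly nat}))`_k)%R.

(* Only used for [k <= m], so that [m - k] is not truncated. All terms with
   [i > m] vanish. *)
Definition DA (m k : nat) : nat :=
  (2 * \sum_(0 <= i < m.+1) stirling1 m (m - k + 1 + i.*2))%N.

Definition DB (m k : nat) : nat :=
  (2 * \sum_(0 <= i < m.+1) stirlingB m (m - k + 1 + i.*2))%N.

(* Main.v *)
Require Import Defs.
From HB Require Import structures.
From mathcomp Require Import all_boot all_order all_algebra perm.
From mathcomp Require Import finmap ring lra zify.
From mathcomp Require Import all_classical all_reals all_analysis.

(** The mean of [Lambda k] over the cones of a tessellation turns out to be the
    same number for all vectors in general position, so the expectation is this
    number. Both types are treated together, a boolean [b] telling type B from
    type A: the map sending [v] to its inner products with the vectors [y i]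
    pulls the chambers of the group [weyl n b] of signed, respectively plain,
    permutations back to the cones of the tessellation.

    Number of cones. Add the vectors one at a time. By general position, the
    restriction of the arrangement of the previous vectors to a hyperplane of
    the new one is again in general position, in one dimension less, and the
    intersection of two hyperplanes of the new vector lies on an old hyperplane.
    Deletion and restriction then give a recursion in the number of vectors and
    the dimension ([regions_arrangement]), which the numbers [DA n d] and
    [DB n d] solve ([region_count_DA], [region_count_DB]).

    Sum of the angles. The [k]-faces of the chamber of [g] arise by turning
    [d - k] of its walls into equations, so that the sum of [Lambda k] over all
    cones is a sum over pairs of a group element and a set of [d - k] walls
    ([sum_Lambda_chambers]). The group elements whose chamber is missed, and the
    sets of walls meeting the chamber in too small a dimension, contribute zero,
    because the uniform law on a sphere does not charge proper subspaces
    ([uniform_subspace_null]). A flat is a partition of the coordinates into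
    [m = n - (d - k)] blocks. The faces inside it are indexed by the ways to name
    and orient the blocks, that is by the group [weyl m b], and they tile it
    ([sum_label_mass]): their angles add up to one although the single angles are
    unknown. Counting each labeled flat with the size of its stabilizer
    ([weyl_face_sum]), the sum of all angles is [#|weyl n b|] times the number of
    sets of [d - k] walls, divided by [#|weyl m b|] ([sum_face_mass]).

    For the angles to mean anything, the uniform law on the sphere of a subspace
    has to exist. It is built by Haar's method: compare the numbers of small balls
    needed to cover a set and to cover the sphere, pass to the limit along an
    ultrafilter, and extend the resulting content to Borel sets by Caratheodory's
    theorem ([exists_invariant_probability]). *)

Set Implicit Arguments.
Unset Strict Implicit.
Unset Printing Implicit Defensive.

Import Order.TTheory GRing.Theory Num.Theory.
Import numFieldNormedType.Exports.

Local Open Scope ring_scope.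

(** * Signed permutations and signed blocks of coordinates *)

Section SignedPermutations.
Variable n : nat.
Implicit Types (g h : {ffun 'I_n -> bool} * 'S_n).

Local Notation sperm := ({ffun 'I_n -> bool} * 'S_n)%type.

Definition weyl (b : bool) : {set sperm} :=
  [set g : sperm | b || (g.1 == [ffun=> false])].

(** The product for which [sact] and [lact] are left actions. *)
Definition smul g h : sperm := ([ffun i => g.1 i (+) h.1 (g.2 i)], (g.2 * h.2)%g).

Definition sinv g : sperm := ([ffun i => g.1 ((g.2)^-1%g i)], (g.2)^-1%g).

Lemma smul_weyl b g h : g \in weyl b -> h \in weyl b -> smul g h \in weyl b.
Proof.
rewrite !inE; case: b => //= /eqP g0 /eqP h0; apply/eqP/ffunP => i.
by rewrite !ffunE g0 h0 !ffunE.
Qed.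

Lemma sinv_weyl b g : g \in weyl b -> sinv g \in weyl b.
Proof.
by rewrite !inE; case: b => //= /eqP g0; apply/eqP/ffunP => i; rewrite !ffunE g0 ffunE.
Qed.

Lemma smulA g h (k : sperm) : smul g (smul h k) = smul (smul g h) k.
Proof.
rewrite /smul /= mulgA; congr pair; apply/ffunP => i.
by rewrite !ffunE /= permM addbA.
Qed.

Definition sone : sperm := ([ffun=> false], 1%g).

Lemma smul1 g : smul sone g = g.
Proof.
case: g => e s; rewrite /smul /= mul1g; congr pair; apply/ffunP => i.
by rewrite !ffunE /= perm1.
Qed.

Lemma smulg1 g : smul g sone = g.
Proof.
case: g => e s; rewrite /smul /= mulg1; congr pair; apply/ffunP => i.
by rewrite !ffunE addbF.
Qed.

Lemma smulV g : smul (sinv g) g = sone.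
Proof.
rewrite /smul /= mulVg; congr pair; apply/ffunP => i.
by rewrite !ffunE addbb.
Qed.

Lemma smulgV g : smul g (sinv g) = sone.
Proof.
rewrite /smul /= mulgV; congr pair; apply/ffunP => i.
by rewrite !ffunE permK addbb.
Qed.

Lemma smulI g : injective (smul g).
Proof. by move=> h k e; rewrite -(smul1 h) -(smul1 k) -(smulV g) -!smulA e. Qed.

Lemma card_weyl b : #|weyl b| = (2 ^ (b * n) * n`!)%N.
Proof.
case: b.
  have -> : weyl true = [set: sperm] by apply/setP => g; rewrite !inE.
  by rewrite cardsT card_prod card_ffun card_bool card_ord card_Sn mul1n.
have -> : weyl false = finset.setX [set [ffun=> false]] [set: 'S_n].
  by apply/setP => -[e s]; rewrite !inE andbT.
by rewrite cardsX cards1 cardsT card_Sn.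
Qed.

End SignedPermutations.

Section Dominance.
Context {R : realFieldType}.
Variables (b : bool) (n : nat).
Implicit Types (z w : 'I_n -> R) (g h : {ffun 'I_n -> bool} * 'S_n).

Definition sact g z : 'I_n -> R := fun i => (-1) ^+ g.1 i * z (g.2 i).

Lemma sact_smul g h z : sact (smul g h) z =1 sact g (sact h z).
Proof. by move=> i; rewrite /sact /= ffunE signr_addb permM mulrA. Qed.

Lemma sactK g z : sact (sinv g) (sact g z) =1 z.
Proof.
move=> i; rewrite -sact_smul smulV /sact /= ffunE perm1.
by rewrite expr0 mul1r.
Qed.

Lemma eq_sact g z w : z =1 w -> sact g z =1 sact g w.
Proof. by move=> e i; rewrite /sact e. Qed.

(** Positions of the simple roots: a wall compares a coordinate with the next
    one, and the last coordinate with zero. Type A has no wall of the second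
    kind. *)
Definition wall : {set 'I_n} := [set i : 'I_n | b || (i.+1 < n)%N].

Definition increment z (i : 'I_n) : R :=
  if (i.+1 < n)%N then z i - z (ordS i) else z i.

Definition dominant z : bool := [forall (i | i \in wall), 0 <= increment z i].

Definition strictly_dominant z : bool := [forall (i | i \in wall), 0 < increment z i].

Lemma eq_increment z w : z =1 w -> increment z =1 increment w.
Proof. by move=> e i; rewrite /increment !e. Qed.

Lemma eq_dominant z w : z =1 w -> dominant z = dominant w.
Proof. by move=> e; apply: eq_forallb_in => i _; rewrite (eq_increment e). Qed.

Lemma val_ordS (i : 'I_n) : (i.+1 < n)%N -> ordS i = i.+1 :> nat.
Proof. by move=> h; rewrite /= modn_small. Qed.

Lemma dominant_anti z (i j : 'I_n) : dominant z -> (i <= j)%N -> z j <= z i.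
Proof.
move=> /forall_inP dz; case: j => j; elim: j => [|j ih] jn /= ij.
  by rewrite (_ : i = Ordinal jn) //; apply/val_inj => /=; lia.
have [e|ne] := eqVneq (i : nat) j.+1.
  by rewrite (_ : i = Ordinal jn) //; apply/val_inj.
have jn' : (j < n)%N by lia.
have := dz (Ordinal jn'); rewrite inE /= jn orbT /increment /= jn subr_ge0.
rewrite (_ : ordS _ = Ordinal jn); last by apply/val_inj => /=; rewrite modn_small.
by move=> /(_ isT) /le_trans; apply; apply: ih => /=; lia.
Qed.

Lemma dominant_ge0 z (i : 'I_n) : dominant z -> b -> 0 <= z i.
Proof.
move=> dz hb; have n0 : (n.-1 < n)%N by case: i => i; lia.
apply: le_trans (dominant_anti (j := Ordinal n0) dz _); last by case: i => i /=; lia.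
have /forall_inP/(_ (Ordinal n0)) := dz; rewrite inE hb /increment /= => /(_ isT).
by rewrite ifN // -leqNgt; lia.
Qed.

Lemma sorted_dominant z : dominant z -> sorted >=%R [seq z i | i <- enum 'I_n].
Proof.
move=> dz; have [n0|n_gt0] := posnP n.
  by rewrite (size0nil (s := map _ _)) // size_map size_enum_ord.
have i0 : 'I_n := Ordinal n_gt0.
apply/(sortedP 0) => i; rewrite size_map size_enum_ord => hi.
have nthE k : (k < n)%N ->
    nth 0 [seq z i | i <- enum 'I_n] k = z (nth i0 (enum 'I_n) k).
  by move=> hk; rewrite (nth_map i0) // size_enum_ord.
rewrite !nthE ?(ltnW hi) //; apply: (@dominant_anti z (nth i0 (enum 'I_n) i) (nth i0 (enum 'I_n) i.+1)) => //.
by rewrite !nth_enum_ord // ltnW.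
Qed.

(** A dominant point lists its coordinates in decreasing order, and in the
    signed case they are nonnegative. The group does not change the multiset of
    the coordinates, respectively of their absolute values, so an orbit has
    only one dominant point. *)
Lemma dominant_unique g z : g \in weyl n b -> dominant z -> dominant (sact g z) ->
  sact g z =1 z.
Proof.
move=> gW dz dg; have e i : sact g z i = z (g.2 i).
  move: gW; rewrite inE => /orP[hb|/eqP g0]; last by rewrite /sact g0 ffunE mul1r.
  rewrite -(ger0_norm (dominant_ge0 i dg hb)) normrMsign ger0_norm //.
  exact: dominant_ge0.
have pe : perm_eq [seq sact g z i | i <- enum 'I_n] [seq z i | i <- enum 'I_n].
  rewrite (eq_map e) (map_comp z g.2); apply: perm_map.
  apply: uniq_perm; rewrite ?(map_inj_uniq (@perm_inj _ g.2)) ?enum_uniq //.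
  move=> i; rewrite mem_enum; apply/mapP; exists ((g.2)^-1%g i); rewrite ?mem_enum //.
  by rewrite permKV.
have := sorted_eq ge_trans ge_anti (sorted_dominant dg) (sorted_dominant dz) pe.
by move=> /eq_in_map h i; apply: h; rewrite mem_enum.
Qed.

Lemma exists_sorting z : exists s : 'S_n, forall i : 'I_n, (i.+1 < n)%N ->
  z (s (ordS i)) <= z (s i).
Proof.
pose le (i j : 'I_n) := z j <= z i; pose t := sort le (enum 'I_n).
have st : size t = n by rewrite size_sort size_enum_ord.
have ut : uniq t by rewrite sort_uniq enum_uniq.
have inj : injective (fun i : 'I_n => nth i t i).
  move=> i j; rewrite (set_nth_default i) ?st // => /eqP.
  by rewrite nth_uniq ?st // => /eqP/val_inj.
exists (perm inj) => i hi; rewrite !permE.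
have srt : sorted le t by apply: sort_sorted => x y; exact: le_total.
rewrite [X in z X <= _](set_nth_default i) ?st // val_ordS //.
by apply: (sortedP i srt); rewrite st.
Qed.

(** Sort the coordinates, in the signed case by absolute value, and choose the
    signs that make them nonnegative. *)
Lemma exists_dominant z : exists2 g, g \in weyl n b & dominant (sact g z).
Proof.
have [hb|hb] := boolP b; last first.
  have [s hs] := exists_sorting z.
  exists ([ffun=> false], s); first by rewrite inE eqxx orbT.
  apply/forall_inP => i; rewrite inE (negbTE hb) /= => hi.
  by rewrite /increment hi /sact /= !ffunE !mul1r subr_ge0 hs.
have [s hs] := exists_sorting (fun i => `|z i|).
exists ([ffun i => z (s i) < 0], s); first by rewrite inE ?hb.
have e i : sact ([ffun i => z (s i) < 0], s) z i = `|z (s i)|.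
  rewrite /sact /= ffunE; have [h|h] := ltP (z (s i)) 0.
    by rewrite expr1 mulN1r ltr0_norm.
  by rewrite mul1r ger0_norm.
apply/forall_inP => i _; rewrite /increment !e.
by case: ifP => // hi; rewrite subr_ge0 hs.
Qed.

Lemma strictly_dominant_dominant z : strictly_dominant z -> dominant z.
Proof. by move=> /forall_inP h; apply/forall_inP => i /h /ltW. Qed.

Lemma strictly_dominant_lt z (i j : 'I_n) : strictly_dominant z -> (i < j)%N -> z j < z i.
Proof.
move=> sz ij; have in' : (i.+1 < n)%N by case: j ij => j /=; lia.
have := forall_inP sz i; rewrite inE in' orbT /increment in' subr_gt0 => /(_ isT).
apply: le_lt_trans; apply: dominant_anti; first exact: strictly_dominant_dominant.
by rewrite val_ordS.
Qed.

Lemma strictly_dominant_gt0 z (i : 'I_n) : strictly_dominant z -> b -> 0 < z i.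
Proof.
move=> sz hb; have n0 : (n.-1 < n)%N by case: i => i; lia.
apply: lt_le_trans (dominant_anti (j := Ordinal n0) (strictly_dominant_dominant sz) _); last first.
  by case: i => i /=; lia.
have /forall_inP/(_ (Ordinal n0)) := sz; rewrite inE hb /increment /= => /(_ isT).
by rewrite ifN // -leqNgt; lia.
Qed.

Lemma strictly_dominant_free g z : g \in weyl n b -> strictly_dominant z ->
  sact g z =1 z -> g = sone n.
Proof.
move=> gW sz e.
have inj i j : z i = z j -> i = j.
  move=> zij; apply/val_inj/eqP; rewrite eqn_leq; apply/andP; split;
    rewrite leqNgt; apply/negP => /(strictly_dominant_lt sz); rewrite zij ltxx //.
have hz i : z (g.2 i) = z i /\ (g.1 i = false).
  move: gW; rewrite inE => /orP[hb|/eqP g0]; last first.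
    by rewrite -(e i) /sact g0 ffunE mul1r.
  have := e i; rewrite /sact; case: (g.1 i); last by rewrite mul1r.
  rewrite expr1 mulN1r => h; have := strictly_dominant_gt0 i sz hb.
  by rewrite -h oppr_gt0 ltNge (ltW (strictly_dominant_gt0 _ sz hb)).
case: g hz {gW e} => e s /= hz; congr pair.
  by apply/ffunP => i; rewrite ffunE; have [] := hz i.
by apply/permP => i; rewrite perm1; apply: inj; have [] := hz i.
Qed.
End Dominance.

Section Labels.
Variables (R : realFieldType) (b : bool) (n m : nat).
Local Notation label := (option (bool * 'I_m)).
Local Notation labeling := {ffun 'I_n -> label}.
Implicit Types (c : labeling) (l : label).

(** A label is a signed block, or the block of coordinates that vanish; a point
    [phi] of dimension [m] gives the common value of each block. *)
Definition ev (phi : 'I_m -> R) l : R :=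
  if l is Some (e, j) then (-1) ^+ e * phi j else 0.

Definition twist (e : bool) l : label :=
  if l is Some (e', j) then Some (e (+) e', j) else None.

Definition lact (g : {ffun 'I_n -> bool} * 'S_n) c : labeling :=
  [ffun i => twist (g.1 i) (c (g.2 i))].

Definition relabel (t : {ffun 'I_m -> bool} * 'S_m) l : label :=
  if l is Some (e, j) then Some (e (+) t.1 j, t.2 j) else None.

Definition lrelabel t c : labeling := [ffun i => relabel t (c i)].

(** Partitions of the coordinates into [m] named nonempty blocks; in the signed
    case the blocks carry orientations and there is a zero block, possibly
    empty. Without the names and orientations these are the flats of the
    reflection arrangement. *)
Definition valid c : bool :=
  [forall j : 'I_m, exists i, exists e, c i == Some (e, j)] &&
  (b || [forall i, if c i is Some (e, _) then ~~ e else false]).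

Lemma ev_twist phi e l : ev phi (twist e l) = (-1) ^+ e * ev phi l.
Proof. by case: l => [[e' j]|] /=; rewrite ?mulr0 // signr_addb mulrA. Qed.

Lemma ev_lact phi g c i : ev phi (lact g c i) = sact g (fun i => ev phi (c i)) i.
Proof. by rewrite ffunE ev_twist. Qed.

Lemma ev_relabel phi t l : ev phi (relabel t l) = ev (sact t phi) l.
Proof. by case: l => [[e j]|] //=; rewrite signr_addb -mulrA. Qed.

Lemma twist_relabel t e l : twist e (relabel t l) = relabel t (twist e l).
Proof. by case: l => [[e' j]|] //=; rewrite addbA. Qed.

(** One action moves the coordinates and the other one renames the blocks.
    Because they commute, the stabilizers of the first action do not see the
    second. *)
Lemma lact_lrelabel t g c : lact g (lrelabel t c) = lrelabel t (lact g c).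
Proof. by apply/ffunP => i; rewrite !ffunE twist_relabel. Qed.

Lemma twistD e e' l : twist e (twist e' l) = twist (e (+) e') l.
Proof. by case: l => [[f j]|] //=; rewrite addbA. Qed.

Lemma lact_smul g h c : lact (smul g h) c = lact g (lact h c).
Proof. by apply/ffunP => i; rewrite !ffunE /= permM twistD. Qed.

Lemma lact1 c : lact (sone n) c = c.
Proof.
by apply/ffunP => i; rewrite !ffunE /= perm1; case: (c i) => [[e j]|].
Qed.

Lemma lactK g : cancel (lact g) (lact (sinv g)).
Proof. by move=> c; rewrite -lact_smul smulV lact1. Qed.

Lemma relabel_inj t : injective (relabel t).
Proof.
move=> [[e j]|] [[e' j']|] //= [h /perm_inj jj]; rewrite jj in h *.
by rewrite (addIb h).
Qed.

Lemma lrelabel_inj t : injective (lrelabel t).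
Proof. by move=> c c' /ffunP h; apply/ffunP => i; have := h i; rewrite !ffunE => /relabel_inj. Qed.

Lemma validP c : reflect ((forall j, exists i e, c i = Some (e, j)) /\
    (b \/ forall i, exists j, c i = Some (false, j))) (valid c).
Proof.
apply: (iffP andP) => -[h1 h2]; split.
- by move=> j; have /existsP[i /existsP[e /eqP ce]] := forallP h1 j; exists i, e.
- case/orP: h2 => [hb|/forallP h]; [by left|right => i].
  by have := h i; case: (c i) => // -[[] j] // _; exists j.
- by apply/forallP => j; have [i [e ce]] := h1 j; apply/existsP; exists i; apply/existsP; exists e; apply/eqP.
- case: h2 => [->//|h]; apply/orP; right; apply/forallP => i.
  by have [j ->] := h i.
Qed.

Lemma valid_lact g c : g \in weyl n b -> valid c -> valid (lact g c).
Proof.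
move=> gW /validP[h1 h2]; apply/validP; split.
  move=> j; have [i [e ce]] := h1 j; exists ((g.2)^-1%g i).
  by exists (g.1 ((g.2)^-1%g i) (+) e); rewrite ffunE permKV ce.
case: h2 => [hb|h]; [by left|]; move: gW; rewrite inE => /orP[hb|/eqP g0]; [by left|right=> i].
by have [j cj] := h (g.2 i); exists j; rewrite ffunE cj g0 ffunE.
Qed.

Lemma valid_lrelabel t c : t \in weyl m b -> valid c -> valid (lrelabel t c).
Proof.
move=> tW /validP[h1 h2]; apply/validP; split.
  move=> j; have [i [e ce]] := h1 ((t.2)^-1%g j); exists i.
  by exists (e (+) t.1 ((t.2)^-1%g j)); rewrite ffunE ce /= permKV.
case: h2 => [hb|h]; [by left|]; move: tW; rewrite inE => /orP[hb|/eqP t0]; [by left|right=> i].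
by have [j cj] := h i; exists (t.2 j); rewrite ffunE cj /= t0 ffunE.
Qed.

Lemma lrelabelK t : cancel (lrelabel t) (lrelabel (sinv t)).
Proof.
move=> c; apply/ffunP => i; rewrite !ffunE; case: (c i) => [[e j]|] //=.
by rewrite ffunE permK addbK.
Qed.

Lemma valid_lrelabelE t c : t \in weyl m b -> valid (lrelabel t c) = valid c.
Proof.
move=> tW; apply/idP/idP; last exact: valid_lrelabel.
by move=> h; rewrite -(lrelabelK t c) valid_lrelabel ?sinv_weyl.
Qed.

(** A strictly decreasing positive reference point, which makes labels
    comparable. *)
Definition heights (j : 'I_m) : R := (m - j)%:R.

Lemma ev_heights_inj : injective (ev heights).
Proof.
have pos (j : 'I_m) : 0 < heights j by rewrite ltr0n subn_gt0.
have inj (j j' : 'I_m) : heights j = heights j' -> j = j'.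
  by move=> /eqP; rewrite eqr_nat => /eqP h; apply/val_inj => /=; case: j j' h => j hj [j' hj'] /=; lia.
have ne (j j' : 'I_m) : - heights j != heights j'.
  by rewrite lt_eqF // (lt_trans _ (pos j')) // oppr_lt0.
have n0 (e : bool) (j : 'I_m) : (-1) ^+ e * heights j != 0 by rewrite mulf_neq0 ?signr_eq0 ?gt_eqF.
move=> [[e j]|] [[e' j']|] //=; last 2 first.
- by move=> /eqP; rewrite (negbTE (n0 _ _)).
- by move=> /esym/eqP; rewrite (negbTE (n0 _ _)).
case: e e' => [] []; rewrite ?expr1 ?expr0 ?mul1r ?mulN1r.
- by move=> /oppr_inj/inj ->.
- by move=> /eqP; rewrite (negbTE (ne _ _)).
- by move=> /esym/eqP; rewrite (negbTE (ne _ _)).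
- by move=> /inj ->.
Qed.

Definition dominant_labeling c : bool := dominant b (fun i => ev heights (c i)).

Definition sorters c := [set g in weyl n b | dominant_labeling (lact g c)].

Definition stabilizer c := [set g in weyl n b | lact g c == c].

Lemma dominant_lact g c :
  dominant_labeling (lact g c) = dominant b (sact g (fun i => ev heights (c i))).
Proof. by apply: eq_dominant => i; rewrite ev_lact. Qed.

(** An orbit contains one dominant labeling only, so the elements that sort [c]
    form a coset of its stabilizer. *)
Lemma card_sorters c : #|sorters c| = #|stabilizer c|.
Proof.
have [g0 g0W d0] := exists_dominant b (fun i => ev heights (c i)).
suff -> : sorters c = [set smul g0 h | h in stabilizer c].
  by rewrite card_imset //; exact: smulI.
rewrite -dominant_lact in d0.
apply/setP => g; rewrite inE; apply/andP/imsetP => [[gW dg]|[h]]; last first.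
  by rewrite inE => /andP[hW /eqP hc] ->; rewrite smul_weyl // lact_smul hc.
exists (smul (sinv g0) g).
  rewrite inE smul_weyl ?sinv_weyl //=.
  rewrite lact_smul -[X in _ == X](lactK g0) (inj_eq (can_inj (lactK (sinv g0)))).
  apply/eqP/ffunP => i; apply: ev_heights_inj.
  have := dominant_unique (g := smul g (sinv g0)) (b := b) (z := fun i => ev heights (lact g0 c i)).
  rewrite smul_weyl ?sinv_weyl // -dominant_lact lact_smul lactK => /(_ isT d0 dg i).
  by rewrite -ev_lact lact_smul lactK.
by rewrite smulA smulgV smul1.
Qed.

Lemma stabilizer_lrelabel t c : stabilizer (lrelabel t c) = stabilizer c.
Proof.
apply/setP => g; rewrite !inE lact_lrelabel.
by rewrite (inj_eq (@lrelabel_inj t)).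
Qed.

Lemma card_sorters_lrelabel t c : #|sorters (lrelabel t c)| = #|sorters c|.
Proof. by rewrite !card_sorters stabilizer_lrelabel. Qed.

End Labels.
Section Blocks.
Variables (R : realFieldType) (b : bool) (n m : nat).
Hypotheses (n_gt0 : (0 < n)%N) (m_le_n : (m <= n)%N) (m_gt0 : b || (0 < m)%N).
Local Notation label := (option (bool * 'I_m)).
Local Notation labeling := {ffun 'I_n -> label}.
Implicit Types (S : {set 'I_n}) (c : labeling) (w : 'I_n -> R) (phi : 'I_m -> R).

(** The number of walls before position [k] that are not in [S]: the index of
    the block of [k] once the walls in [S] glue neighbours together. *)
Definition rank S (k : nat) : nat := #|[set j : 'I_n | (j < k)%N && (j \notin S)]|.

Lemma rank0 S : rank S 0 = 0%N.
Proof. by apply: eq_card0 => j; rewrite inE. Qed.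

Lemma rankS S (i : 'I_n) : rank S i.+1 = (rank S i + (i \notin S))%N.
Proof.
rewrite /rank; have [iS|iS] := boolP (i \in S).
  rewrite addn0; apply: eq_card => j; rewrite !inE ltnS leq_eqVlt.
  by have [/val_inj->|] := eqVneq (j : nat) i; rewrite /= ?iS ?andbF.
rewrite addn1 (_ : [set j : 'I_n | _ & _] = i |: [set j : 'I_n | (j < i)%N && (j \notin S)]).
  by rewrite cardsU1 inE ltnn.
apply/setP => j; rewrite !inE ltnS leq_eqVlt.
by have [/val_inj->|ne] := eqVneq (j : nat) i; rewrite ?iS ?eqxx //= -val_eqE /= (negbTE ne).
Qed.

Lemma rank_n S : rank S n = (n - #|S|)%N.
Proof.
have := cardsC S; rewrite card_ord => e.
rewrite -[X in (X - _)%N]e addKn; apply: eq_card => j.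
by rewrite !inE ltn_ord.
Qed.

Lemma rank_mono S k l : (k <= l)%N -> (rank S k <= rank S l)%N.
Proof.
move=> kl; apply: subset_leq_card; apply/fintype.subsetP => j; rewrite !inE => /andP[jk ->].
by rewrite (leq_trans jk kl).
Qed.

Definition standard_labeling S : labeling :=
  [ffun i : 'I_n => omap (pair false) (insub (rank S i))].

Definition admissible S : bool := (S \subset wall b n) && (#|S| == (n - m)%N).

Let last_lt : (n.-1 < n)%N.
Proof. by rewrite ltn_predL. Qed.

Let last_ord : 'I_n := Ordinal last_lt.

Lemma admissible_rank_n S : admissible S -> rank S n = m.
Proof. by move=> /andP[_ /eqP e]; rewrite rank_n e subKn. Qed.

Lemma rank_le S (i : 'I_n) : admissible S -> (rank S i <= m)%N.
Proof. by move=> /admissible_rank_n <-; apply: rank_mono; exact: ltnW. Qed.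

Lemma rank_lt S (i : 'I_n) : admissible S -> ~~ b -> (rank S i < m)%N.
Proof.
move=> aS hb; have lS : last_ord \notin S.
  move: aS => /andP[/fintype.subsetP SW _]; apply/negP => /SW; rewrite inE (negbTE hb) /=.
  by rewrite prednK // ltnn.
apply: leq_ltn_trans (rank_mono S (_ : (i <= last_ord)%N)) _.
  by case: i => i /= hi; lia.
have := rankS S last_ord; rewrite lS /= prednK // (admissible_rank_n aS) => ->.
by rewrite addn1.
Qed.

Lemma rank_step S j : (j < rank S n)%N -> exists2 i : 'I_n, rank S i = j & i \notin S.
Proof.
move=> jn; pose P k := (j < rank S k)%N.
have exP : exists k, P k by exists n.
case: (ex_minnP exP) => -[|k] Pk kmin; first by move: Pk; rewrite /P rank0.
have kn : (k < n)%N by exact: kmin.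
have := rankS S (Ordinal kn) => /= e; move: Pk; rewrite /P e => Pk.
have : ~~ (j < rank S k)%N by apply/negP => /kmin; rewrite ltnn.
rewrite -leqNgt => kj; exists (Ordinal kn).
  by move: Pk kj; rewrite /=; case: (_ \notin _) => /=; lia.
by apply/negP => iS; move: Pk; rewrite iS /= addn0 ltnNge kj.
Qed.

Lemma standard_labeling_lt S (i : 'I_n) (h : (rank S i < m)%N) :
  standard_labeling S i = Some (false, Ordinal h).
Proof. by rewrite ffunE insubT. Qed.

Lemma standard_labeling_ge S (i : 'I_n) : (m <= rank S i)%N ->
  standard_labeling S i = None.
Proof. by move=> h; rewrite ffunE insubN // -leqNgt. Qed.

Lemma standard_labeling_valid S : admissible S -> valid b (standard_labeling S).
Proof.
move=> aS; apply/validP; split.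
  move=> j; have [|i ri _] := @rank_step S j; first by rewrite admissible_rank_n.
  exists i, false; have h : (rank S i < m)%N by rewrite ri.
  by rewrite (standard_labeling_lt h); congr (Some (_, _)); apply/val_inj.
have [hb|hb] := boolP b; [by left|right => i].
by exists (Ordinal (rank_lt i aS hb)); rewrite -standard_labeling_lt.
Qed.

Lemma ordS_eq (i : 'I_n) (h : (i.+1 < n)%N) : ordS i = Ordinal h.
Proof. by apply/val_inj => /=; rewrite modn_small. Qed.

Lemma rank_last S (i : 'I_n) : admissible S -> ~~ (i.+1 < n)%N ->
  (rank S i + (i \notin S))%N = m.
Proof.
move=> aS hi; rewrite -rankS (_ : i.+1 = n) ?admissible_rank_n //.
by case: i hi => i /= hi; lia.
Qed.

(** Crossing a wall off [S] leads from one block to the next one. *)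
Lemma increment_standard S phi (i : 'I_n) : admissible S -> i \in wall b n ->
  if i \in S then increment (fun i => ev phi (standard_labeling S i)) i = 0
  else exists2 h : (rank S i < m)%N, Ordinal h \in wall b m &
    increment (fun i => ev phi (standard_labeling S i)) i = increment phi (Ordinal h).
Proof.
move=> aS iW; set w := fun i => ev phi (standard_labeling S i); rewrite /increment; case: ifPn => iS.
  case: ifPn => [hi|hi]; last first.
    rewrite /w standard_labeling_ge //.
    by have := rank_last aS hi; rewrite iS addn0 => ->.
  apply/eqP; rewrite subr_eq0 /w /standard_labeling !ffunE.
  by rewrite (ordS_eq hi) /= rankS iS addn0.
have h : (rank S i < m)%N.
  rewrite -(admissible_rank_n aS); apply: leq_trans (rank_mono S (ltn_ord i)).
  by rewrite rankS iS addn1.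
exists h.
  rewrite inE; have [//|hb] := boolP b; rewrite /=.
  move: iW; rewrite inE (negbTE hb) /= => hi.
  by have := rank_lt (Ordinal hi) aS hb; rewrite /= rankS iS addn1.
have wi : w i = phi (Ordinal h) by rewrite /w (standard_labeling_lt h) /= mul1r.
rewrite wi /=; case: ifPn => hi; last first.
  have := rank_last aS hi; rewrite iS addn1 => e.
  by rewrite e ltnn.
have rS : rank S (ordS i) = (rank S i).+1 by rewrite (ordS_eq hi) /= rankS iS addn1.
case: ifPn => hm.
  have h' : (rank S (ordS i) < m)%N by rewrite rS.
  rewrite /w (standard_labeling_lt h') /= mul1r; congr (_ - phi _).
  by apply/val_inj; rewrite [RHS](modn_small hm); exact: rS.
by rewrite /w standard_labeling_ge ?subr0 // rS leqNgt.
Qed.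

Lemma standard_dominant S phi : admissible S -> dominant b phi ->
  dominant b (fun i => ev phi (standard_labeling S i)).
Proof.
move=> aS /forall_inP dphi; apply/forall_inP => i iW.
have := increment_standard phi aS iW; case: ifP => _; first by move=> ->.
by move=> [h hW ->]; exact: dphi.
Qed.

(** A wall in [S] equates neighbouring coordinates, or the last one with zero,
    so a point on all these walls is constant on the blocks. *)
Lemma standard_factor S w : admissible S ->
  (forall i, i \in S -> increment w i = 0) ->
  exists phi, forall i, w i = ev phi (standard_labeling S i).
Proof.
move=> aS wS.
have wit (j : 'I_m) : exists i : 'I_n, rank S i = j /\ i \notin S.
  have [|i ri iS] := @rank_step S j; first by rewrite admissible_rank_n.
  by exists i.
have step (i : 'I_n) : i \in S -> if (i.+1 < n)%N then w i = w (ordS i) else w i = 0.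
  by move=> /wS; rewrite /increment; case: ifP => // _ /eqP; rewrite subr_eq0 => /eqP.
(* moving right inside a block, down to its last element or to the zero block *)
have walk k (i : 'I_n) : (n - i <= k)%N -> (forall i' : 'I_n, i' \notin S ->
    rank S i' = rank S i -> w i = w i') /\ ((rank S i = m) -> w i = 0).
  elim: k i => [|k ih] i hk; first by case: i hk => i /=; lia.
  have [iS|iS] := boolP (i \in S); last first.
    split=> [i' iS' e|e].
      congr w; apply/val_inj/eqP; rewrite eqn_leq; apply/andP; split; rewrite leqNgt;
        apply/negP => lt; have := rank_mono S lt; rewrite rankS ?iS ?iS' addn1 e ltnn //.
    have := rank_mono S (ltn_ord i); rewrite rankS iS addn1 (admissible_rank_n aS) e.
    by rewrite ltnn.
  have := step i iS; case: ifPn => hi wi.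
    have rS : rank S (ordS i) = rank S i by rewrite (ordS_eq hi) /= rankS iS addn0.
    have [|h1 h2] := ih (ordS i); first by rewrite val_ordS //; lia.
    rewrite wi; split=> [i' iS' e|e]; first by apply: h1; rewrite ?rS.
    by apply: h2; rewrite rS.
  split=> // i' iS' e; have := rank_last aS hi; rewrite iS addn0 -e => e'.
  have := rank_mono S (ltn_ord i'); rewrite rankS iS' addn1 (admissible_rank_n aS) e'.
  by rewrite ltnn.
have [f fP] := fin_all_exists wit.
exists (fun j => w (f j)) => i; have [h1 h2] := walk (n - i)%N i (leqnn _).
have [h|h] := ltnP (rank S i) m.
  rewrite (standard_labeling_lt h) /= mul1r; have [rf fS] := fP (Ordinal h).
  by apply: h1; rewrite ?rf.
rewrite standard_labeling_ge //=; apply: h2; apply/eqP.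
by rewrite eqn_leq rank_le.
Qed.

Lemma increment_block S (j : 'I_m) : admissible S -> j \in wall b m ->
  exists i : 'I_n, [/\ i \in wall b n, i \notin S & forall phi,
    increment (fun i => ev phi (standard_labeling S i)) i = increment phi j].
Proof.
move=> aS jW; have [|i ri iS] := @rank_step S j; first by rewrite admissible_rank_n.
have iW : i \in wall b n.
  rewrite inE; have [//|hb /=] := boolP b; rewrite ltnNge; apply/negP => hi.
  move: jW; rewrite inE (negbTE hb) /= -ri.
  by have := rank_last aS (i := i); rewrite -leqNgt hi iS addn1 => /(_ isT) ->; rewrite ltnn.
exists i; split=> // phi.
have := increment_standard phi aS iW; rewrite (negbTE iS) => -[h hW ->].
by rewrite (_ : Ordinal h = j) //; exact/val_inj.
Qed.

Lemma standard_factor_dominant S phi : admissible S ->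
  dominant b (fun i => ev phi (standard_labeling S i)) -> dominant b phi.
Proof.
move=> aS /forall_inP dw; apply/forall_inP => j jW.
by have [i [iW _ <-]] := increment_block aS jW; exact: dw.
Qed.

Lemma standard_factor_strict S phi : admissible S ->
  (forall i, i \in wall b n -> i \notin S ->
    0 < increment (fun i => ev phi (standard_labeling S i)) i) ->
  strictly_dominant b phi.
Proof.
move=> aS dw; apply/forall_inP => j jW.
by have [i [iW iS <-]] := increment_block aS jW; exact: dw.
Qed.

Lemma heights_increment (j : 'I_m) : j \in wall b m -> 0 < increment (heights R (m := m)) j.
Proof.
move=> jW; rewrite /increment /heights; case: ifPn => h.
  by rewrite subr_gt0 ltr_nat val_ordS //; lia.
by rewrite ltr0n subn_gt0.
Qed.

Lemma standard_labeling_inj : {in admissible &, injective standard_labeling}.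
Proof.
move=> S T aS aT e; apply/setP => i.
have sub S' T' : admissible S' -> admissible T' -> standard_labeling S' = standard_labeling T' ->
    i \in S' -> i \in T'.
  move=> aS' aT' e' iS; have iW : i \in wall b n by move: aS' => /andP[/fintype.subsetP/(_ i iS)].
  apply/negPn/negP => iT.
  have := increment_standard (heights R (m := m)) aS' iW; rewrite iS => i0.
  have := increment_standard (heights R (m := m)) aT' iW; rewrite (negbTE iT) => -[h hW].
  rewrite (eq_increment (w := fun i => ev (heights R (m := m)) (standard_labeling S' i))); last first.
    by move=> i'; rewrite e'.
  by rewrite i0 => e0; have := heights_increment hW; rewrite -e0 ltxx.
by apply/idP/idP; apply: sub.
Qed.

(** Conversely a valid labeling with decreasing heights is standard: the block
    index starts at zero and, no label being skipped, grows by unit steps. *)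
Lemma dominant_labeling_standard c : valid b c -> dominant_labeling R b c ->
  exists2 S, admissible S & c = standard_labeling S.
Proof.
move=> /validP[surj typ] dc.
pose rho i : nat := if c i is Some (_, j) then j else m.
have cE i : c i = omap (pair false) (insub (rho i)).
  rewrite /rho; case ci : (c i) => [[e j]|]; last by rewrite insubN ?ltnn.
  rewrite insubT ?ltn_ord // => h /=; rewrite (_ : e = false).
    by congr (Some (_, _)); exact/val_inj.
  case: typ => [hb|ht]; last by have [j'] := ht i; rewrite ci => -[].
  have := dominant_ge0 i dc hb; rewrite ci /=; case: (e) => //.
  by rewrite expr1 mulN1r oppr_ge0 /heights lern0 subn_eq0 leqNgt ltn_ord.
have rho_le i : (rho i <= m)%N by rewrite /rho; case: (c i) => [[e j]|] //; exact: ltnW.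
have rho_lt i : ~~ b -> (rho i < m)%N.
  case: typ => [-> //|ht _]; have [j cj] := ht i.
  by rewrite /rho cj.
have evE i : ev (heights R (m := m)) (c i) = (m - rho i)%:R.
  rewrite cE; case: insubP => [j _ <-|]; first by rewrite /= mul1r.
  by rewrite -leqNgt => h /=; rewrite (eqP h).
have rho_mono (i j : 'I_n) : (i <= j)%N -> (rho i <= rho j)%N.
  move=> ij; have := dominant_anti dc ij; rewrite !evE ler_nat.
  by have := rho_le i; have := rho_le j; lia.
have rho_surj j : (j < m)%N -> exists i, rho i = j.
  by move=> jm; have [i [e ci]] := surj (Ordinal jm); exists i; rewrite /rho ci.
pose S := [set i in wall b n | increment (fun i => ev (heights R (m := m)) (c i)) i == 0].
have SE i : i \in wall b n -> (i \in S) =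
    if (i.+1 < n)%N then rho (ordS i) == rho i else rho i == m.
  move=> iW; rewrite inE iW /= /increment !evE; case: ifP => hi.
    rewrite subr_eq0 eqr_nat; have := rho_le i; have := rho_le (ordS i).
    by move=> h1 h2; apply/eqP/eqP; lia.
  by rewrite pnatr_eq0; have := rho_le i => h; apply/eqP/eqP; lia.
have SW : S \subset wall b n by apply/fintype.subsetP => i; rewrite inE => /andP[].
have key k (kn : (k < n)%N) : rho (Ordinal kn) = rank S k.
  elim: k kn => [|k ih] kn.
    rewrite rank0; have [m0|m0] := posnP m; first by have := rho_le (Ordinal kn); lia.
    by have [i ri] := rho_surj 0%N m0; have := rho_mono (Ordinal kn) i (leq0n _); lia.
  pose i0 := Ordinal (ltnW kn); have o0 : ordS i0 = Ordinal kn by exact: ordS_eq.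
  have i0W : i0 \in wall b n by rewrite inE /= kn orbT.
  have := SE i0 i0W; rewrite /= kn o0 (rankS S i0) /= -(ih (ltnW kn)) -/i0 => ->.
  have le := rho_mono i0 (Ordinal kn) (leqnSn k).
  case: eqP => [->|/eqP ne] /=; first by rewrite addn0.
  (* at a jump, the label just above [rho i0] would be attained nowhere *)
  have [lt|gt|->//] := ltngtP (rho (Ordinal kn)) (rho i0 + 1)%N; first by lia.
  have [|i ri] := rho_surj (rho i0).+1; first by have := rho_le (Ordinal kn); lia.
  have [ik|ki] := leqP i k; first by have := rho_mono i i0 ik; lia.
  by have := rho_mono (Ordinal kn) i ki; lia.
have rn : rank S n = m.
  have lastE : last_ord.+1 = n by rewrite /= prednK.
  rewrite -[X in rank S X]lastE rankS -(key _ (ltn_ord last_ord)).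
  rewrite (_ : Ordinal _ = last_ord); last exact/val_inj.
  have big : (m <= (rho last_ord).+1)%N.
    have [->//|m0] := posnP m; have [|i ri] := rho_surj m.-1; first by lia.
    have il : (i <= last_ord)%N by case: i {ri} => i hi /=; lia.
    by have := rho_mono i last_ord il; rewrite ri; move: (rho last_ord) => r; lia.
  have [hb|hb] := boolP b.
    have lW : last_ord \in wall b n by rewrite inE hb.
    rewrite (SE _ lW) lastE ltnn; have := rho_le last_ord.
    by case: eqP => [->|/eqP]; rewrite ?addn0 //=; lia.
  have lS : last_ord \notin S.
    by apply: contra hb => /(fintype.subsetP SW); rewrite inE lastE ltnn orbF.
  by rewrite lS; have := rho_lt last_ord hb; lia.
exists S.
  rewrite /admissible SW andTb; have := rank_n S; rewrite rn => e.
  have h : (#|S| <= n)%N by rewrite -[X in (_ <= X)%N]card_ord max_card.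
  by rewrite e subKn.
by apply/ffunP => i; rewrite cE ffunE -(key _ (ltn_ord i)); congr (omap _ (insub (rho _))); exact/val_inj.
Qed.

Lemma standard_dominant_labeling S : admissible S ->
  dominant_labeling R b (standard_labeling S).
Proof.
move=> aS; apply: standard_dominant aS _; apply/forall_inP => j jW.
exact/ltW/heights_increment.
Qed.

(** The labelings attached to the pairs [(g, S)] are the valid ones, each hit as
    often as it has stabilizing elements, and relabeling does not change this
    multiplicity. So a function whose sum over the relabelings of any valid
    labeling is one has mean [1 / #|weyl m b|] over these pairs. *)
Theorem weyl_face_sum (f : labeling -> R) :
  (forall c, valid b c -> \sum_(t in weyl m b) f (lrelabel t c) = 1) ->
  #|weyl m b|%:R * (\sum_(g in weyl n b) \sum_(S | admissible S)
    f (lact (sinv g) (standard_labeling S))) =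
  #|weyl n b|%:R * #|[set S | admissible S]|%:R.
Proof.
move=> f1; pose N c := #|sorters R b c|.
have lactV g c : lact g (lact (sinv g) c) = c by rewrite -lact_smul smulgV lact1.
have inner_sum (h : labeling -> R) g : g \in weyl n b ->
    \sum_(S | admissible S) h (lact (sinv g) (standard_labeling S)) =
    \sum_(c | valid b c && dominant_labeling R b (lact g c)) h c.
  move=> gW; rewrite -[LHS]big_set /= -(big_imset (h := fun S => lact (sinv g) (standard_labeling S)) h).
    apply: eq_bigl => c; apply/imsetP/andP => [[S]|[vc dc]].
      rewrite inE => aS ->; rewrite lactV standard_dominant_labeling //.
      by rewrite valid_lact ?sinv_weyl ?standard_labeling_valid.
    have [|S aS e] := @dominant_labeling_standard (lact g c) _ dc; first exact: valid_lact.
    by exists S; rewrite ?inE // -e lactK.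
  move=> S T; rewrite !inE => aS aT e; apply: standard_labeling_inj => //.
  by rewrite -(lactV g (standard_labeling S)) e lactV.
have total (h : labeling -> R) :
    \sum_(g in weyl n b) \sum_(S | admissible S) h (lact (sinv g) (standard_labeling S)) =
    \sum_(c | valid b c) (N c)%:R * h c.
  rewrite (eq_bigr _ (inner_sum h)) /=.
  rewrite (exchange_big_dep (fun c => valid b c)) /=; last by move=> g c _ /andP[].
  apply: eq_bigr => c vc; rewrite /N -sum1_card natr_sum mulr_suml.
  rewrite -big_set /=; apply: eq_big => [g|g _]; last by rewrite mul1r.
  by rewrite !inE vc.
have relab t : t \in weyl m b ->
    \sum_(c | valid b c) (N c)%:R * f c =
    \sum_(c | valid b c) (N c)%:R * f (lrelabel t c).
  move=> tW; rewrite (reindex_inj (@lrelabel_inj n m t)) /=.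
  apply: eq_big => c; first exact: valid_lrelabelE.
  by rewrite /N card_sorters_lrelabel.
rewrite total mulr_natl -sumr_const (eq_bigr _ relab) exchange_big /=.
rewrite (eq_bigr (fun c => (N c)%:R * 1)); last first.
  by move=> c vc; rewrite -mulr_sumr f1.
rewrite -(total (fun=> 1)) (eq_bigr (fun=> #|[set S | admissible S]|%:R)).
  by rewrite sumr_const mulr_natl.
by move=> g _; rewrite -sum1_card natr_sum; apply: eq_bigl => S; rewrite inE.
Qed.

End Blocks.

Local Open Scope classical_set_scope.
Local Open Scope ring_scope.

(** * The inner product *)

Section InnerProduct.
Context {R : realType} {d : nat}.
Local Notation V := 'rV[R]_d.
Implicit Types (u v w x : V) (U L : {vspace V}).

Lemma innerC u v : inner u v = inner v u.
Proof. by apply: eq_bigr => i _; rewrite mulrC. Qed.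

Definition inner_with x : V -> R^o := fun v => inner v x.

Lemma inner_with_is_linear x : linear (inner_with x).
Proof.
move=> a u v; rewrite /inner_with /inner scaler_sumr -big_split /=.
by apply: eq_bigr => i _; rewrite !mxE mulrDl -mulrA.
Qed.

HB.instance Definition _ x :=
  GRing.isLinear.Build R V R^o _ (inner_with x) (inner_with_is_linear x).

Lemma innerDl x u v : inner (u + v) x = inner u x + inner v x.
Proof. exact: (linearD (inner_with x)). Qed.

Lemma innerBl x u v : inner (u - v) x = inner u x - inner v x.
Proof. exact: (linearB (inner_with x)). Qed.

Lemma innerZl x a u : inner (a *: u) x = a * inner u x.
Proof. exact: (linearZ_LR (inner_with x)). Qed.

Lemma inner0l x : inner 0 x = 0.
Proof. exact: (linear0 (inner_with x)). Qed.

Lemma innerNl x u : inner (- u) x = - inner u x.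
Proof. exact: (linearN (inner_with x)). Qed.

Lemma inner_suml x I (r : seq I) (P : pred I) (F : I -> V) :
  inner (\sum_(i <- r | P i) F i) x = \sum_(i <- r | P i) inner (F i) x.
Proof. exact: (linear_sum (inner_with x)). Qed.

Lemma innerDr x u v : inner x (u + v) = inner x u + inner x v.
Proof. by rewrite innerC innerDl !(innerC x). Qed.

Lemma innerBr x u v : inner x (u - v) = inner x u - inner x v.
Proof. by rewrite innerC innerBl !(innerC x). Qed.

Lemma innerZr x a u : inner x (a *: u) = a * inner x u.
Proof. by rewrite innerC innerZl !(innerC x). Qed.

Lemma innerNr x u : inner x (- u) = - inner x u.
Proof. by rewrite innerC innerNl !(innerC x). Qed.

Lemma inner0r x : inner x 0 = 0.
Proof. by rewrite innerC inner0l. Qed.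

Lemma inner_sumr x I (r : seq I) (P : pred I) (F : I -> V) :
  inner x (\sum_(i <- r | P i) F i) = \sum_(i <- r | P i) inner x (F i).
Proof. by rewrite innerC inner_suml; apply: eq_bigr => i _; rewrite innerC. Qed.

Lemma inner_ge0 v : 0 <= inner v v.
Proof. by apply: sumr_ge0 => i _; rewrite -expr2 sqr_ge0. Qed.

Lemma inner_eq0 v : (inner v v == 0) = (v == 0).
Proof.
apply/idP/idP => [|/eqP->]; last by rewrite inner0l.
rewrite /inner psumr_eq0 => [|i _]; last by rewrite -expr2 sqr_ge0.
move=> /allP h; apply/eqP/rowP => i; rewrite mxE; apply/eqP.
by have := h i (mem_index_enum _); rewrite /= mulf_eq0 orbb.
Qed.

Lemma inner_gt0 v : (0 < inner v v) = (v != 0).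
Proof. by rewrite lt0r inner_ge0 andbT inner_eq0. Qed.

Lemma inner_mulmx u v (Q : 'M[R]_d) :
  Q *m Q^T = 1%:M -> inner (u *m Q) (v *m Q) = inner u v.
Proof.
have innerE (a b : V) : inner a b = (a *m b^T) 0 0.
  by rewrite mxE; apply: eq_bigr => i _; rewrite mxE.
by move=> hQ; rewrite !innerE trmx_mul mulmxA -(mulmxA u) hQ mulmx1.
Qed.

(** A triangle inequality for squared distances, which spares square roots. *)
Lemma inner_weak_triangle u v w r : inner (u - v) (u - v) < r ->
  inner (v - w) (v - w) < r -> inner (u - w) (u - w) < 4 * r.
Proof.
rewrite (_ : u - w = (u - v) + (v - w)); last by rewrite addrA subrK.
move: (u - v) (v - w) => a b ha hb.
have := inner_ge0 (a - b); rewrite !innerDl !innerDr !innerNl !innerNr.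
move: ha hb; rewrite (innerC b a); lra.
Qed.

Lemma inner_continuous x : continuous (inner ^~ x : V -> R).
Proof.
apply: continuous_big => [|i _]; first exact: add_continuous.
move=> v; apply: (cvgM (@coord_continuous R 1 d 0 i v) (cvg_cst _)).
Qed.

Lemma inner_sqr_continuous x :
  continuous ((fun v => inner (v - x) (v - x)) : V -> R).
Proof.
apply: continuous_big => [|i _ v]; first exact: add_continuous.
rewrite (_ : (fun w : V => _) =
    (fun w : V => (w 0 i - x 0 i) * (w 0 i - x 0 i))); last first.
  by apply/funext => w; rewrite !mxE.
have h : {for v, continuous (fun w : V => w 0 i - x 0 i)}.
  by apply: continuousB; [exact: (@coord_continuous R 1 d 0 i v)|exact: cst_continuous].
exact: (continuousM h h).
Qed.

Lemma open_inner_sqr_lt x (r : R) : open [set v : V | inner (v - x) (v - x) < r].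
Proof.
have /continuousP h := @inner_sqr_continuous x.
exact: (h _ (open_lt (y := r))).
Qed.

(** Euclidean balls are compared with those of the sup norm, which define the
    topology. *)
Lemma open_inner_ball (G : set V) v : open G -> G v ->
  exists2 e : R, 0 < e & forall w, inner (w - v) (w - v) < e -> G w.
Proof.
rewrite openE => oG /oG /nbhs_ballP [e /= e0 he].
exists (e ^+ 2); first exact: exprn_gt0.
move=> w hw; apply: he => //=; split=> // i j.
rewrite /ball /= (ord1 i) distrC -(ltr_pXn2r (n := 2)) ?nnegrE ?(ltW e0) //.
apply: le_lt_trans hw; rewrite real_normK ?num_real // /inner (bigD1 j) //=.
rewrite !mxE expr2 lerDl; apply: sumr_ge0 => l _.
by rewrite -expr2 sqr_ge0.
Qed.
Lemma inner_ball_open (G : set V) :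
  (forall v, G v ->
    exists2 e : R, 0 < e & forall w, inner (w - v) (w - v) < e -> G w) ->
  open G.
Proof.
move=> h; rewrite openE => v /h [e e0 he].
apply: filterS he _; apply: open_nbhs_nbhs; split; first exact: open_inner_sqr_lt.
by rewrite /= subrr inner0l.
Qed.
End InnerProduct.

(** * Subspaces as annihilators *)

Section Annihilators.
Context {R : realType} {d : nat}.
Local Notation V := 'rV[R]_d.
Implicit Types (u v w x : V) (U L : {vspace V}) (X : seq V).

Definition perpv x : {vspace V} := lker (linfun (inner_with x)).

Lemma mem_perpv x v : (v \in perpv x) = (inner v x == 0).
Proof. by rewrite memv_ker lfunE. Qed.

Lemma dim_cap_perpv U x : (\dim U <= (\dim (U :&: perpv x)).+1)%N.
Proof.
rewrite -(limg_ker_dim (linfun (inner_with x)) U) -[X in (_ <= X)%N]addn1.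
by rewrite leq_add2l (leq_trans (dimvS (subvf _))) // dimvf.
Qed.

Definition ann X : {vspace V} := (\bigcap_(x <- X) perpv x)%VS.

Lemma mem_ann X v : (v \in ann X) = all (fun x => inner v x == 0) X.
Proof.
rewrite /ann; elim: X => [|x X ih]; first by rewrite big_nil memvf.
by rewrite big_cons memv_cap ih /= mem_perpv.
Qed.

Lemma dim_cap_ann U X : (\dim U <= \dim (U :&: ann X) + size X)%N.
Proof.
rewrite /ann; elim: X => [|x X ih]; first by rewrite big_nil capvf addn0.
rewrite big_cons (capvC (perpv x)) capvA /= addnS -addSn.
by apply: leq_trans ih _; rewrite leq_add2r dim_cap_perpv.
Qed.

Lemma dim_ann_free X : free X -> \dim (ann X) = (d - size X)%N.
Proof.
move=> /eqP fX; have lo := dim_cap_ann fullv X.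
rewrite capfv dimvf /= in lo.
have dX : (ann X :&: <<X>>)%VS = 0%VS.
  apply/eqP; rewrite -subv0; apply/subvP => v; rewrite memv_cap mem_ann.
  move=> /andP[/allP h vX]; have e := coord_span (X := in_tuple X) vX.
  rewrite memv0 -inner_eq0 {2}e inner_sumr.
  apply/eqP; rewrite big1 // => i _; rewrite innerZr.
  by rewrite (eqP (h _ _)) ?mulr0 // mem_nth.
have := dimv_disjoint_sum dX; rewrite fX => e.
have := dimvS (subvf (ann X + <<X>>)%VS); rewrite e dimvf.
move: lo; rewrite /dim /= mul1n; lia.
Qed.

(** The components of the projection with kernel [U] are the equations. *)
Lemma vspace_inner_eqs U : exists c : 'I_d -> V,
  forall v, v \in U <-> forall j, inner v (c j) = 0.
Proof.
pose f := (\1 - projv U)%VF.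
exists (fun j => \row_i f (delta_mx 0 i) 0 j) => v.
have e j : inner v (\row_i f (delta_mx 0 i) 0 j) = f v 0 j.
  rewrite [in RHS](row_sum_delta v) linear_sum summxE; apply: eq_bigr => i _.
  by rewrite linearZ /= !mxE.
have fE : (v \in U) = (f v == 0).
  rewrite add_lfunE opp_lfunE id_lfunE subr_eq0; apply/idP/eqP => [|->].
    by move=> vU; rewrite projv_id.
  exact: memv_proj.
rewrite fE; split=> [/eqP h j|h]; first by rewrite e h mxE.
by apply/eqP/rowP => j; rewrite -e h mxE.
Qed.

Lemma inner_closed (D : set R) x : closed D -> closed [set v : V | D (inner v x)].
Proof.
by move=> cD; apply: (preimage_closed (f := inner ^~ x)) => // v _; exact: inner_continuous.
Qed.

Lemma inner_eq0_closed x : closed [set v : V | inner v x = 0].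
Proof. exact: (inner_closed (x := x) (closed_eq (y := 0))). Qed.

Lemma inner_ge0_closed x : closed [set v : V | 0 <= inner v x].
Proof. exact: (inner_closed (x := x) (closed_ge (y := 0))). Qed.

Lemma vspace_closed U : closed [set v : V | v \in U].
Proof.
have [c hc] := vspace_inner_eqs U.
rewrite (_ : [set _ | _] = \bigcap_j [set v | inner v (c j) = 0]).
  by apply: closed_bigI => j _; exact: inner_eq0_closed.
by apply/seteqP; split=> v /= => [/hc h j _|h]; [exact: h|apply/hc => j; exact: h].
Qed.

(** The equations of orthogonality to [U] are fewer than the dimension of [L].
    *)
Lemma exists_orthogonal U L : (\dim U < \dim L)%N ->
  exists2 w, w \in L & w != 0 /\ forall u, u \in U -> inner u w = 0.
Proof.
move=> UL; have := dim_cap_ann L (vbasis U); rewrite size_tuple => h.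
have : (L :&: ann (vbasis U))%VS != 0%VS.
  by apply/eqP => e; move: h; rewrite e dimv0 leqNgt UL.
rewrite -vpick0 => w0; exists (vpick (L :&: ann (vbasis U))%VS).
  by have := memv_pick (L :&: ann (vbasis U)); rewrite memv_cap => /andP[].
split=> // u /coord_vbasis ->; rewrite inner_suml big1 // => i _; rewrite innerZl.
have := memv_pick (L :&: ann (vbasis U)); rewrite memv_cap mem_ann.
move=> /andP[_ /allP ha]; rewrite innerC (eqP (ha _ _)) ?mulr0 //.
by rewrite mem_nth // size_tuple.
Qed.

Lemma closed_borel (A : set V) : closed A -> measurable (A : set (borel R d)).
Proof.
move=> cA; rewrite -(setCK A); apply: measurableC; apply: sub_sigma_algebra.
exact: closed_openC.
Qed.

End Annihilators.

(** * Covering numbers and an invariant content *)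

Section UltrafilterLimit.
Context {R : realType} (F : set_system nat) {FU : UltraFilter F}.
Hypothesis F_oo : \oo `<=` F.
Implicit Types u v w : nat -> R.

Definition ultralim u : R := lim (u n @[n --> F]).

(** By compactness every bounded sequence converges along an ultrafilter. One
    ultrafilter serves all sets at once, which no choice of a subsequence would
    do. *)
Lemma cvg_ultralim u : (forall n, 0 <= u n <= 1) ->
  u n @[n --> F] --> ultralim u.
Proof.
move=> hu; have FF : ProperFilter F := @ultra_proper _ F FU.
suff : exists l : R, u n @[n --> F] --> l.
  by move=> [l hl]; rewrite /ultralim (cvg_lim _ hl).
have cpt : compact `[0, 1 : R] := segment_compact (a := 0) (b := 1).
have uA : (u n @[n --> F]) [set` `[0, 1]].
  apply: (@filterS _ F _ setT); last exact: filterT.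
  by move=> n _; rewrite /= in_itv /=.
have [l [_ cl]] := cpt _ _ uA.
exists l => A /= Al; have [//|FA] := in_ultra_setVsetC (u @^-1` A) FU.
have [x []] := cl _ A (FA : (u n @[n --> F]) (~` A)) Al.
by [].
Qed.

Lemma ultralim_eq u (l : R) : (\forall n \near \oo, u n = l) -> ultralim u = l.
Proof.
move=> /F_oo hu; have FF : ProperFilter F := @ultra_proper _ F FU.
by apply/cvg_lim => //; apply: cvg_near_cst.
Qed.

Lemma le_ultralim u v : (forall n, 0 <= u n <= 1) ->
  (forall n, 0 <= v n <= 1) -> (\forall n \near \oo, u n <= v n) ->
  ultralim u <= ultralim v.
Proof.
move=> hu hv /F_oo huv; have FF : ProperFilter F := @ultra_proper _ F FU.
exact: ler_cvg_to (cvg_ultralim hu) (cvg_ultralim hv) huv.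
Qed.

Lemma ultralim_leD u v w : (forall n, 0 <= u n <= 1) ->
  (forall n, 0 <= v n <= 1) -> (forall n, 0 <= w n <= 1) ->
  (\forall n \near \oo, w n <= u n + v n) ->
  ultralim w <= ultralim u + ultralim v.
Proof.
move=> hu hv hw /F_oo h; have FF : ProperFilter F := @ultra_proper _ F FU.
have hD : u n + v n @[n --> F] --> ultralim u + ultralim v.
  exact: cvgD (cvg_ultralim hu) (cvg_ultralim hv).
exact: ler_cvg_to (cvg_ultralim hw) hD h.
Qed.

Lemma ultralim_geD u v w : (forall n, 0 <= u n <= 1) ->
  (forall n, 0 <= v n <= 1) -> (forall n, 0 <= w n <= 1) ->
  (\forall n \near \oo, u n + v n <= w n) ->
  ultralim u + ultralim v <= ultralim w.
Proof.
move=> hu hv hw /F_oo h; have FF : ProperFilter F := @ultra_proper _ F FU.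
have hD : u n + v n @[n --> F] --> ultralim u + ultralim v.
  exact: cvgD (cvg_ultralim hu) (cvg_ultralim hv).
exact: ler_cvg_to hD (cvg_ultralim hw) h.
Qed.

End UltrafilterLimit.

Section CoveringNumber.
Context {R : realType} {d : nat}.
Local Notation V := 'rV[R]_d.
Variable X : set V.
Hypotheses (cX : compact X) (X0 : X !=set0).
Implicit Types (A B : set V) (r : R) (s : seq V).

Definition covers A r s :=
  forall a, X a -> A a -> exists2 c, c \in s & inner (a - c) (a - c) < r.

Lemma exists_cover r : 0 < r -> exists s, covers setT r s.
Proof.
move=> r0; move: cX; rewrite compact_cover.
move=> /(_ V X (fun c => [set a | inner (a - c) (a - c) < r])) [c _||D _ hD].
- exact: open_inner_sqr_lt.
- by move=> a Xa; exists a => //=; rewrite subrr inner0l.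
exists (D : seq V) => a Xa _; have [c /= cD h] := hD a Xa.
by exists c.
Qed.

Lemma exists_cover_size A r : 0 < r ->
  exists n, `[< exists2 s, size s = n & covers A r s >].
Proof.
move=> /exists_cover [s hs]; exists (size s); apply/asboolP; exists s => //.
by move=> a Xa _; exact: hs.
Qed.

(** Coverings of minimal size are available for positive radii only, whence the
    default value. *)
Definition covnum A r : nat :=
  if pselect (0 < r) is left r0 then ex_minn (exists_cover_size A r0) else 0%N.

Lemma covnumP A r : 0 < r ->
  (exists2 s, size s = covnum A r & covers A r s) /\
  (forall s, covers A r s -> (covnum A r <= size s)%N).
Proof.
move=> r0; rewrite /covnum; case: pselect => // r0'; case: ex_minnP.
move=> n /asboolP h hmin; split=> // s hs; apply: hmin; apply/asboolP.
by exists s.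
Qed.

Lemma covnum_sub A B r : 0 < r -> X `&` A `<=` B ->
  (covnum A r <= covnum B r)%N.
Proof.
move=> r0 AB; have [[s <- hs] _] := covnumP B r0.
by apply: (covnumP A r0).2 => a Xa Aa; apply: hs => //; exact: AB.
Qed.

Lemma covnumU A B r : 0 < r ->
  (covnum (A `|` B) r <= covnum A r + covnum B r)%N.
Proof.
move=> r0; have [[s <- hs] _] := covnumP A r0.
have [[t <- ht] _] := covnumP B r0.
rewrite -size_cat; apply: (covnumP _ r0).2 => a Xa [/(hs _ Xa)|/(ht _ Xa)] [c].
- by move=> cs h; exists c => //; rewrite mem_cat cs.
- by move=> cs h; exists c => //; rewrite mem_cat cs orbT.
Qed.

(** A ball of radius small with respect to the gap between two sets meets at
    most one of them, so a cover of the union splits. *)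
Lemma covnumU_separated A B r e : 0 < r -> 4 * r <= e ->
  (forall a b, X a -> A a -> X b -> B b -> e <= inner (a - b) (a - b)) ->
  (covnum A r + covnum B r <= covnum (A `|` B) r)%N.
Proof.
move=> r0 re sep; have [[s <- hs] _] := covnumP (A `|` B) r0.
pose P c := `[< exists a, [/\ X a, A a & inner (a - c) (a - c) < r] >].
rewrite -(count_predC P) -!size_filter leq_add //.
- apply: (covnumP _ r0).2 => a Xa Aa; have [c cs h] := hs a Xa (or_introl Aa).
  exists c => //; rewrite mem_filter cs andbT; apply/asboolP.
  by exists a.
- apply: (covnumP _ r0).2 => b Xb Bb; have [c cs h] := hs b Xb (or_intror Bb).
  exists c => //; rewrite mem_filter cs andbT /=; apply/asboolP => -[a [Xa Aa h']].
  have := sep a b Xa Aa Xb Bb; rewrite leNgt => /negP; apply.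
  apply: lt_le_trans re; apply: inner_weak_triangle h' _.
  by rewrite -opprB innerNl innerNr opprK.
Qed.

Lemma covnum0 r : 0 < r -> covnum set0 r = 0%N.
Proof.
move=> r0; apply/eqP; rewrite -leqn0 -[0%N]/(size ([::] : seq V)).
by apply: (covnumP _ r0).2.
Qed.

Lemma covnumT_gt0 r : 0 < r -> (0 < covnum setT r)%N.
Proof.
move=> r0; have [[s <- hs] _] := covnumP setT r0.
by case: X0 => a Xa; have [c] := hs a Xa I; case: s {hs}.
Qed.

Lemma covnum_le A r : 0 < r -> (covnum A r <= covnum setT r)%N.
Proof. by move=> r0; exact: covnum_sub. Qed.

Lemma covnum_isometry A r (Q : 'M[R]_d) : 0 < r -> Q *m Q^T = 1%:M ->
  (forall v, X v <-> X (v *m Q)) ->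
  covnum [set v | A (v *m Q)] r = covnum A r.
Proof.
move=> r0 hQ XQ; have hQ' : Q^T *m Q = 1%:M by exact: mulmx1C.
apply/eqP; rewrite eqn_leq; apply/andP; split.
- have [[s <- hs] _] := covnumP A r0.
  rewrite -(size_map (fun v => v *m Q^T)); apply: (covnumP _ r0).2.
  move=> a /XQ Xa Aa; have [c cs h] := hs _ Xa Aa.
  exists (c *m Q^T); first exact: map_f.
  rewrite -(inner_mulmx _ _ hQ) mulmxBl -mulmxA hQ' mulmx1 //.
- have [[s <- hs] _] := covnumP [set v | A (v *m Q)] r0.
  rewrite -(size_map (fun v => v *m Q)); apply: (covnumP _ r0).2 => a Xa Aa.
  have aQ : a = a *m Q^T *m Q by rewrite -mulmxA hQ' mulmx1.
  have [||c cs h] := hs (a *m Q^T); rewrite /= -?aQ //; first by apply/XQ; rewrite -aQ.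
  exists (c *m Q); first exact: map_f.
  by rewrite (_ : a - c *m Q = (a *m Q^T - c) *m Q) ?inner_mulmx // mulmxBl -aQ.
Qed.

End CoveringNumber.

Section HaarContent.
Context {R : realType} {d : nat}.
Local Notation V := 'rV[R]_d.
Variables (X : set V) (F : set_system nat).
Hypotheses (cX : compact X) (X0 : X !=set0) (FU : UltraFilter F)
  (F_oo : \oo `<=` F).
Implicit Types (A B G : set V) (e : R).

Let radius (n : nat) : R := n.+1%:R^-1.

Let radius_gt0 n : 0 < radius n.
Proof. by rewrite invr_gt0. Qed.

Let ratio A n : R := (covnum cX A (radius n))%:R / (covnum cX setT (radius n))%:R.

Let ratio_bound A n : 0 <= ratio A n <= 1.
Proof.
rewrite divr_ge0 //= ler_pdivrMr ?ltr0n ?covnumT_gt0 // mul1r ler_nat.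
exact: covnum_le.
Qed.

(** Haar's construction: the size of [A] relative to [X], measured by the
    numbers of balls of the same small radius that cover them. *)
Definition haar_content A : R := ultralim F (ratio A).

Lemma haar_content_ge0 A : 0 <= haar_content A.
Proof.
have <- : ultralim F (fun=> 0 : R) = 0 by apply: ultralim_eq => //; near=> n.
apply: le_ultralim => // [n|]; first by rewrite lexx ler01.
by near=> n; have /andP[] := ratio_bound A n.
Unshelve. all: by end_near. Qed.

Lemma haar_contentT A : X `<=` A -> haar_content A = 1.
Proof.
move=> XA; apply: ultralim_eq => //; near=> n.
rewrite /ratio (_ : covnum cX A _ = covnum cX setT (radius n)).
  by rewrite divff // pnatr_eq0 -lt0n covnumT_gt0.
by apply/eqP; rewrite eqn_leq !covnum_sub // => v [Xv _]; exact: XA.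
Unshelve. all: by end_near. Qed.

Lemma haar_content0 : haar_content set0 = 0.
Proof.
apply: ultralim_eq => //; near=> n.
by rewrite /ratio covnum0 // mul0r.
Unshelve. all: by end_near. Qed.

Lemma haar_content_sub A B : X `&` A `<=` B -> haar_content A <= haar_content B.
Proof.
move=> AB; apply: le_ultralim => //; near=> n.
by rewrite ler_pM2r ?invr_gt0 ?ltr0n ?covnumT_gt0 // ler_nat covnum_sub.
Unshelve. all: by end_near. Qed.

Lemma haar_contentU A B : haar_content (A `|` B) <= haar_content A + haar_content B.
Proof.
apply: ultralim_leD => //; near=> n; rewrite -mulrDl.
by rewrite ler_pM2r ?invr_gt0 ?ltr0n ?covnumT_gt0 // -natrD ler_nat covnumU.
Unshelve. all: by end_near. Qed.

Lemma haar_contentU_separated A B e : 0 < e ->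
  (forall a b, X a -> A a -> X b -> B b -> e <= inner (a - b) (a - b)) ->
  haar_content A + haar_content B <= haar_content (A `|` B).
Proof.
move=> e0 sep; apply: ultralim_geD => //; near=> n; rewrite -mulrDl.
rewrite ler_pM2r ?invr_gt0 ?ltr0n ?covnumT_gt0 // -natrD ler_nat.
apply: covnumU_separated sep => //.
rewrite -ler_pdivlMl // ltW //; near: n.
have e4 : 0 < 4^-1 * e by rewrite mulr_gt0 ?invr_gt0.
exact: (near_infty_natSinv_lt (PosNum e4)).
Unshelve. all: by end_near. Qed.

Lemma haar_content_isometry A (Q : 'M[R]_d) : Q *m Q^T = 1%:M ->
  (forall v, X v <-> X (v *m Q)) ->
  haar_content [set v | A (v *m Q)] = haar_content A.
Proof.
move=> hQ XQ; rewrite /haar_content; congr ultralim; apply/funext => n.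
by rewrite /ratio covnum_isometry.
Qed.

(** The points of [X] that lie in [G] together with a neighbourhood of fixed
    size. Measuring an open set by these makes the content regular from within.
    *)
Definition shrink G e : set V :=
  [set x | X x /\ forall y, X y -> inner (y - x) (y - x) < e -> G y].

Definition open_content G : R := sup [set haar_content (shrink G e) | e in [set e | 0 < e]].

Lemma open_content_has_sup G :
  has_sup [set haar_content (shrink G e) | e in [set e | 0 < e]].
Proof.
split; first by exists (haar_content (shrink G 1)), 1 => //=.
exists 1 => _ [e _ <-]; rewrite -(haar_contentT (A := setT)) //.
exact: haar_content_sub.
Qed.

Lemma haar_content_shrink_le G e : 0 < e -> haar_content (shrink G e) <= open_content G.
Proof. by move=> e0; apply: ub_le_sup; [exact: (open_content_has_sup G).2|exists e]. Qed.

Lemma open_content_le G (c : R) :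
  (forall e, 0 < e -> haar_content (shrink G e) <= c) -> open_content G <= c.
Proof.
move=> h; apply: ge_sup; first exact: (open_content_has_sup G).1.
by move=> _ [e e0 <-]; exact: h.
Qed.

Lemma open_content_ge0 G : 0 <= open_content G.
Proof. exact: le_trans (haar_content_ge0 _) (haar_content_shrink_le G ltr01). Qed.

Lemma open_content0 : open_content set0 = 0.
Proof.
apply/le_anti; rewrite open_content_ge0 andbT; apply: open_content_le => e e0.
rewrite -haar_content0; apply: haar_content_sub => x [_ [Xx]].
by apply=> //; rewrite subrr inner0l.
Qed.

Lemma open_contentT G : X `<=` G -> open_content G = 1.
Proof.
move=> XG; have h e : 0 < e -> haar_content (shrink G e) = 1.
  by move=> e0; apply: haar_contentT => x Xx; split=> // y Xy _; exact: XG.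
apply/le_anti/andP; split; first by apply: open_content_le => e /h ->.
by rewrite -(h 1) //; exact: haar_content_shrink_le.
Qed.

Lemma open_content_isometry G (Q : 'M[R]_d) : Q *m Q^T = 1%:M ->
  (forall v, X v <-> X (v *m Q)) ->
  open_content [set v | G (v *m Q)] = open_content G.
Proof.
move=> hQ XQ; congr sup; apply/seteqP.
have sQ e : shrink [set v | G (v *m Q)] e = [set v | shrink G e (v *m Q)].
  have hQ' : Q^T *m Q = 1%:M by exact: mulmx1C.
  apply/seteqP; split=> v [] /= Xv h.
    split=> [|y Xy hy]; first exact/(XQ v).1.
    rewrite -(mulmx1 y) -hQ' mulmxA; apply: h.
      by apply/XQ; rewrite -mulmxA hQ' mulmx1.
    by rewrite -(inner_mulmx _ _ hQ) mulmxBl -mulmxA hQ' mulmx1.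
  split=> [|y /(XQ y).1 Xy hy]; first exact/(XQ v).2.
  by apply: h => //; rewrite -mulmxBl inner_mulmx.
by split=> _ [e e0 <-]; exists e => //; rewrite sQ haar_content_isometry.
Qed.

(** Compactness of [X] provides a Lebesgue number for the cover, which reduces
    countable subadditivity to the finite one. *)
Lemma open_content_bigcup (G : nat -> set V) : (forall i, open (G i)) ->
  ((open_content (\bigcup_i G i))%:E <=
   \sum_(0 <= i <oo) (open_content (G i))%:E)%E.
Proof.
move=> oG.
have fin n : haar_content (\bigcup_(i in `I_n) shrink (G i) n.+1%:R^-1) <=
    \sum_(0 <= i < n) open_content (G i).
  have : 0 < n.+1%:R^-1 :> R by rewrite invr_gt0.
  move: (n.+1%:R^-1) => e e0; elim: n => [|n ih].
    by rewrite big_geq // II0 bigcup_set0 haar_content0.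
  rewrite big_nat_recr //= IIS bigcup_setU bigcup_set1.
  by apply: le_trans (haar_contentU _ _) _; rewrite lerD // haar_content_shrink_le.
(* for a Lebesgue number of the cover, finitely many shrunk sets are enough *)
have key e : 0 < e -> exists n,
    shrink (\bigcup_i G i) e `<=` \bigcup_(i in `I_n) shrink (G i) n.+1%:R^-1.
  move=> e0; have /compact_near_coveringP nc := cX.
  have := nc nat \oo (fun n x => shrink (\bigcup_i G i) e x ->
    (\bigcup_(i in `I_n) shrink (G i) n.+1%:R^-1) x) _.
  have hX x : X x -> \forall x' \near x & n \near \oo,
      shrink (\bigcup_i G i) e x' ->
      (\bigcup_(i in `I_n) shrink (G i) n.+1%:R^-1) x'.
    move=> Xx; have [[i _ Gix]|nGx] := pselect ((\bigcup_i G i) x).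
      have [r r0 hr] := open_inner_ball (oG i) Gix.
      exists ([set v | inner (v - x) (v - x) < r / 4],
              [set n | (i < n)%N /\ n.+1%:R^-1 < r / 4]).
        split=> /=.
          apply: open_nbhs_nbhs; split; first exact: open_inner_sqr_lt.
          by rewrite /= subrr inner0l divr_gt0.
        apply: filterI; first exact: nbhs_infty_gt.
        have r4 : 0 < r / 4 by rewrite divr_gt0.
        exact: (near_infty_natSinv_lt (PosNum r4)).
      move=> [v n] /= [hv [lt_in hn]] [Xv _]; exists i => //; split=> // y Xy hy.
      apply: hr; rewrite (_ : r = 4 * (r / 4)); last by field.
      by apply: inner_weak_triangle hv; exact: lt_trans hn.
    exists ([set v | inner (v - x) (v - x) < e], setT).
      split=> /=; last exact: filterT.
      apply: open_nbhs_nbhs; split; first exact: open_inner_sqr_lt.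
      by rewrite /= subrr inner0l.
    move=> [v n] /= [hv _] [Xv h]; exfalso; apply: nGx; apply: h => //.
    by rewrite -opprB innerNl innerNr opprK.
  move=> /(_ _ hX) [n _ hn]; exists n => v sv; apply: (hn n) => //=.
  by case: sv.
have sum_le n : ((\sum_(0 <= i < n) open_content (G i))%:E <=
    \sum_(0 <= i <oo) (open_content (G i))%:E)%E.
  rewrite -sumEFin; apply: nneseries_lim_ge => i _ _.
  by rewrite lee_fin open_content_ge0.
have [->|fin_sum] := eqVneq (\sum_(0 <= i <oo) (open_content (G i))%:E)%E +oo%E.
  by rewrite leey.
have sum_fin : (\sum_(0 <= i <oo) (open_content (G i))%:E)%E \is a fin_num.
  rewrite ge0_fin_numE ?ltey //; apply: nneseries_ge0 => i _ _.
  by rewrite lee_fin open_content_ge0.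
rewrite -(fineK sum_fin) lee_fin; apply: open_content_le => e /key [n hn].
rewrite -lee_fin fineK //; apply: le_trans (sum_le n).
rewrite lee_fin; apply: le_trans (fin n); apply: haar_content_sub.
by move=> v [_ /hn].
Qed.

End HaarContent.

(** * Invariant probability measures on compact sets *)

(** The Caratheodory-measurable sets form a sigma-algebra, so they include all
    Borel sets as soon as they include the closed ones. *)
Lemma outer_measure_borel_probability {R : realType} {d : nat}
    (om : {outer_measure set 'rV[R]_d -> \bar R}) :
  (forall A, closed A -> om.-caratheodory A) -> om setT = 1%E ->
  exists P : probability (borel R d) R, forall A, P A = om A.
Proof.
move=> hcl om1.
have sub (A : set (borel R d)) : measurable A -> om.-caratheodory A.
  apply: smallest_sub => [|B oB].
    split; first exact: caratheodory_measurable_set0.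
      by move=> B mB; rewrite setTD; exact: caratheodory_measurable_setC.
    exact: caratheodory_measurable_bigcup.
  rewrite -(setCK B); apply/caratheodory_measurable_setC/hcl.
  exact: open_closedC.
have sa : semi_sigma_additive (om : set (borel R d) -> \bar R).
  move=> A mA tA mU; apply: (@caratheodory_measure_sigma_additive _ _ om) => //.
  - by move=> i; exact: sub.
  - exact: sub.
pose M := isMeasure.Build _ (borel R d) R om (outer_measure0 om)
  (outer_measure_ge0 om) sa.
pose mu : {measure set (borel R d) -> \bar R} :=
  HB.pack (om : set (borel R d) -> \bar R) M.
pose MP := Measure_isProbability.Build _ _ _ mu om1.
pose P : probability (borel R d) R := HB.pack (om : set (borel R d) -> \bar R) M MP.
by exists P.
Qed.

Section HaarMeasure.
Context {R : realType} {d : nat}.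
Local Notation V := 'rV[R]_d.
Variables (X : set V) (F : set_system nat).
Hypotheses (cX : compact X) (X0 : X !=set0) (FU : UltraFilter F)
  (F_oo : \oo `<=` F).
Implicit Types (A B G : set V) (e : R).
Local Notation mo := (open_content F cX).
Local Notation sh := (shrink X).

Definition haar_outer A : \bar R :=
  ereal_inf [set (mo G)%:E | G in [set G | open G /\ X `&` A `<=` G]].

Lemma haar_outer_le A G : open G -> X `&` A `<=` G -> (haar_outer A <= (mo G)%:E)%E.
Proof. by move=> oG AG; apply: ereal_inf_lbound; exists G. Qed.

Lemma haar_outer_ge A (c : \bar R) :
  (forall G, open G -> X `&` A `<=` G -> (c <= (mo G)%:E)%E) ->
  (c <= haar_outer A)%E.
Proof. by move=> h; apply: le_ereal_inf_tmp => _ [G [oG AG] <-]; exact: h. Qed.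

Lemma haar_outer_ge0 A : (0 <= haar_outer A)%E.
Proof. by apply: haar_outer_ge => G _ _; rewrite lee_fin open_content_ge0. Qed.

Lemma haar_outer0 : haar_outer set0 = 0%E.
Proof.
apply/le_anti; rewrite haar_outer_ge0 andbT.
rewrite -[leRHS]/((0 : R)%:E) -(open_content0 cX X0 FU F_oo).
by apply: haar_outer_le; [exact: open0|rewrite setI0].
Qed.

Lemma haar_outerT A : X `<=` A -> haar_outer A = 1%E.
Proof.
move=> XA; apply/le_anti/andP; split.
  rewrite -[leRHS]/((1 : R)%:E) -(open_contentT cX X0 FU F_oo (@subsetT _ X)).
  by apply: haar_outer_le; [exact: openT|].
apply: haar_outer_ge => G oG XG; rewrite open_contentT // => x Xx.
by apply: XG; split=> //; exact: XA.
Qed.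

Lemma haar_outer_fin A : haar_outer A \is a fin_num.
Proof.
rewrite ge0_fin_numE ?haar_outer_ge0 //.
apply: (@le_lt_trans _ _ (mo setT)%:E); last exact: ltry.
by apply: haar_outer_le; [exact: openT|].
Qed.

Lemma haar_outer_sub : {homo haar_outer : A B / A `<=` B >-> (A <= B)%E}.
Proof.
move=> A B AB; apply: haar_outer_ge => G oG BG; apply: haar_outer_le => //.
by move=> x [Xx Ax]; apply: BG; split=> //; exact: AB.
Qed.

Lemma haar_outer_sigma_subadditive : sigma_subadditive haar_outer.
Proof.
move=> A; apply/lee_addgt0Pr => e e0.
have hG i : exists G, [/\ open G, X `&` A i `<=` G &
    ((mo G)%:E <= haar_outer (A i) + (e / (2 ^ i.+1)%:R)%:E)%E].
  have e2 : 0 < e / (2 ^ i.+1)%:R by rewrite divr_gt0 // ltr0n expn_gt0.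
  have [_ [G [oG AG] <-] h] := lb_ereal_inf_adherent e2 (haar_outer_fin (A i)).
  by exists G; split=> //; exact: ltW.
have [G GP] := choice hG.
apply: le_trans (epsilon_trick xpredT _ (ltW e0)); last first.
  by move=> n; exact: haar_outer_ge0.
apply: le_trans (lee_nneseries _ _ (u := fun i => (mo (G i))%:E)) => //=; last first.
- by move=> i _; have [] := GP i.
- by move=> i _; rewrite lee_fin open_content_ge0.
apply: le_trans (open_content_bigcup _ _ _ _ _) => //; last first.
  by move=> i; have [] := GP i.
apply: haar_outer_le; first by apply: bigcup_open => i _; have [] := GP i.
move=> x [Xx [i _ Ax]]; exists i => //.
by have [_ + _] := GP i; apply.
Qed.

(** Let [G] be open around [B]. Exhaust the part of [G] off [A] by sets [C]
    that stay at a fixed distance from the rest of [X], and let [O] be the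
    neighbourhood of that rest, of the same width. Then [G] and [O] together
    still contain the part of [B] in [A], and shrinking their intersection
    separates it from [C], so that the contents add up. *)
Lemma closed_haar_caratheodory A : closed A -> forall B,
  (haar_outer (B `&` A) + haar_outer (B `&` ~` A) <= haar_outer B)%E.
Proof.
move=> cA B; apply: haar_outer_ge => G oG BG.
have oGA : open (G `&` ~` A) by apply: openI => //; exact: closed_openC.
rewrite addeC; apply: (@le_trans _ _ ((mo (G `&` ~` A))%:E + haar_outer (B `&` A))%E).
  rewrite leeD2r // haar_outer_le // => x [Xx [Bx nAx]].
  by split=> //; exact: BG.
rewrite -(fineK (haar_outer_fin (B `&` A))) -EFinD lee_fin -lerBrDr.
apply: open_content_le => // e e0; rewrite lerBrDr -lee_fin EFinD.
rewrite fineK ?haar_outer_fin //.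
set C := sh (G `&` ~` A) e.
pose O := \bigcup_(y in X `\` (G `&` ~` A)) [set v | inner (v - y) (v - y) < e].
have oO : open O by apply: bigcup_open => y _; exact: open_inner_sqr_lt.
have OC v : C v -> ~ O v.
  move=> [Xv h] [y [Xy nGy] /= hy]; apply: nGy; apply: h => //.
  by rewrite -opprB innerNl innerNr opprK.
apply: (@le_trans _ _ ((haar_content F cX C)%:E + (mo (G `&` O))%:E)%E).
  rewrite leeD2l // haar_outer_le //; first exact: openI.
  move=> x [Xx [Bx Ax]]; split; first exact: BG.
  by exists x; [split=> // -[]|rewrite /= subrr inner0l].
rewrite -EFinD lee_fin -lerBrDl; apply: open_content_le => // e' e'0.
rewrite lerBrDl.
apply: le_trans (haar_contentU_separated cX X0 FU F_oo (e := e') e'0 _) _.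
  move=> a b Xa Ca Xb [_ Db]; rewrite leNgt; apply/negP => hab.
  by have [_] := Db a Xa hab; exact: OC.
have m0 : 0 < Num.min e e' by rewrite lt_min e0.
apply: le_trans (haar_content_shrink_le cX X0 FU F_oo G m0).
apply: haar_content_sub => // x [_ [[Xx h]|[Xx h]]]; split=> // y Xy; rewrite lt_min => /andP[h1 h2].
- by have [] := h y Xy h1.
- by have [] := h y Xy h2.
Qed.

Lemma haar_outer_isometry A (Q : 'M[R]_d) : Q *m Q^T = 1%:M ->
  (forall v, X v <-> X (v *m Q)) ->
  haar_outer [set v | A (v *m Q)] = haar_outer A.
Proof.
have half (P : 'M[R]_d) B : P *m P^T = 1%:M -> (forall v, X v <-> X (v *m P)) ->
    (haar_outer [set v | B (v *m P)] <= haar_outer B)%E.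
  move=> hP XP; apply: haar_outer_ge => G oG BG.
  rewrite -(open_content_isometry F cX G hP XP); apply: haar_outer_le.
    apply: inner_ball_open => v /(open_inner_ball oG) [e e0 he]; exists e => // w hw.
    by apply: he; rewrite -mulmxBl inner_mulmx.
  by move=> v [/XP Xv Bv]; exact: BG.
move=> hQ XQ; have hQ' : Q^T *m Q = 1%:M by exact: mulmx1C.
apply/le_anti; rewrite half //=.
have := half Q^T [set v | A (v *m Q)].
rewrite trmxK (_ : [set v | [set v | A (v *m Q)] (v *m Q^T)] = A).
  apply=> // v; rewrite (XQ (v *m Q^T)) -mulmxA hQ' mulmx1 //.
by apply/seteqP; split=> v /=; rewrite -mulmxA hQ' mulmx1.
Qed.

End HaarMeasure.

(** Isometries of [X] do not change the covering numbers, hence they preserve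
    every stage of the construction. *)
Theorem exists_invariant_probability {R : realType} {d : nat} (X : set 'rV[R]_d) :
  compact X -> X !=set0 -> exists mu : probability (borel R d) R, mu X = 1%E /\
  forall Q : 'M[R]_d, Q *m Q^T = 1%:M -> (forall v, X v <-> X (v *m Q)) ->
  forall A, mu [set v | A (v *m Q)] = mu A.
Proof.
move=> cX X0; have [F [FU F_oo]] := ultraFilterLemma (eventually_filter).
pose M := isOuterMeasure.Build R 'rV[R]_d (haar_outer F cX)
  (@haar_outer0 _ _ _ F cX X0 FU F_oo) (@haar_outer_ge0 _ _ _ F cX X0 FU F_oo)
  (@haar_outer_sub _ _ _ F cX) (haar_outer_sigma_subadditive cX X0 FU F_oo).
pose om : {outer_measure set 'rV[R]_d -> \bar R} := HB.pack (haar_outer F cX) M.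
have [||mu hmu] := @outer_measure_borel_probability R d om.
- move=> A cA; apply: le_caratheodory_measurable.
  exact: (closed_haar_caratheodory cX X0 FU F_oo cA).
- exact: (haar_outerT cX X0 FU F_oo).
exists mu; rewrite hmu; split; first exact: (haar_outerT cX X0 FU F_oo).
move=> Q hQ XQ A; rewrite !hmu.
exact: (@haar_outer_isometry _ _ X F cX A Q hQ XQ).
Qed.

(** * The uniform law on a sphere *)

Section FiniteUnion.
Context {disp : measure_display} {T : measurableType disp} {R : realType}.
Variable mu : probability T R.

Lemma probability_bigcup_null (I : finType) (F : I -> set T) :
  (forall i, measurable (F i)) ->
  (forall i j, i != j -> mu (F i `&` F j) = 0%E) ->
  mu (\bigcup_i F i) = (\sum_i mu (F i))%E.
Proof.
move=> mF F0; suff h (s : seq I) : uniq s ->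
    mu (\big[setU/set0]_(i <- s) F i) = (\sum_(i <- s) mu (F i))%E.
  rewrite -h ?index_enum_uniq //; congr (mu _).
  rewrite -bigcup_seq; apply: eq_bigcupl; split=> i //= _.
  exact: mem_index_enum.
have mU (r : seq I) : measurable (\big[setU/set0]_(i <- r) F i).
  exact: bigsetU_measurable.
elim: s => [_|i s ih /= /andP[i_s us]]; first by rewrite !big_nil measure0.
rewrite !big_cons measureUfinl //; last first.
  by apply: le_lt_trans (probability_le1 mu (mF i)) _; exact: ltry.
rewrite -ih //.
rewrite [X in (_ + _ - X)%E](_ : _ = 0%E) ?sube0 //.
have : {in s, forall j, mu (F i `&` F j) = 0%E}.
  by move=> j js; apply: F0; apply: contraNneq i_s => ->.
elim: s {ih i_s us} => [_|j s ih hs]; first by rewrite big_nil setI0 measure0.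
rewrite big_cons setIUr measureU0; first exact/hs/mem_head.
- exact: measurableI.
- exact: measurableI.
- by apply: ih => l ls; apply: hs; rewrite in_cons ls orbT.
Qed.
End FiniteUnion.

Section SphereLaw.
Context {R : realType} {d : nat}.
Local Notation V := 'rV[R]_d.
Implicit Types (u v w : V) (U L H : {vspace V}).

Lemma unit_sphere_closed L : closed (unit_sphere L).
Proof.
apply: closedI; first exact: vspace_closed.
have c : continuous (fun v : V => inner (v - 0) (v - 0)).
  exact: inner_sqr_continuous.
have e : [set v : V | inner v v = 1] =
    (fun v : V => inner (v - 0) (v - 0)) @^-1` [set x | x = 1].
  by apply/seteqP; split=> v /=; rewrite subr0.
have := preimage_closed (fun v _ => c v) (closed_eq (y := 1 : R)).
by rewrite -e.
Qed.

Lemma unit_sphere_compact L : compact (unit_sphere L).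
Proof.
apply: (subclosed_compact (@unit_sphere_closed L)
    (rV_compact (A := fun=> [set` `[-1, 1 : R]]) _)).
  by move=> _; exact: segment_compact.
move=> v [_ v1] i /=; rewrite in_itv /= -ler_norml.
rewrite -(ler_pXn2r (n := 2)) ?nnegrE // real_normK ?num_real // expr1n -v1.
rewrite /inner (bigD1 i) //= expr2 lerDl; apply: sumr_ge0 => j _.
by rewrite -expr2 sqr_ge0.
Qed.

Lemma unit_sphere_nonempty L : L != 0%VS -> unit_sphere L !=set0.
Proof.
rewrite -vpick0 => u0; have p := inner_gt0 (vpick L).
exists ((Num.sqrt (inner (vpick L) (vpick L)))^-1 *: vpick L); split.
  by rewrite memvZ // memv_pick.
rewrite innerZl innerZr mulrA -expr2 exprVn sqr_sqrtr ?inner_ge0 //.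
by rewrite mulVf // gt_eqF // p.
Qed.

(** The image of [L] is a subspace of [L] of the same dimension. *)
Lemma orthogonal_preserves L (Q : 'M[R]_d) : Q *m Q^T = 1%:M ->
  (forall v, v \in L -> v *m Q \in L) -> forall v, (v \in L) = (v *m Q \in L).
Proof.
move=> hQ QL; pose f := linfun (mulmxr Q : V -> V).
have fE v : f v = v *m Q by rewrite lfunE.
have ker0 : (L :&: lker f)%VS = 0%VS.
  apply/eqP; rewrite -subv0; apply/subvP => v; rewrite memv_cap memv_ker fE memv0.
  by move=> /andP[_ /eqP e]; rewrite -(mulmx1 v) -hQ mulmxA e mul0mx.
have fL : (f @: L <= L)%VS by apply/subvP => _ /memv_imgP[v /QL vL ->]; rewrite fE.
have eL : (f @: L)%VS = L by apply/eqP; rewrite eqEdim fL (limg_dim_eq ker0) leqnn.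
move=> v; apply/idP/idP; first exact: QL.
rewrite -[in X in X -> _]eL => /memv_imgP[w wL]; rewrite fE => e.
suff -> : v = w by [].
by rewrite -(mulmx1 v) -hQ mulmxA e -mulmxA hQ mulmx1.
Qed.

(** The unit sphere of [L] is compact, so the invariant probability measure on
    it is a uniform law and the choice made by [sphere_law] is effective. *)
Lemma sphere_law_uniform L : L != 0%VS -> uniform_on_sphere L (sphere_law L).
Proof.
move=> L0; apply: getPex.
have [mu [mu1 inv]] := exists_invariant_probability
  (unit_sphere_compact (L := L)) (unit_sphere_nonempty L0).
exists mu; split=> // Q hQ QL A _; apply: inv => // v.
by rewrite /unit_sphere /= -(orthogonal_preserves hQ QL) inner_mulmx.
Qed.

(** The orthogonal reflection in the hyperplane perpendicular to [a]. *)
Definition reflection (a : V) : 'M[R]_d := 1%:M - (2 / inner a a) *: (a^T *m a).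

Lemma reflectionE a v : v *m reflection a = v - (2 * inner v a / inner a a) *: a.
Proof.
rewrite /reflection mulmxBr mulmx1 -scalemxAr mulmxA.
rewrite (_ : v *m a^T = (inner v a)%:M); last first.
  by rewrite [LHS]mx11_scalar mxE; congr _%:M; apply: eq_bigr => i _; rewrite mxE.
by rewrite mul_scalar_mx scalerA; congr (_ - _ *: _); rewrite mulrAC.
Qed.

Lemma reflection_sym a : (reflection a)^T = reflection a.
Proof. by rewrite /reflection linearB /= linearZ /= trmx1 trmx_mul trmxK. Qed.

Lemma reflection_orthogonal a : a != 0 -> reflection a *m (reflection a)^T = 1%:M.
Proof.
rewrite -inner_eq0 => a0; rewrite reflection_sym; apply/row_matrixP => i.
rewrite rowE [in RHS]rowE mulmx1 mulmxA !reflectionE; move: (delta_mx 0 i) => v.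
rewrite innerBl innerZl; apply/rowP => j; rewrite !mxE; field.
exact: a0.
Qed.

(** Reflecting [w] and [u] along two different vectors [u + t w] destroys their
    orthogonality, which will tell the reflected subspaces apart. *)
Lemma inner_reflections u w (s t : R) : inner u w = 0 ->
  let N r := inner u u + r ^+ 2 * inner w w in N s != 0 -> N t != 0 ->
  inner (u *m reflection (u + s *: w)) (w *m reflection (u + t *: w)) =
  2 * inner u u * inner w w * ((t - s) * (inner u u + s * t * inner w w))
    / (N s * N t).
Proof.
move=> uw N Ns Nt; rewrite !reflectionE.
have aa r q : inner (u + r *: w) (u + q *: w) = inner u u + r * q * inner w w.
  by rewrite !(innerDl, innerDr, innerZl, innerZr) (innerC w u) uw; ring.
have ua r : inner u (u + r *: w) = inner u u.
  by rewrite innerDr innerZr uw mulr0 addr0.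
have wa r : inner w (u + r *: w) = r * inner w w.
  by rewrite innerDr innerZr (innerC w u) uw add0r.
rewrite innerBl !innerBr !innerZl !innerZr uw (innerC _ w) !aa ua !wa -!expr2.
rewrite -/(N s) -/(N t) ua.
by move: Ns Nt; rewrite /N => Ns Nt; field; rewrite Ns Nt.
Qed.

Lemma sphere_off_null L (mu : probability (borel R d) R) (A : set V) :
  uniform_on_sphere L mu -> closed A -> A `&` unit_sphere L = set0 -> mu A = 0%E.
Proof.
move=> [mu1 _] cA A0; have mS := closed_borel (@unit_sphere_closed L).
apply: (@subset_measure0 _ _ _ mu A (~` unit_sphere L)).
- exact: closed_borel.
- exact: measurableC.
- by move=> v Av Sv; have : (A `&` unit_sphere L) v by []; rewrite A0.
- by have := probability_setC mu mS; rewrite mu1 subee.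
Qed.

(** The images of a proper subspace [H] under the reflections along [u + t w],
    with [u] in [H] and [w] in [L] orthogonal to [H], are distinct for distinct
    [t >= 0], so by induction on the dimension they meet in null sets.
    Infinitely many of them, all of the same mass, fit into a set of measure
    one. *)
Theorem uniform_subspace_null L (mu : probability (borel R d) R) H :
  uniform_on_sphere L mu -> (H <= L)%VS -> (\dim H < \dim L)%N ->
  mu [set v : V | v \in H] = 0%E.
Proof.
move=> unif; have [mu1 inv] := unif.
have [n] := ubnP (\dim H); elim: n H => // n ih H hn HL dH.
have mV U : measurable ([set v : V | v \in U] : set (borel R d)).
  exact: (closed_borel (@vspace_closed R d U)).
have [H0|H0] := eqVneq H 0%VS.
  apply: (sphere_off_null unif); first exact: vspace_closed.
  apply/seteqP; split=> v //= -[]; rewrite H0 memv0 => /eqP -> [_].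
  by rewrite inner0l => /esym/eqP; rewrite oner_eq0.
have [w wL [w0 wH]] := exists_orthogonal dH.
set u := vpick H; have uH : u \in H := memv_pick H.
have u0 : u != 0 by rewrite vpick0.
have uw : inner u w = 0 := wH u uH.
(* integers supply infinitely many directions *)
pose a (i : nat) := u + i%:R *: w.
have aL i : a i \in L by rewrite memvD ?memvZ // (subvP HL).
have a0 i : inner (a i) (a i) != 0.
  rewrite inner_eq0; apply: contraNneq u0 => e; rewrite -inner_eq0.
  by have := inner0r u; rewrite -e innerDr innerZr uw mulr0 addr0 => ->.
pose Q i := reflection (a i).
have hQ i : Q i *m (Q i)^T = 1%:M by apply: reflection_orthogonal; rewrite -inner_eq0.
have QQ i : Q i *m Q i = 1%:M by rewrite -[X in _ *m X]reflection_sym.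
have QL i v : v \in L -> v *m Q i \in L.
  by move=> vL; rewrite reflectionE memvB ?memvZ.
have [Hi memHi dimHi] : exists2 Hi : nat -> {vspace V},
    forall i v, (v \in Hi i) = (v *m Q i \in H) &
    forall i, (\dim (Hi i) <= \dim H)%N.
  exists (fun i => (linfun (mulmxr (Q i) : V -> V) @: H)%VS) => [i v|i]; last first.
    by rewrite -(limg_ker_dim (linfun (mulmxr (Q i) : V -> V)) H) leq_addl.
  apply/idP/idP => [/memv_imgP[x xH ->]|h].
    by rewrite lfunE /= -mulmxA QQ mulmx1.
  by apply/memv_imgP; exists (v *m Q i); rewrite // lfunE /= -mulmxA QQ mulmx1.
have muHi i : mu [set v : V | v \in Hi i] = mu [set v : V | v \in H].
  rewrite -(inv (Q i) (hQ i) (QL i) _ (mV H)); congr (mu _).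
  by apply/seteqP; split=> v /=; rewrite memHi.
have capHi i j : i != j -> mu ([set v : V | v \in Hi i] `&` [set v : V | v \in Hi j]) = 0%E.
  move=> ij; have -> : [set v : V | v \in Hi i] `&` [set v : V | v \in Hi j] =
      [set v : V | v \in (Hi i :&: Hi j)%VS].
    apply/seteqP; split=> [v [vi vj]|v].
      by apply/memv_capP; split.
    by move=> /memv_capP[].
  have lt : (\dim (Hi i :&: Hi j) < \dim H)%N.
    apply: leq_trans (dimHi i); rewrite (ltn_leqif (dimv_leqif_sup (capvSl _ _))).
    apply/negP => /subvP /(_ (u *m Q i)).
    rewrite memv_cap !memHi -mulmxA QQ mulmx1 uH => /(_ isT) /wH.
    rewrite -[w]mulmx1 -(QQ j) mulmxA inner_mulmx // inner_reflections //.
    - have A0 : 0 < inner u u by rewrite inner_gt0.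
      have B0 : 0 < inner w w by rewrite inner_gt0.
      apply/eqP; rewrite !mulf_neq0 ?invr_neq0 ?(gt_eqF A0) ?(gt_eqF B0) //.
      + by rewrite subr_eq0 eqr_nat eq_sym.
      + by rewrite gt_eqF // ltr_wpDr // mulr_ge0 ?(ltW B0) // mulr_ge0.
      + by rewrite mulf_neq0 // gt_eqF // ltr_wpDr // mulr_ge0 ?(ltW B0) ?sqr_ge0.
    - by rewrite gt_eqF // ltr_wpDr ?inner_gt0 // mulr_ge0 ?inner_ge0 ?sqr_ge0.
    - by rewrite gt_eqF // ltr_wpDr ?inner_gt0 // mulr_ge0 ?inner_ge0 ?sqr_ge0.
  apply: ih; [exact: leq_trans lt _|apply/subvP => v|].
    rewrite memv_cap memHi => /andP[/(subvP HL) h _].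
    by rewrite (orthogonal_preserves (hQ i) (QL i)).
  exact: ltn_trans lt dH.
apply/eqP; rewrite eq_le measure_ge0 andbT leNgt; apply/negP => p0.
have pfin : mu [set v : V | v \in H] \is a fin_num.
  rewrite ge0_fin_numE //; apply: le_lt_trans (probability_le1 mu (mV H)) _.
  exact: ltry.
set p := fine (mu [set v : V | v \in H]).
have {}p0 : 0 < p by apply: fine_gt0; rewrite p0 /= ltey_eq pfin.
(* [N] copies of mass [p] that meet in null sets *)
have bound N : N%:R * p <= 1.
  have := probability_bigcup_null (mu := mu) (F := fun i : 'I_N => [set v : V | v \in Hi i])
    (fun i => mV _) (fun i j ij => capHi i j ij).
  under eq_bigr do rewrite muHi -(fineK pfin).
  rewrite sumEFin sumr_const card_ord => e.
  rewrite mulr_natl -lee_fin -e; apply: probability_le1.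
  by apply: fin_bigcup_measurable.
have := bound (Num.Def.truncn p^-1).+1; apply/negP; rewrite -ltNge.
rewrite -ltr_pdivrMr // div1r; exact: truncnS_gt.
Qed.

End SphereLaw.

(** * Faces of polyhedral cones *)

Lemma fsbig_image_finType (R : zmodType) (I : finType) (J : choiceType)
    (P : pred I) (h : I -> J) (F : J -> R) :
  {in P &, injective h} ->
  \sum_(j \in [set h i | i in [set i | P i]]) F j = \sum_(i | P i) F (h i).
Proof.
move=> inj; rewrite fsbig_image; last first.
  by move=> i j; rewrite !inE => Pi Pj; exact: inj.
rewrite fsbig_mkcond (@fsbigE _ _ _ _ _ (index_enum I)) ?index_enum_uniq //.
  rewrite [RHS]big_mkcond; apply: eq_big => i; first by rewrite in_setT.
  by move=> _; rewrite patchE mem_setE.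
by move=> i _; rewrite mem_index_enum.
Qed.

Section Perturbation.
Context {R : realFieldType} {I : finType}.

Lemma exists_small_step (P : pred I) (a b : I -> R) : (forall i, P i -> 0 < a i) ->
  exists2 e, 0 < e & forall i, P i -> 0 < a i + e * b i.
Proof.
move=> a0; pose s := \sum_(i | P i) `|b i| / a i.
have t0 i : P i -> 0 <= `|b i| / a i by move=> /a0 ai; rewrite divr_ge0 // ltW.
have s0 : 0 <= s by apply: sumr_ge0.
have s1 : 0 < 1 + s by rewrite ltr_pwDl.
exists (1 + s)^-1 => [|i Pi]; first by rewrite invr_gt0.
have bs : `|b i| / a i < 1 + s.
  by rewrite ltr_pwDl // /s (bigD1 i) //= lerDl sumr_ge0 // => j /andP[/t0].
have {}bs : (1 + s)^-1 * `|b i| < a i.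
  by rewrite mulrC ltr_pdivrMr // mulrC -ltr_pdivrMr ?a0.
have : - ((1 + s)^-1 * `|b i|) <= (1 + s)^-1 * b i.
  by rewrite -mulrN ler_pM2l ?invr_gt0 // lerNl -normrN ler_norm.
lra.
Qed.
End Perturbation.

Section Cones.
Context {R : realType} {d : nat} {I : finType}.
Local Notation V := 'rV[R]_d.
Variables (x : I -> V) (W : {set I}).
Hypothesis W_free : forall S : {set I}, S \subset W -> #|S| = d ->
  free [seq x i | i in S].
Hypothesis card_W : (d <= #|W|)%N.
Implicit Types (S T : {set I}) (u v w : V) (U L : {vspace V}).

Definition cone : set V := [set v | forall i, i \in W -> 0 <= inner v (x i)].

Definition cone_face S : set V :=
  [set v | cone v /\ forall i, i \in S -> inner v (x i) = 0].

Definition flat S : {vspace V} := ann [seq x i | i in S].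

Lemma mem_flat S v : v \in flat S <-> forall i, i \in S -> inner v (x i) = 0.
Proof.
rewrite mem_ann; split=> [/allP h i iS|h].
  by apply/eqP/h/mapP; exists i; rewrite ?mem_enum.
by apply/allP => _ /mapP[i + ->]; rewrite mem_enum => /h ->.
Qed.

Lemma free_walls S : S \subset W -> (#|S| <= d)%N -> free [seq x i | i in S].
Proof.
move=> SW Sd; pose T := S :|: [set i in take (d - #|S|) (enum (W :\: S))].
have cT : #|T| = d.
  rewrite cardsU (_ : S :&: _ = finset.set0) ?cards0 ?subn0; last first.
    apply/setP => i; rewrite !inE; apply/negP => /andP[iS /mem_take].
    by rewrite mem_enum inE iS.
  rewrite cardsE (card_uniqP _) ?take_uniq ?enum_uniq // size_take -cardE cardsD.
  by rewrite (finset.setIidPr SW); case: ltnP; lia.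
have TW : T \subset W.
  rewrite finset.subUset SW; apply/fintype.subsetP => i; rewrite inE => /mem_take.
  by rewrite mem_enum inE => /andP[].
have : perm_eq (enum T) (enum S ++ enum (T :\: S)).
  apply: uniq_perm; rewrite ?enum_uniq ?cat_uniq //=.
    rewrite !enum_uniq andbT; apply/hasPn => i.
    by rewrite !mem_enum inE => /andP[].
  move=> i; rewrite mem_cat !mem_enum !inE.
  by case: (i \in S).
move=> /(perm_map x)/perm_free e; have := W_free TW cT.
by rewrite e map_cat => /catl_free.
Qed.

Lemma dim_flat S : S \subset W -> \dim (flat S) = (d - #|S|)%N.
Proof.
move=> SW; have [Sd|dS] := leqP #|S| d.
  by rewrite dim_ann_free ?free_walls // size_map -cardE.
pose T := [set i in take d (enum S)].
have TS : T \subset S by apply/fintype.subsetP => i; rewrite inE => /mem_take; rewrite mem_enum.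
have cT : #|T| = d.
  rewrite cardsE (card_uniqP _) ?take_uniq ?enum_uniq // size_take -cardE dS //.
have := dim_ann_free (W_free (fintype.subset_trans TS SW) cT).
rewrite size_map -cardE cT subnn (eqP (ltnW dS)) => e.
apply/eqP; rewrite -leqn0 -[leqRHS]e dimvS //; apply/subvP => v /mem_flat h.
by apply/mem_flat => i iT; apply: h; exact: (fintype.subsetP TS).
Qed.

Lemma cone0 : cone 0.
Proof. by move=> i _; rewrite inner0l. Qed.

Lemma cone_face_flat S v : cone_face S v -> v \in flat S.
Proof. by move=> [_ h]; exact/mem_flat. Qed.

(** Take the sum of witnesses, one for each constraint that is not tight on all
    of [F]. *)
Lemma exists_relint (F : set V) :
  F `<=` cone -> F 0 -> (forall u v, F u -> F v -> F (u + v)) ->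
  exists2 w, F w & forall i, i \in W ->
    inner w (x i) = 0 -> forall v, F v -> inner v (x i) = 0.
Proof.
move=> FC F0 FD.
have wit i : exists v, F v /\ (i \in W -> inner v (x i) = 0 ->
    forall v, F v -> inner v (x i) = 0).
  have [h|] := pselect (forall v, F v -> inner v (x i) = 0); first by exists 0.
  by move=> /existsNP[v /not_implyP[Fv vi]]; exists v.
have [f fP] := choice wit.
have FS (J : seq I) : F (\sum_(j <- J) f j).
  by elim/big_ind: _ => // i _; have [] := fP i.
exists (\sum_i f i) => [|i iW]; first exact: FS.
rewrite inner_suml => /eqP; rewrite psumr_eq0; last first.
  by move=> j _; apply: (FC (f j)) iW; have [] := fP j.
move=> /allP/(_ i (mem_index_enum _)) /= /eqP.
by have [_] := fP i; apply.
Qed.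

Definition strict_point S w :=
  cone_face S w /\ forall i, i \in W -> i \notin S -> 0 < inner w (x i).

Definition saturation S : {set I} :=
  [set i in W | `[< forall v, cone_face S v -> inner v (x i) = 0 >]].

Lemma saturation_sub S : saturation S \subset W.
Proof. by apply/fintype.subsetP => i; rewrite inE => /andP[]. Qed.

Lemma sub_saturation S : S \subset W -> S \subset saturation S.
Proof.
move=> SW; apply/fintype.subsetP => i iS; rewrite inE (fintype.subsetP SW) //=.
by apply/asboolP => v [_]; apply.
Qed.

Lemma cone_face_saturation S : S \subset W ->
  cone_face (saturation S) = cone_face S.
Proof.
move=> SW; apply/seteqP; split=> v [Cv h]; split=> // i.
  by move=> iS; apply: h; exact: (fintype.subsetP (sub_saturation SW)).
by rewrite inE => /andP[_ /asboolP]; apply.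
Qed.

Lemma strict_point_saturation S : S \subset W ->
  exists w, strict_point (saturation S) w.
Proof.
move=> SW; have [|||w Fw hw] := @exists_relint (cone_face S).
- by move=> v [].
- by split=> [|i _]; [exact: cone0|rewrite inner0l].
- move=> u v [Cu hu] [Cv hv]; split=> i hi; rewrite innerDl.
    by rewrite addr_ge0 ?Cu ?Cv.
  by rewrite hu // hv // addr0.
exists w; split; first by rewrite cone_face_saturation.
move=> i iW iS; have [Cw _] := Fw; rewrite lt0r Cw // andbT.
apply: contraNneq iS => wi; rewrite inE iW /=; apply/asboolP.
exact: hw.
Qed.

Lemma linear_hull_eq (C : set V) U : (forall v, C v -> v \in U) ->
  (forall L, (forall v, C v -> v \in L) -> (U <= L)%VS) -> linear_hull C = U.
Proof.
move=> CU min; rewrite /linear_hull.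
have [CX minX] := xgetPex 0%VS (ex_intro
  (fun L : {vspace V} => C `<=` [set` L] /\
    forall M : {vspace V}, C `<=` [set` M] -> (L <= M)%VS) U (conj CU min)).
by apply/eqP; rewrite eqEsubv minX // min.
Qed.

Lemma linear_hull_vspace U : linear_hull [set v : V | v \in U] = U.
Proof. by apply: linear_hull_eq => // L h; apply/subvP => v; exact: h. Qed.

(** From a strict point all small displacements within the flat stay in the
    face. *)
Lemma linear_hull_strict S w : strict_point S w -> linear_hull (cone_face S) = flat S.
Proof.
move=> [[Cw wS] hw]; apply: linear_hull_eq; first exact: cone_face_flat.
move=> L FL; apply/subvP => u /mem_flat uS.
have [e e0 he] := exists_small_step (P := [pred i in W | i \notin S])
  (a := fun i => inner w (x i)) (fun i => inner u (x i))
  (fun i h => hw i (proj1 (andP h)) (proj2 (andP h))).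
have wL : w \in L by apply: FL.
have : w + e *: u \in L.
  apply: FL; split=> i hi; rewrite innerDl innerZl.
    have [iS|iS] := boolP (i \in S); first by rewrite uS // wS // mulr0 addr0.
    by apply/ltW/he; rewrite /= hi.
  by rewrite uS // wS // mulr0 addr0.
by rewrite rpredDl // rpredZeq gt_eqF.
Qed.

Lemma linear_hull_face S : S \subset W ->
  linear_hull (cone_face S) = flat (saturation S).
Proof.
move=> SW; have [w hw] := strict_point_saturation SW.
by rewrite -cone_face_saturation // (linear_hull_strict hw).
Qed.

(** Let [w] be a relative interior point of [F] and [u] a point of the cone on
    the walls tight along [F]. A small step from [w] away from [u] stays in the
    cone; as the form of [X] vanishes at [w] and is nonpositive on the cone, it
    vanishes at [u] too, and [u] lies in [F]. *)
Lemma exposed_face_cone_face (X : V) (F : set V) :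
  (forall v, cone v -> inner v X <= 0) ->
  F = [set v | cone v /\ inner v X = 0] ->
  exists2 S : {set I}, S \subset W & F = cone_face S /\ saturation S = S.
Proof.
move=> CX FE; have F0 : F 0 by rewrite FE /= inner0l; split=> //; exact: cone0.
have [|||w Fw hw] := @exists_relint F.
- by move=> v; rewrite FE => -[].
- exact: F0.
- move=> u v; rewrite FE => -[Cu hu] [Cv hv]; split=> [i hi|].
    by rewrite innerDl addr_ge0 ?Cu ?Cv.
  by rewrite innerDl hu hv addr0.
pose S := [set i in W | `[< forall v, F v -> inner v (x i) = 0 >]].
have SW : S \subset W by apply/fintype.subsetP => i; rewrite inE => /andP[].
have FS : F = cone_face S.
  apply/seteqP; split=> [v Fv|u [Cu uS]].
    split; first by move: Fv; rewrite FE => -[].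
    by move=> i; rewrite inE => /andP[_ /asboolP]; apply.
  have pos i : i \in W -> i \notin S -> 0 < inner w (x i).
    move=> iW iS; have : cone w by move: Fw; rewrite FE => -[].
    move=> Cw; rewrite lt0r Cw // andbT; apply: contraNneq iS => wi.
    by rewrite inE iW /=; apply/asboolP; exact: hw.
  have [e e0 he] := exists_small_step (P := [pred i in W | i \notin S])
    (a := fun i => inner w (x i)) (fun i => - inner u (x i))
    (fun i h => pos i (proj1 (andP h)) (proj2 (andP h))).
  have wS i : i \in S -> inner w (x i) = 0.
    by rewrite inE => /andP[_ /asboolP]; apply.
  have : inner (w - e *: u) X <= 0.
    apply: CX => i hi; rewrite innerBl innerZl.
    have [iS|iS] := boolP (i \in S); first by rewrite uS // wS // mulr0 subr0.
    by rewrite -mulrN; apply/ltW/he; rewrite /= hi.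
  have wX : inner w X = 0 by move: Fw; rewrite FE => -[].
  rewrite innerBl innerZl wX sub0r oppr_le0 pmulr_rge0 // => uX.
  by rewrite FE; split=> //; apply/le_anti; rewrite uX CX.
exists S => //; split=> //; apply/setP => i; rewrite !inE -FS.
by [].
Qed.

Hypothesis d_gt0 : (0 < d)%N.

Lemma wall_neq0 i : i \in W -> x i != 0.
Proof.
move=> iW; apply/eqP => x0.
have := dim_flat (S := [set i]); rewrite finset.sub1set iW cards1 => /(_ isT) e.
have : (flat [set i] == fullv)%VS.
  rewrite eqEsubv subvf; apply/subvP => v _; apply/mem_flat => j /set1P ->.
  by rewrite x0 inner0r.
by move=> /eqP f; move: e; rewrite f dimvf /dim /= mul1n; lia.
Qed.

Lemma is_face_cone_face S : S \subset W -> is_face cone (cone_face S).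
Proof.
move=> SW; exists #|W|, (fun j => - x (enum_val j)), [set j in [pred j : 'I_#|W| | enum_val j \in S]].
split.
- by move=> j; rewrite oppr_eq0; apply: wall_neq0; exact: enum_valP.
- apply/seteqP; split=> v /= h => [j|i iW].
    by rewrite innerNr oppr_le0; apply: h; exact: enum_valP.
  by have := h (enum_rank_in iW i); rewrite enum_rankK_in // innerNr oppr_le0.
- apply/seteqP; split=> v /= => [[Cv h] j|h].
    rewrite inE innerNr; case: ifPn => jS; first by rewrite h ?oppr0.
    by rewrite oppr_le0; apply: Cv; exact: enum_valP.
  have key i (iW : i \in W) : if i \in S then inner v (x i) = 0 else 0 <= inner v (x i).
    have := h (enum_rank_in iW i); rewrite !inE /= enum_rankK_in // innerNr oppr_le0.
    by case: ifP => // _ /eqP; rewrite oppr_eq0 => /eqP.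
  split=> i hi; first by have := key i hi; case: ifP => // _ ->.
  by have := key i (fintype.subsetP SW i hi); rewrite hi.
Qed.

(** Faces may be presented by any half-space description of the cone. The sum
    of the normals that are made tight is one form exposing the face, which
    brings the description at hand back. *)
Lemma is_face_coneP (F : set V) : is_face cone F ->
  exists2 S : {set I}, S \subset W & F = cone_face S /\ saturation S = S.
Proof.
move=> [m [y [J [_ CE FE]]]].
apply: (@exposed_face_cone_face (\sum_(j in J) y j)).
  by move=> v; rewrite CE => h; rewrite inner_sumr sumr_le0.
rewrite FE CE; apply/seteqP; split=> v /= => [h|[h /eqP]].
  split=> [j|]; first by have := h j; case: ifP => // _ ->.
  by rewrite inner_sumr big1 // => j jJ; have := h j; rewrite jJ.
rewrite -oppr_eq0 inner_sumr -sumrN psumr_eq0 => [/allP e j|j _]; last first.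
  by rewrite oppr_ge0.
case: ifP => // jJ; apply/eqP; rewrite -oppr_eq0.
by have := e j (mem_index_enum _); rewrite jJ.
Qed.

Variable k : nat.
Hypothesis hk : (0 < k <= d)%N.

Lemma cone_face_inj : {in [pred S : {set I} | [&& S \subset W, #|S| == (d - k)%N &
  saturation S == S]] &, injective cone_face}.
Proof.
move=> S T; rewrite !inE => /and3P[SW /eqP cS /eqP satS] /and3P[TW /eqP cT /eqP satT] e.
have fe : flat S = flat T by rewrite -satS -satT -!linear_hull_face // e.
have dST : \dim (flat (S :|: T)) = k.
  have -> : flat (S :|: T) = flat S.
    apply/eqP; rewrite eqEsubv; apply/andP; split; apply/subvP => v.
      by move=> /mem_flat h; apply/mem_flat => i iS; apply: h; rewrite inE iS.
    move=> vS; apply/mem_flat => i; rewrite inE => /orP[]; first exact/(mem_flat S v).1.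
    by apply/(mem_flat T v).1; rewrite -fe.
  by rewrite dim_flat // cS; move: hk; lia.
have : #|S :|: T| = (d - k)%N.
  by move: dST; rewrite dim_flat ?finset.subUset ?SW //; move: hk; lia.
move=> cU; have eS : S = S :|: T by apply/eqP; rewrite eqEcard finset.subsetUl cU cS leqnn.
by apply/eqP; rewrite eq_sym eqEcard cS cT leqnn andbT; apply/finset.setUidPl.
Qed.

Definition face_mass S : R := fine (sphere_law (flat S) (cone_face S)).

Lemma cone_face_closed S : closed (cone_face S).
Proof.
have -> : cone_face S = (\bigcap_(i in [set i | i \in W]) [set v | 0 <= inner v (x i)]) `&`
    (\bigcap_(i in [set i | i \in S]) [set v | inner v (x i) = 0]).
  by apply/seteqP; split=> v.
apply: closedI; apply: closed_bigI => i _; first exact: inner_ge0_closed.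
exact: inner_eq0_closed.
Qed.

Lemma flat_neq0 S : S \subset W -> #|S| = (d - k)%N -> flat S != 0%VS.
Proof.
by move=> SW cS; rewrite -dimv_eq0 dim_flat // cS; move: hk; lia.
Qed.

(** Faces whose dimension drops lie in a proper subspace of the flat. *)
Lemma face_mass0 S : S \subset W -> #|S| = (d - k)%N -> saturation S != S ->
  face_mass S = 0.
Proof.
move=> SW cS satS; have lt : (#|S| < #|saturation S|)%N.
  rewrite ltn_neqAle subset_leq_card ?sub_saturation // andbT.
  apply: contra satS => /eqP e; rewrite eq_sym eqEcard sub_saturation //= e //.
have unif := sphere_law_uniform (flat_neq0 SW cS).
rewrite /face_mass (@subset_measure0 _ _ _ (sphere_law (flat S)) (cone_face S)
  [set v : V | v \in flat (saturation S)]) //.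
- by apply: closed_borel; exact: cone_face_closed.
- by apply: closed_borel; exact: vspace_closed.
- by move=> v Fv; apply: cone_face_flat; rewrite cone_face_saturation.
- apply: (uniform_subspace_null unif).
    apply/subvP => v /mem_flat h; apply/mem_flat => i iS; apply: h.
    exact: (fintype.subsetP (sub_saturation SW)).
  rewrite !dim_flat ?saturation_sub //; move: hk; lia.
Qed.

(** A face of dimension [k] is given by exactly one saturated set of [d - k]
    walls, and the sets that are not saturated contribute nothing. So the sum
    can run over all sets of [d - k] walls, whatever the combinatorial type of
    the cone. *)
Lemma Lambda_cone :
  Lambda k cone = \sum_(S : {set I} | (S \subset W) && (#|S| == (d - k)%N)) face_mass S.
Proof.
pose P := [pred S : {set I} | [&& S \subset W, #|S| == (d - k)%N & saturation S == S]].
rewrite /Lambda; have -> : faces k cone = [set cone_face S | S in [set S | P S]].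
  apply/seteqP; split=> F /=.
    move=> [/is_face_coneP [S SW [-> satS]]].
    rewrite linear_hull_face // satS dim_flat // => dS; exists S => //=.
    by rewrite SW satS eqxx andbT; apply/eqP; move: hk; lia.
  move=> [S /and3P[SW /eqP cS /eqP satS] <-]; split; first exact: is_face_cone_face.
  by rewrite linear_hull_face // satS dim_flat // cS; move: hk; lia.
rewrite fsbig_image_finType; last exact: cone_face_inj.
rewrite [RHS](bigID (fun S => saturation S == S)) /= [X in _ + X]big1 ?addr0.
  apply: eq_big => S; first by rewrite !andbA.
  move=> /and3P[SW _ /eqP satS]; rewrite /solid_angle linear_hull_face // satS.
  by [].
by move=> S /andP[/andP[SW /eqP cS]]; exact: face_mass0.
Qed.

(** A face of full dimension in its flat can be pushed into the interior, since
    the constraints tight on it are independent. *)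
Lemma face_mass0_empty S : S \subset W -> #|S| = (d - k)%N ->
  (~ exists v, forall i, i \in W -> 0 < inner v (x i)) -> face_mass S = 0.
Proof.
move=> SW cS nI; apply: face_mass0 => //; apply/eqP => satS; apply: nI.
have [w] := strict_point_saturation SW; rewrite satS => -[[Cw wS] hw].
(* by independence, one tight constraint can be made positive while the others
   stay tight *)
have push i : exists u, i \in S -> 0 < inner u (x i) /\
    forall j, j \in S -> j != i -> inner u (x j) = 0.
  have [iS|] := boolP (i \in S); last by exists 0.
  have dlt : (\dim (flat S) < \dim (flat (S :\ i)))%N.
    rewrite !dim_flat //; last exact: fintype.subset_trans (finset.subsetDl _ _) SW.
    by have := cardsD1 i S; rewrite iS cS; move: hk; lia.
  have /subvPn [u uSi uS] : ~~ (flat (S :\ i) <= flat S)%VS.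
    by apply: contraL dlt => /dimvS; rewrite -leqNgt.
  have h j : j \in S -> j != i -> inner u (x j) = 0.
    by move=> jS ji; apply: (mem_flat _ _).1 uSi _ _; rewrite !inE ji.
  have ui : inner u (x i) != 0.
    apply: contra uS => /eqP ui; apply/mem_flat => j jS.
    by have [->//|ji] := eqVneq j i; exact: h.
  exists (Num.sg (inner u (x i)) *: u) => _; split=> [|j jS ji].
    by rewrite innerZl -normrEsg normr_gt0.
  by rewrite innerZl (h j) ?mulr0.
have [f fP] := choice push; pose u := \sum_(i in S) f i.
have uS i : i \in S -> 0 < inner u (x i).
  move=> iS; rewrite inner_suml (bigD1 i) //= big1 ?addr0; first by have [] := fP i iS.
  by move=> j /andP[jS ji]; have [_] := fP j jS; apply=> //; rewrite eq_sym.
have [e e0 he] := exists_small_step (P := [pred i in W | i \notin S])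
  (a := fun i => inner w (x i)) (fun i => inner u (x i))
  (fun i h => hw i (proj1 (andP h)) (proj2 (andP h))).
exists (w + e *: u) => i iW; rewrite innerDl innerZl.
have [iS|iS] := boolP (i \in S); last by apply: he; rewrite /= iW.
by rewrite wS // add0r mulr_gt0 ?uS.
Qed.

End Cones.

(** * Regions of hyperplane arrangements and tessellations *)

Section SignVectors.
Implicit Types (n : nat) (t : bitseq) (P Q : bitseq -> Prop).

Fixpoint bits n : seq bitseq :=
  if n is n'.+1 then map (cons true) (bits n') ++ map (cons false) (bits n')
  else [:: [::]].

Lemma mem_bits n t : (t \in bits n) = (size t == n).
Proof.
have inj (b : bool) : injective (cons b) by move=> ? ? [].
elim: n t => [|n ih] [|b t] //=; rewrite mem_cat.
  by apply/negbTE; rewrite negb_or; apply/andP; split; apply/negP => /mapP[].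
have no (b' : bool) (s : seq bitseq) :
    (b :: t \in map (cons b') s) = (b == b') && (t \in s).
  apply/mapP/andP => [[t' ts [-> ->]]|[/eqP-> ts]]; first by rewrite eqxx.
  by exists t.
by rewrite !no ih eqSS; case: b {no}; rewrite ?orbF.
Qed.

Lemma bits_uniq n : uniq (bits n).
Proof.
have inj (b : bool) : injective (cons b) by move=> ? ? [].
elim: n => //= n ih; rewrite cat_uniq !(map_inj_uniq (inj _)); apply/and3P; split=> //.
by apply/hasPn => _ /mapP[t _ ->]; apply/negP => /mapP[].
Qed.

Definition cnt n P : nat := count (fun t => `[< P t >]) (bits n).

Lemma cntS n P : cnt n.+1 P = (cnt n (fun t => P (true :: t)) + cnt n (fun t => P (false :: t)))%N.
Proof. by rewrite /cnt /= count_cat !count_map. Qed.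

Lemma eq_cnt n P Q : (forall t, size t = n -> P t <-> Q t) -> cnt n P = cnt n Q.
Proof.
move=> PQ; apply: eq_in_count => t; rewrite mem_bits => /eqP st.
by apply: asbool_equiv_eq; exact: PQ.
Qed.

Lemma cnt_or_and n P Q :
  (cnt n P + cnt n Q)%N = (cnt n (fun t => P t \/ Q t) + cnt n (fun t => P t /\ Q t))%N.
Proof.
rewrite /cnt -count_predUI; congr (_ + _)%N; apply: eq_count => t /=.
  by rewrite asbool_or.
by rewrite asbool_and.
Qed.

Lemma cnt0 n P : (forall t, size t = n -> ~ P t) -> cnt n P = 0%N.
Proof.
move=> h; rewrite (eq_cnt (Q := fun=> False)) => [|t /h]; last by [].
by rewrite /cnt (eq_count (a2 := pred0)) ?count_pred0 // => t; apply/asboolP.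
Qed.
End SignVectors.

Section Regions.
Context {R : realType} {d : nat}.
Local Notation V := 'rV[R]_d.
Implicit Types (u v w x : V) (U : {vspace V}) (As : seq V) (t : bitseq).

Definition has_signs v As t : Prop :=
  forall x b, (x, b) \in zip As t -> 0 < (-1) ^+ b * inner v x.

Definition realizable U As t : Prop := exists2 v, v \in U & has_signs v As t.

(** The number of regions into which the hyperplanes orthogonal to the members
    of [As] cut the subspace [U]. *)
Definition regions U As : nat := cnt (size As) (realizable U As).

Lemma has_signs_cons v x As b t :
  has_signs v (x :: As) (b :: t) <-> 0 < (-1) ^+ b * inner v x /\ has_signs v As t.
Proof.
split=> [h|[h0 h] y c]; last by rewrite in_cons => /orP[/eqP[-> ->]|/h].
by split=> [|y c yc]; apply: h; rewrite in_cons ?eqxx // yc orbT.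
Qed.

Lemma has_signs_perturb v u As t : has_signs v As t ->
  exists2 e, 0 < e & forall e', 0 < e' -> e' <= e ->
    has_signs (v + e' *: u) As t /\ has_signs (v - e' *: u) As t.
Proof.
move=> h; pose s := zip As t.
have [e e0 he] := exists_small_step (P := [pred i : 'I_(size s) | true])
  (a := fun i => (-1) ^+ (tnth (in_tuple s) i).2 * inner v (tnth (in_tuple s) i).1)
  (fun i => - `|inner u (tnth (in_tuple s) i).1|)
  (fun i _ => h _ _ (eq_ind _ (fun p => p \in zip As t) (mem_tnth i (in_tuple s)) _
     (surjective_pairing _))).
exists e => // e' e'0 ee'.
suff key x b c : (x, b) \in s -> `|c| = e' -> 0 < (-1) ^+ b * inner (v + c *: u) x.
  split=> x b xb; first by apply: key => //; rewrite gtr0_norm.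
  by rewrite -scaleNr; apply: key => //; rewrite normrN gtr0_norm.
move=> xb ce; have /tnthP[i xbi] : (x, b) \in in_tuple s by [].
have := he i isT; rewrite -xbi /= innerDl innerZl mulrDr => pos.
have : - (e * `|inner u x|) <= (-1) ^+ b * (c * inner u x).
  apply: le_trans (_ : - `|(-1) ^+ b * (c * inner u x)| <= _); last first.
    by rewrite lerNl -normrN ler_norm.
  by rewrite lerN2 normrMsign normrM ce ler_wpM2r.
by move: pos; rewrite mulrN; lra.
Qed.

Lemma signr_pos (b : bool) (c : R) : c != 0 -> (0 < (-1) ^+ b * c) = (b == (c < 0)).
Proof.
move=> c0; case: b; first by rewrite expr1 mulN1r oppr_gt0; case: (c < 0).
by rewrite expr0 mul1r lt0r c0 /= leNgt; case: (c < 0).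
Qed.

(** Deletion and restriction: a region of [As] splits in two exactly when the
    new hyperplane meets it, and by convexity it then leaves one region on the
    hyperplane. *)
Lemma regions_cons U x As u : u \in U -> inner u x != 0 ->
  regions U (x :: As) = (regions U As + regions (U :&: perpv x) As)%N.
Proof.
move=> uU ux; rewrite /regions /= cntS cnt_or_and; congr (_ + _)%N.
  apply: eq_cnt => t st; split=> [[] [v vU /has_signs_cons[_ h]]|[v vU h]].
  - by exists v.
  - by exists v.
  have [vx|vx] := eqVneq (inner v x) 0; last first.
    have hv : has_signs v (x :: As) ((inner v x < 0) :: t).
      by apply/has_signs_cons; rewrite signr_pos.
    by case: (inner v x < 0) hv => hv; [left|right]; exists v.
  have [e e0 he] := has_signs_perturb u h; have [hp hm] := he e e0 (lexx e).
  have wx : inner (v + e *: u) x != 0 by rewrite innerDl vx add0r innerZl mulf_neq0 ?(gt_eqF e0).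
  have hw : has_signs (v + e *: u) (x :: As) ((inner (v + e *: u) x < 0) :: t).
    by apply/has_signs_cons; rewrite signr_pos.
  have wU : v + e *: u \in U by rewrite memvD ?memvZ.
  by case: (_ < 0) hw => hw; [left|right]; exists (v + e *: u).
apply: eq_cnt => t st; split=> [[[v vU /has_signs_cons[vx hv]] [w wU /has_signs_cons[wx hw]]]|].
  move: vx wx; rewrite expr1 expr0 mul1r mulN1r oppr_gt0 => vx wx.
  (* the point where the segment between the two sides crosses the hyperplane,
     up to a positive factor *)
  exists (inner w x *: v - inner v x *: w).
    rewrite memv_cap memvB ?memvZ //= mem_perpv innerBl !innerZl.
    by rewrite mulrC subrr.
  move=> y b yb; rewrite innerBl !innerZl mulrBr -mulrN -!mulNr !(mulrCA ((-1) ^+ b)).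
  by apply: addr_gt0; rewrite mulr_gt0 ?oppr_gt0 ?hv ?hw.
move=> [v]; rewrite memv_cap mem_perpv => /andP[vU /eqP vx] h.
have [e e0 he] := has_signs_perturb u h; have [hp hm] := he e e0 (lexx e).
have pm (b : bool) : exists2 w, w \in U & has_signs w As t /\ inner w x = (-1) ^+ b * (e * inner u x).
  exists (v + (-1) ^+ b *: (e *: u)); first by rewrite memvD ?memvZ.
  by rewrite innerDl vx add0r !innerZl; split=> //; case: b; rewrite ?expr1 ?expr0 ?scale1r ?scaleN1r.
have eu : e * inner u x != 0 by rewrite mulf_neq0 ?(gt_eqF e0).
have fin (b : bool) : exists2 w, w \in U & has_signs w (x :: As) (b :: t).
  have [w wU [hw wx]] := pm (b (+) (e * inner u x < 0)).
  exists w => //; apply/has_signs_cons; split=> //.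
  by rewrite wx mulrA -signr_addb addbA addbb addFb signr_pos.
by split; exact: fin.
Qed.

Lemma regions_cons0 U x As : (forall u, u \in U -> inner u x = 0) ->
  regions U (x :: As) = 0%N.
Proof.
move=> h; apply: cnt0 => -[//|b t] _ [v /h vx /has_signs_cons[]].
by rewrite vx mulr0 ltxx.
Qed.

(** The sign of [x] is determined by the sign of [a]. *)
Lemma regions_cons_redundant U x As a (c : R) : a \in As -> c != 0 ->
  (forall u, u \in U -> inner u x = c * inner u a) ->
  regions U (x :: As) = regions U As.
Proof.
move=> aAs c0 xa; rewrite /regions /= cntS cnt_or_and.
have det v t : size t = size As -> has_signs v As t -> inner v a != 0.
  move=> st h; have := h a (nth true t (index a As)).
  rewrite -[X in (X, _)](nth_index 0 aAs) -nth_zip ?st //.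
  rewrite mem_nth ?size_zip ?st ?minnn ?index_mem // => /(_ isT).
  by case: (eqVneq (inner v a) 0) => [->|//]; rewrite mulr0 ltxx.
rewrite [X in (_ + X)%N]cnt0 ?addn0.
  apply: eq_cnt => t st; split=> [[] [v vU /has_signs_cons[_ h]]|[v vU h]].
  - by exists v.
  - by exists v.
  have vx : inner v x != 0 by rewrite xa // mulf_neq0 // (det v t).
  have hv : has_signs v (x :: As) ((inner v x < 0) :: t).
    by apply/has_signs_cons; rewrite signr_pos.
  by case: (inner v x < 0) hv => hv; [left|right]; exists v.
move=> t st [[v vU /has_signs_cons[vx hv]] [w wU /has_signs_cons[wx hw]]].
have := hv a (nth true t (index a As)); have := hw a (nth true t (index a As)).
rewrite -[X in (X, _)](nth_index 0 aAs) -nth_zip ?st //.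
rewrite mem_nth ?size_zip ?st ?minnn ?index_mem // => /(_ isT) h1 /(_ isT) h2.
move: vx wx; rewrite expr1 expr0 mul1r mulN1r oppr_gt0 !xa // => vx wx.
have : (c * inner w a) * (c * inner v a) < 0 by rewrite pmulr_rlt0.
have c2 : 0 < c ^+ 2 by rewrite exprn_even_gt0.
have := mulr_gt0 c2 (mulr_gt0 h1 h2); set s : R := (-1) ^+ _.
have s2 : s * s = 1 by rewrite -expr2 sqrr_sign.
rewrite (_ : c ^+ 2 * (s * inner w a * (s * inner v a)) =
  (s * s) * ((c * inner w a) * (c * inner v a))); last by ring.
by rewrite s2 mul1r => h h'; have := lt_trans h h'; rewrite ltxx.
Qed.

(** Adding the hyperplanes on which a new form [f] agrees with the forms [g] of
    a list whose pairwise differences are already present: on the hyperplane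
    where [f] equals [g], the remaining new ones add nothing. *)
Lemma regions_add_block U As f (Js : seq V) :
  (forall g, g \in Js -> exists2 u, u \in U & inner u (f - g) != 0) ->
  pairwise (fun g g' => `[< exists2 a, a \in As & exists2 c : R, c != 0 &
    g - g' = c *: a >]) Js ->
  regions U ([seq f - g | g <- Js] ++ As) =
  (regions U As + \sum_(g <- Js) regions (U :&: perpv (f - g)) As)%N.
Proof.
elim: Js => [|g Js ih] hU /=; first by rewrite big_nil addn0.
move=> /andP[/allP hg hJ]; have [u uU ug] := hU g (mem_head _ _).
rewrite big_cons (regions_cons _ uU ug) ih //; last first.
  by move=> g' g'J; apply: hU; rewrite in_cons g'J orbT.
rewrite -addnA [X in (_ + X)%N]addnC; congr (_ + (_ + _))%N.
elim: Js hg {ih hU hJ} => //= g' Js ih hg.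
have /asboolP[a aAs [c c0 e]] := hg g' (mem_head _ _).
rewrite (regions_cons_redundant (a := a) (c := c)) ?mem_cat ?aAs ?orbT //.
  by apply: ih => l lJ; apply: hg; rewrite in_cons lJ orbT.
move=> v; rewrite memv_cap mem_perpv innerBr subr_eq0 => /andP[_ /eqP fg].
by rewrite innerBr fg -innerBr e innerZr.
Qed.
End Regions.

Section Tessellation.
Context {R : realType} {d : nat}.
Local Notation V := 'rV[R]_d.
Implicit Types (u v w x : V) (As : seq V) (t : bitseq).

Definition generic As v := all (fun x => inner v x != 0) As.

Definition closed_cell As v : set V :=
  [set w | forall x, x \in As -> 0 <= inner v x * inner w x].

Definition open_cell As v : set V :=
  [set w | forall x, x \in As -> 0 < inner v x * inner w x].

(** A form keeps its sign on a connected set that avoids its hyperplane;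
    conversely an open cell is convex. *)
Lemma open_cell_component As v : generic As v ->
  connected_component [set w | generic As w] v = open_cell As v.
Proof.
move=> /allP gv; apply/seteqP; split=> w.
  move=> [B [Bv BU cB] Bw] x xA; rewrite lt0r mulf_neq0 ?gv ?(allP (BU _ Bw)) //=.
  rewrite leNgt; apply/negP => neg.
  have cI : is_interval [set inner z x | z in B].
    apply/connected_intervalP; apply: connected_continuous_connected => //.
    by apply: continuous_subspaceT => z; exact: inner_continuous.
  have Iv : [set inner z x | z in B] (inner v x) by exists v.
  have Iw : [set inner z x | z in B] (inner w x) by exists w.
  have [z Bz zx] : [set inner z x | z in B] 0.
    have := gv x xA; rewrite neq_lt => /orP[vx|vx].
      by apply: (cI _ _ Iv Iw); rewrite (ltW vx) ltW // -(nmulr_rlt0 _ vx).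
    by apply: (cI _ _ Iw Iv); rewrite (ltW vx) ltW // -(pmulr_rlt0 _ vx).
  by have := allP (BU _ Bz) x xA; rewrite zx eqxx.
move=> cw; pose f (t : R) : V := v + t *: (w - v).
exists (f @` [set` `[0, 1]]); last first.
  by exists 1; rewrite /= ?in_itv /= ?ler01 ?lexx // /f scale1r addrC subrK.
split.
- by exists 0; rewrite /= ?in_itv /= ?ler01 ?lexx // /f scale0r addr0.
- move=> _ [t tI <-]; move: tI; rewrite /= in_itv /= => /andP[t0 t1].
  apply/allP => x xA.
  have : 0 < inner v x * inner (f t) x.
    rewrite (_ : _ * _ = (1 - t) * inner v x ^+ 2 + t * (inner v x * inner w x)).
      have [->|tn1] := eqVneq t 1; first by rewrite subrr mul0r add0r mul1r cw.
      apply: ltr_pwDl; last by rewrite mulr_ge0 // ltW // cw.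
      by rewrite mulr_gt0 ?exprn_even_gt0 ?gv // subr_gt0 lt_neqAle tn1.
    by rewrite /f innerDl innerZl innerBl; ring.
  by apply: contraTneq => ->; rewrite mulr0 ltxx.
- apply: connected_continuous_connected; first exact: segment_connected.
  apply: continuous_subspaceT => t; apply: cvgD; first exact: cvg_cst.
  by apply: cvgZr_tmp; exact: cvg_id.
Qed.

(** A point of the closed cell is approached from the open one by adding small
    multiples of [v]. *)
Lemma closure_open_cell As v : generic As v ->
  closure (open_cell As v) = closed_cell As v.
Proof.
move=> /allP gv; apply/seteqP; split.
  have cl : closed (closed_cell As v).
    have -> : closed_cell As v =
        \bigcap_(x in [set` As]) [set w | 0 <= inner w (inner v x *: x)].
      by apply/seteqP; split=> w h x xA; have := h x xA; rewrite /= innerZr.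
    by apply: closed_bigI => x _; exact: inner_ge0_closed.
  rewrite (closure_id (closed_cell As v)).1 //; apply: closureS => w h x xA.
  exact/ltW/h.
move=> w hw B /nbhs_ballP [e /= e0 eB].
pose c := e / 2 / (1 + `|v|).
have n0 : 0 < 1 + `|v| by rewrite ltr_pwDl.
have c0 : 0 < c by rewrite !divr_gt0.
exists (w + c *: v); split.
  move=> x xA; rewrite innerDl innerZl mulrDr ltr_wpDl ?hw //.
  by rewrite mulrCA mulr_gt0 // -expr2 exprn_even_gt0 ?gv.
apply: eB; rewrite -ball_normE /= opprD addNKr normrN normrZ gtr0_norm //.
have : c * (1 + `|v|) = e / 2 by rewrite /c divfK // gt_eqF.
by rewrite mulrDr mulr1; move: c0 e0; lra.
Qed.

(** Only the hyperplanes matter, not the normals that describe them. *)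
Lemma tessellation_cells (N : set V) As :
  (forall v, (exists2 x, N x & inner v x = 0) <-> exists2 x, x \in As & inner v x = 0) ->
  tessellation N = [set closed_cell As v | v in [set v | generic As v]].
Proof.
move=> NA; rewrite /tessellation.
have -> : ~` (\bigcup_(x in N) perp x) = [set v | generic As v].
  apply/seteqP; split=> v /=.
    move=> h; apply/allP => x xA; apply: contra_notN h => /eqP vx.
    by have [|y Ny yv] := (NA v).2; [exists x|exists y].
  move=> /allP gv [x Nx vx]; have [|y yA yv] := (NA v).1; first by exists x.
  by have := gv y yA; rewrite yv eqxx.
apply/seteqP; split=> _ [v gv <-]; exists v => //.
  by rewrite open_cell_component // closure_open_cell.
by rewrite open_cell_component // closure_open_cell.
Qed.

Lemma has_signs_generic v As t : size t = size As -> has_signs v As t -> generic As v.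
Proof.
move=> st h; apply/allP => x xA; have := h x (nth true t (index x As)).
rewrite -[X in (X, _)](nth_index 0 xA) -nth_zip ?st //.
rewrite mem_nth ?size_zip ?st ?minnn ?index_mem // => /(_ isT).
by apply: contraTneq => ->; rewrite mulr0 ltxx.
Qed.

Definition signs As v : bitseq := [seq inner v x < 0 | x <- As].

Lemma has_signs_signs v As : generic As v -> has_signs v As (signs As v).
Proof.
move=> gv x b; rewrite /signs -[X in zip X]map_id zip_map => /mapP[y yA [-> ->]].
by rewrite signr_pos // (allP gv).
Qed.

Lemma has_signs_inj v As t : size t = size As -> has_signs v As t -> t = signs As v.
Proof.
elim: As t => [|x As ih] [|b t] //= [st] /has_signs_cons[vx h].
rewrite (ih t) //; congr (_ :: _); apply/eqP; rewrite -signr_pos //.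
by apply: contraTneq vx => ->; rewrite mulr0 ltxx.
Qed.

Lemma closed_cell_inj v w As : generic As v -> generic As w ->
  closed_cell As v = closed_cell As w -> signs As v = signs As w.
Proof.
move=> gv gw e; apply/eq_in_map => x xA.
have : closed_cell As w v.
  by rewrite -e => y yA; rewrite -expr2 sqr_ge0.
move=> /(_ x xA) vw; have {}vw : 0 < inner w x * inner v x.
  by rewrite lt0r vw mulf_neq0 ?(allP gv) ?(allP gw).
apply/idP/idP => neg; move: vw; first by rewrite (nmulr_lgt0 _ neg).
by rewrite (nmulr_rgt0 _ neg).
Qed.

Lemma closed_cell_signs v w As : signs As v = signs As w -> generic As v ->
  generic As w -> closed_cell As v = closed_cell As w.
Proof.
move=> /eq_in_map e gv gw; apply/seteqP; split=> z h x xA; move: (h x xA) (e x xA);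
  have := allP gv x xA; have := allP gw x xA;
  rewrite neq_lt => /orP wx; rewrite neq_lt => /orP vx; case: wx vx => wx [] vx;
  rewrite ?(pmulr_rge0 _ vx) ?(pmulr_rge0 _ wx) ?(nmulr_rge0 _ vx) ?(nmulr_rge0 _ wx) //;
  by rewrite ?wx ?vx ?(lt_gtF wx) ?(lt_gtF vx).
Qed.

Lemma card_cells As :
  let W := [set closed_cell As v | v in [set v | generic As v]] in
  finite_set W /\ #|` fset_set W|%fset = regions fullv As.
Proof.
move=> W; pose s := [seq t <- bits (size As) | `[< realizable fullv As t >]].
have wit t : exists v, t \in s -> generic As v /\ signs As v = t.
  have [|] := boolP (t \in s); last by exists 0.
  rewrite mem_filter mem_bits => /andP[/asboolP[v _ h] /eqP st]; exists v => _.
  by split; [exact: has_signs_generic h|rewrite -(has_signs_inj st h)].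
have [f fP] := choice wit.
have WE : W = [set` [seq closed_cell As (f t) | t <- s]].
  apply/seteqP; split=> C /=.
    move=> [v gv <-]; have vs : signs As v \in s.
      rewrite mem_filter mem_bits size_map eqxx andbT; apply/asboolP.
      by exists v; [exact: memvf|exact: has_signs_signs].
    apply/mapP; exists (signs As v) => //; have [gf ef] := fP _ vs.
    exact: closed_cell_signs.
  by move=> /mapP[t ts ->]; have [gf _] := fP _ ts; exists (f t).
have fW : finite_set W by rewrite WE; exact: finite_seq.
split=> //; have : perm_eq (fset_set W) [seq closed_cell As (f t) | t <- s].
  apply: uniq_perm; first exact: fset_uniq.
    rewrite map_inj_in_uniq ?filter_uniq ?bits_uniq // => t t' ts ts' e.
    have [gt et] := fP _ ts; have [gt' et'] := fP _ ts'.
    by rewrite -et -et'; exact: closed_cell_inj.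
  move=> C; rewrite in_fset_set // WE; apply/idP/idP; rewrite inE //.
move=> /perm_size; rewrite size_map size_filter => e.
by rewrite /regions /cnt -e.
Qed.

End Tessellation.

(** * Solid angles of the faces of Weyl chambers *)

Section WeylCones.
Context {R : realType} {d : nat}.
Local Notation V := 'rV[R]_d.
Variables (b : bool) (n : nat) (y : 'I_n -> V).
Implicit Types (g : {ffun 'I_n -> bool} * 'S_n) (S : {set 'I_n}) (u v w : V).

Definition coords v : 'I_n -> R := fun i => inner v (y i).

Definition walls g : 'I_n -> V := type_B_increment y g.1 g.2.

Lemma inner_walls g v i : inner v (walls g i) = increment (sact g (coords v)) i.
Proof.
rewrite /walls /type_B_increment /increment /sact /coords.
by case: ifP => _; rewrite ?innerBr !innerZr.
Qed.

(** The common form of the two general position hypotheses. *)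
Definition general_position : Prop :=
  (d <= #|wall b n|)%N /\ forall g S, g \in weyl n b -> S \subset wall b n ->
    #|S| = d -> free [seq walls g i | i in S].

Lemma mem_cone_walls g v : cone (walls g) (wall b n) v <-> dominant b (sact g (coords v)).
Proof.
split=> [h|/forall_inP h i iW]; last by rewrite inner_walls; exact: h.
by apply/forall_inP => i /h; rewrite inner_walls.
Qed.

Section Faces.
Variable m : nat.
Hypotheses (n_gt0 : (0 < n)%N) (m_le_n : (m <= n)%N) (m_gt0 : b || (0 < m)%N).
Implicit Type c : {ffun 'I_n -> option (bool * 'I_m)}.

(** The blocks of the labeling carry the values of [phi]; in [label_cone] these
    decrease along the names. *)
Definition label_flat c : set V :=
  [set v | exists phi, forall i, coords v i = ev phi (c i)].

Definition label_cone c : set V :=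
  [set v | exists2 phi, dominant b phi & forall i, coords v i = ev phi (c i)].

Lemma coords_lact g c phi v :
  (forall i, coords v i = ev phi (lact (sinv g) c i)) <->
  (forall i, sact g (coords v) i = ev phi (c i)).
Proof.
split=> h i.
  rewrite (eq_sact g (h : coords v =1 _)) -ev_lact.
  by rewrite -lact_smul smulgV lact1.
rewrite ev_lact -(eq_sact (sinv g) (h : sact g (coords v) =1 _)).
by rewrite sactK.
Qed.

Lemma flat_label g S v : admissible b m S ->
  v \in flat (walls g) S <-> label_flat (lact (sinv g) (standard_labeling m S)) v.
Proof.
move=> aS; split=> [/mem_flat h|[phi /coords_lact h]].
  have [|phi hphi] := standard_factor n_gt0 m_le_n m_gt0 aS (w := sact g (coords v)).
    by move=> i /h; rewrite inner_walls.
  by exists phi; apply/coords_lact.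
apply/mem_flat => i iS; rewrite inner_walls (eq_increment h).
have iW : i \in wall b n by move: aS => /andP[/fintype.subsetP/(_ i iS)].
by have := increment_standard n_gt0 m_le_n m_gt0 phi aS iW; rewrite iS.
Qed.

Lemma cone_face_label g S : admissible b m S ->
  cone_face (walls g) (wall b n) S =
  label_cone (lact (sinv g) (standard_labeling m S)).
Proof.
move=> aS; apply/seteqP; split=> v.
  move=> Fv; have := cone_face_flat Fv; move=> /(flat_label g v aS)[phi h].
  exists phi => //; apply: (standard_factor_dominant n_gt0 m_le_n m_gt0 aS).
  have [/mem_cone_walls dv _] := Fv.
  by rewrite -(eq_dominant b ((coords_lact g _ phi v).1 h)).
move=> [phi dphi h]; split.
  apply/mem_cone_walls; rewrite (eq_dominant b ((coords_lact g _ phi v).1 h)).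
  exact: (standard_dominant n_gt0 m_le_n m_gt0).
by apply/mem_flat/(flat_label g v aS); exists phi.
Qed.

Lemma valid_standard c : valid b c -> exists g S,
  [/\ g \in weyl n b, admissible b m S & c = lact (sinv g) (standard_labeling m S)].
Proof.
move=> vc; have [g gW dg] := exists_dominant b (fun i => ev (heights R (m := m)) (c i)).
have [||S aS e] := @dominant_labeling_standard R b n m n_gt0 m_le_n m_gt0 (lact g c).
- exact: valid_lact.
- by rewrite dominant_lact.
by exists g, S; rewrite -e lactK.
Qed.

Lemma label_flat_lrelabel t c : label_flat (lrelabel t c) = label_flat c.
Proof.
apply/seteqP; split=> v [phi h].
  by exists (sact t phi) => i; rewrite h ffunE ev_relabel.
exists (sact (sinv t) phi) => i; rewrite h ffunE ev_relabel.
case: (c i) => [[e j]|] //=; rewrite -sact_smul smulgV /sact /= ffunE perm1.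
by rewrite mul1r.
Qed.

(** Sort the values of the blocks by an element of the smaller group. *)
Lemma label_flat_cover c v : label_flat c v ->
  exists2 t, t \in weyl m b & label_cone (lrelabel t c) v.
Proof.
move=> [phi h]; have [g gW dg] := exists_dominant b phi.
exists (sinv g); first exact: sinv_weyl.
exists (sact g phi) => // i; rewrite h ffunE ev_relabel.
by case: (c i) => [[e j]|] //=; rewrite sactK.
Qed.

(** Two dominant points of one orbit of the smaller group coincide, and a
    strictly dominant one has no stabilizer. *)
Lemma label_cone_unique c t t' phi v : valid b c -> t \in weyl m b -> t' \in weyl m b ->
  strictly_dominant b phi -> (forall i, coords v i = ev phi (lrelabel t c i)) ->
  label_cone (lrelabel t' c) v -> t = t'.
Proof.
move=> /validP[surj _] tW t'W sphi h [phi' dphi' h'].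
have e : sact t phi =1 sact t' phi'.
  move=> j; have [i [s ci]] := surj j.
  have := h' i; rewrite h !ffunE !ev_relabel ci /= => /mulfI; apply.
  by rewrite signr_eq0.
have e' : sact (smul (sinv t') t) phi =1 phi'.
  by move=> j; rewrite sact_smul (eq_sact _ e) sactK.
have uW : smul (sinv t') t \in weyl m b by rewrite smul_weyl ?sinv_weyl.
have := dominant_unique uW (strictly_dominant_dominant sphi).
rewrite (eq_dominant b e') => /(_ dphi') e2.
have := strictly_dominant_free uW sphi e2; rewrite -(smulV t').
by move=> /smulI.
Qed.

End Faces.

Hypotheses (gp : general_position) (n_gt0 : (0 < n)%N).
Variable k : nat.
Hypotheses (hk : (0 < k <= d)%N) (dn : (d <= n)%N) (typ : b || (d < n)%N).

Let m := (n - (d - k))%N.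

Let m_le_n : (m <= n)%N. Proof. exact: leq_subr. Qed.

Let m_gt0 : b || (0 < m)%N.
Proof. by move: typ hk; rewrite /m; case: b => //=; lia. Qed.

Let nm : (n - m = d - k)%N.
Proof. by rewrite /m; move: hk dn; lia. Qed.

Let wfree g (gW : g \in weyl n b) S : S \subset wall b n -> #|S| = d ->
  free [seq walls g i | i in S].
Proof. exact: gp.2. Qed.

Definition label_mass (c : {ffun 'I_n -> option (bool * 'I_m)}) : R :=
  fine (sphere_law (linear_hull (label_flat c)) (label_cone c)).

Lemma linear_hull_label_flat g S : admissible b m S ->
  linear_hull (label_flat (lact (sinv g) (standard_labeling m S))) = flat (walls g) S.
Proof.
move=> aS; rewrite -[RHS]linear_hull_vspace; congr linear_hull.
by apply/seteqP; split=> v /(flat_label n_gt0 m_le_n m_gt0 g v aS).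
Qed.

Lemma face_mass_label g S : admissible b m S ->
  face_mass (walls g) (wall b n) S = label_mass (lact (sinv g) (standard_labeling m S)).
Proof.
by move=> aS; rewrite /label_mass linear_hull_label_flat // -cone_face_label.
Qed.

Lemma sphere_law_wall_null g S i : g \in weyl n b -> admissible b m S ->
  i \in wall b n -> i \notin S ->
  sphere_law (flat (walls g) S) [set v : V | v \in flat (walls g) (i |: S)] = 0%E.
Proof.
move=> gW aS iW iS; have [SW /eqP cS] := andP aS.
have card_iS : #|i |: S| = (d - k).+1 by rewrite cardsU1 iS cS nm.
have iSW : i |: S \subset wall b n by rewrite finset.subUset finset.sub1set iW.
apply: (@uniform_subspace_null _ _ (flat (walls g) S)).
- apply: sphere_law_uniform; rewrite -dimv_eq0 (dim_flat (wfree gW) gp.1) // cS nm.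
  by move: hk; lia.
- by apply/subvP => v /mem_flat h; apply/mem_flat => l lS; apply: h; rewrite inE lS orbT.
- rewrite !(dim_flat (wfree gW) gp.1) // card_iS cS nm; move: hk; lia.
Qed.

(** Relabeling the blocks in all possible ways produces cones that cover the
    flat of [c] and, the group of the blocks being free on strictly dominant
    points, overlap only on walls. So their solid angles add up to one: this is
    where the size of the group of rank [m] enters, whatever the position of
    the points [y]. *)
Lemma sum_label_mass c : valid b c ->
  \sum_(t in weyl m b) label_mass (lrelabel t c) = 1.
Proof.
move=> vc; have [g0 [S0 [g0W aS0 ec]]] := valid_standard n_gt0 m_le_n m_gt0 vc.
set L := flat (walls g0) S0; have [S0W /eqP cS0] := andP aS0.
have L0 : L != 0%VS.
  by rewrite -dimv_eq0 (dim_flat (wfree g0W) gp.1) // cS0 nm; move: hk; lia.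
have hullE t : linear_hull (label_flat (lrelabel t c)) = L.
  by rewrite label_flat_lrelabel ec linear_hull_label_flat.
have [mu1 _] := sphere_law_uniform L0; set mu := sphere_law L in mu1 *.
pose F (t : {ffun 'I_m -> bool} * 'S_m) : set V :=
  if t \in weyl m b then label_cone (lrelabel t c) else set0.
have rep t : t \in weyl m b -> exists g S, [/\ g \in weyl n b, admissible b m S,
    lrelabel t c = lact (sinv g) (standard_labeling m S),
    flat (walls g) S = L & F t = cone_face (walls g) (wall b n) S].
  move=> tW; have [g [S [gW aS e]]] := valid_standard n_gt0 m_le_n m_gt0 (valid_lrelabel tW vc).
  exists g, S; split=> //; first by rewrite -(linear_hull_label_flat g aS) -e hullE.
  by rewrite /F tW (cone_face_label n_gt0 m_le_n m_gt0 g aS) e.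
have mF t : measurable (F t : set (borel R d)).
  apply: closed_borel; rewrite /F; case: ifP => [tW|_]; last exact: closed0.
  have [g [S [_ _ _ _ e]]] := rep t tW; move: e; rewrite /F tW => ->.
  exact: cone_face_closed.
have F0 t t' : t != t' -> mu (F t `&` F t') = 0%E.
  move=> tt'; have [tW|tW] := boolP (t \in weyl m b); last first.
    by rewrite /F (negbTE tW) set0I measure0.
  have [g [S [gW aS e fL FE]]] := rep t tW.
  (* [Z i] is the part of the flat on one more wall [i]; off all of these, the
     block values decrease strictly and [t] is determined *)
  pose Z (i : 'I_n) : set V := if (i \in wall b n) && (i \notin S) then
    [set v : V | v \in flat (walls g) (i |: S)] else set0.
  have mZ i : measurable (Z i : set (borel R d)).
    by apply: closed_borel; rewrite /Z; case: ifP => _; [exact: vspace_closed|exact: closed0].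
  have Z0 i : mu (Z i) = 0%E.
    rewrite /Z; case: ifPn => [/andP[iW iS]|_]; last by rewrite measure0.
    by rewrite /mu -fL; exact: sphere_law_wall_null.
  have ZU : mu (\bigcup_i Z i) = 0%E.
    rewrite probability_bigcup_null ?big1 // => i j _.
    apply: (@subset_measure0 _ _ _ mu (Z i `&` Z j) (Z i)) => //.
      exact: measurableI.
    exact: Z0.
  apply: (@subset_measure0 _ _ _ mu _ (\bigcup_i Z i)) => //.
  - exact: measurableI.
  - exact: fin_bigcup_measurable.
  move=> v [Ftv Ft'v]; apply: contrapT => nZ; move/eqP: tt'; apply.
  have t'W : t' \in weyl m b by move: Ft'v; rewrite /F; case: ifP.
  move: Ft'v; rewrite /F t'W => Ft'v.
  have := Ftv; rewrite /F tW => -[phi dphi hphi].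
  apply: (label_cone_unique vc tW t'W _ hphi Ft'v).
  apply: (standard_factor_strict n_gt0 m_le_n m_gt0 aS) => i iW iS.
  have hs := (coords_lact g (standard_labeling m S) phi v).1.
  rewrite -e in hs; rewrite -(eq_increment (hs hphi)) -inner_walls.
  move: Ftv; rewrite FE => Fv; have [Cv _] := Fv.
  rewrite lt0r Cv // andbT; apply/eqP => i0; apply: nZ; exists i => //.
  rewrite /Z iW iS /=; apply/mem_flat => l; rewrite inE => /orP[/set1P->//|lS].
  by have [_] := Fv; apply.
have sumF : mu (\bigcup_t F t) = (\sum_t mu (F t))%E by exact: probability_bigcup_null.
have mU : measurable (\bigcup_t F t : set (borel R d)).
  by apply: fin_bigcup_measurable => [|t _]; [exact: finite_finset|exact: mF].
have FU : mu (\bigcup_t F t) = 1%E.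
  apply/le_anti/andP; split; first exact: (probability_le1 mu mU).
  rewrite -mu1; apply: le_measure; rewrite ?inE //.
    by apply: closed_borel; exact: unit_sphere_closed.
  move=> v [vL _]; have [|t tW cv] := @label_flat_cover m c v.
    by rewrite ec; exact/(flat_label n_gt0 m_le_n m_gt0 g0 v aS0).
  by exists t => //; rewrite /F tW.
have : (\sum_(t in weyl m b) label_mass (lrelabel t c))%:E = mu (\bigcup_t F t).
  rewrite sumF [in RHS](bigID (mem (weyl m b))) /= [X in (_ + X)%E]big1 ?adde0.
    rewrite -sumEFin; apply: eq_bigr => t tW.
    rewrite /label_mass hullE /F tW fineK //.
    rewrite ge0_fin_numE //; apply: le_lt_trans (probability_le1 mu _) (ltry _).
    by have := mF t; rewrite /F tW.
  by move=> t tW; rewrite /F (negbTE tW) measure0.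
by rewrite FU => -[].
Qed.

(** Each group element and each set of [d - k] walls gives one face, and those
    sharing a flat tile it. *)
Lemma sum_face_mass : #|weyl m b|%:R *
  (\sum_(g in weyl n b) \sum_(S : {set 'I_n} | (S \subset wall b n) && (#|S| == (d - k)%N))
     face_mass (walls g) (wall b n) S) =
  #|weyl n b|%:R * ('C(#|wall b n|, d - k))%:R.
Proof.
have := weyl_face_sum n_gt0 m_le_n m_gt0 sum_label_mass.
rewrite [X in _ = _ * X%:R](_ : _ = 'C(#|wall b n|, d - k)); last first.
  by rewrite -cards_draws; apply: eq_card => S; rewrite !inE /admissible nm.
move=> <-; congr (_ * _); apply: eq_bigr => g gW; apply: eq_big => S.
  by rewrite /admissible nm.
by move=> aS; rewrite face_mass_label // /admissible nm.
Qed.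

End WeylCones.

(** * Counting the regions of a Weyl arrangement *)

Section RegionCount.
Context {R : realType} {d : nat}.
Local Notation V := 'rV[R]_d.
Variables (b : bool) (y : nat -> V).
Implicit Types (U L : {vspace V}) (u v w : V) (l : option (bool * nat)).

(** The forms that a new form is compared with: the previous ones, and in the
    signed case also their opposites and zero. *)
Definition pm_labels (n : nat) : seq (option (bool * nat)) :=
  [seq Some (false, i) | i <- iota 0 n] ++
  (if b then None :: [seq Some (true, i) | i <- iota 0 n] else [::]).

Definition pm_form l : V := if l is Some (e, i) then (-1) ^+ e *: y i else 0.

(** Normals of the reflection arrangement, one new form at a time. *)
Fixpoint arrangement (n : nat) : seq V :=
  if n is n'.+1 then
    [seq y n' - g | g <- [seq pm_form l | l <- pm_labels n']] ++ arrangement n'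
  else [::].

Lemma mem_pm_labels n l : (l \in pm_labels n) =
  if l is Some (e, i) then (i < n)%N && (b || ~~ e) else b.
Proof.
have S e s (e' : bool) i :
    (Some (e', i) \in [seq Some (e, i) | i <- iota 0 s]) = (e == e') && (i < s)%N.
  apply/mapP/andP => [[j]|[/eqP -> h]]; last by exists i; rewrite ?mem_iota.
  by rewrite mem_iota /= => h [-> ->].
have N e s : (None \in [seq Some (e, i) | i <- iota 0 s]) = false.
  by apply/mapP => -[].
rewrite /pm_labels mem_cat; case: l => [[e i]|]; rewrite ?S ?N; case: (b) => //=.
- by rewrite in_cons /= S; case: e => /=; rewrite ?andbT ?orbF.
- by rewrite orbF; case: e; rewrite ?andbT ?andbF.
Qed.

Lemma pm_labels_uniq n : uniq (pm_labels n).
Proof.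
have inj (e : bool) : injective (fun i : nat => Some (e, i)) by move=> ? ? [].
rewrite cat_uniq (map_inj_uniq (inj false)) iota_uniq /=; case: b => //=.
rewrite (map_inj_uniq (inj true)) iota_uniq andbT /=; apply/andP; split.
  rewrite negb_or; apply/andP; split; first by apply/mapP => -[].
  by apply/hasPn => _ /mapP[i _ ->]; apply/mapP => -[].
by apply/mapP => -[].
Qed.

Lemma size_pm_labels n : size (pm_labels n) = (if b then n.*2.+1 else n).
Proof.
rewrite size_cat size_map size_iota; case: b => /=; last by rewrite addn0.
by rewrite size_map size_iota; lia.
Qed.

Lemma arrangementP n x : reflect
  (exists j l, [/\ (j < n)%N, l \in pm_labels j & x = y j - pm_form l])
  (x \in arrangement n).
Proof.
elim: n => [|n ih] /=; first by apply: (iffP idP) => // -[j [l []]].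
rewrite mem_cat; apply: (iffP orP) => [[/mapP[_ /mapP[l hl ->] ->]|/ih[j [l [jn hl ->]]]]|].
- by exists n, l.
- by exists j, l; split=> //; exact: ltnW.
move=> [j [l [jn hl xE]]]; have [e|ne] := eqVneq j n.
  by left; rewrite xE; rewrite e in hl *; apply/map_f/map_f.
by right; apply/ih; exists j, l; split=> //; lia.
Qed.

Lemma signed_diff (s s' : bool) (p q : V) :
  (-1) ^+ s *: p - (-1) ^+ s' *: q = (-1) ^+ s *: (p - (-1) ^+ (s (+) s') *: q).
Proof. by rewrite scalerBr scalerA -signr_addb addbA addbb addFb. Qed.

(** Two hyperplanes of the new form meet inside a hyperplane that the older
    forms already provide: this is what makes the arrangement supersolvable. *)
Lemma pm_form_diff n l l' : l \in pm_labels n -> l' \in pm_labels n -> l != l' ->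
  exists2 a, a \in arrangement n & exists2 c : R, c != 0 & pm_form l - pm_form l' = c *: a.
Proof.
rewrite !mem_pm_labels; case: l => [[e i]|]; case: l' => [[e' j]|] //=.
- move=> /andP[hi he] /andP[hj he'] ne.
  have sb : b || ~~ (e (+) e') by case: (b) he he' => //=; case: e {ne}; case: e'.
  have [ij|ji|ij] := ltngtP i j.
  + exists (y j - pm_form (Some (e (+) e', i))).
      by apply/arrangementP; exists j, (Some (e (+) e', i)); rewrite mem_pm_labels ij sb.
    exists (- (-1) ^+ e'); first by rewrite oppr_eq0 signr_eq0.
    by rewrite /= scaleNr addbC -signed_diff opprB.
  + exists (y i - pm_form (Some (e (+) e', j))).
      by apply/arrangementP; exists i, (Some (e (+) e', j)); rewrite mem_pm_labels ji sb.
    exists ((-1) ^+ e); first by rewrite signr_eq0.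
    exact: signed_diff.
  + have hb : b.
      move: ne; rewrite ij; case: (b) he he' => //=.
      by case: (e); case: (e') => //; rewrite eqxx.
    exists (y i - pm_form None).
      by apply/arrangementP; exists i, None; rewrite mem_pm_labels.
    exists (2 * (-1) ^+ e); first by rewrite mulf_neq0 ?signr_eq0 ?pnatr_eq0.
    have -> : e' = ~~ e by move: ne; rewrite ij; case: (e); case: (e'); rewrite ?eqxx.
    by rewrite /= subr0 -ij -scalerBl signrN opprK mulr_natl mulr2n.
- move=> /andP[hi he] hb _; exists (y i - pm_form None).
    by apply/arrangementP; exists i, None; rewrite mem_pm_labels.
  by exists ((-1) ^+ e); rewrite ?signr_eq0 //= !subr0.
- move=> hb /andP[hi he] _; exists (y j - pm_form None).
    by apply/arrangementP; exists j, None; rewrite mem_pm_labels.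
  by exists (- (-1) ^+ e'); rewrite ?oppr_eq0 ?signr_eq0 //= subr0 sub0r scaleNr.
Qed.

(** General position relative to a subspace [U] of dimension [e], in a form
    that survives the deletion of the last form as well as the restriction to
    one of its hyperplanes. *)
Definition flat_dims n U e : Prop :=
  forall m (c : {ffun 'I_n -> option (bool * 'I_m)}) L, valid b c ->
    (forall v, v \in L <-> (v \in U /\ exists phi, forall i : 'I_n, inner v (y i) = ev phi (c i))) ->
    \dim L = (e - (n - m))%N.

Lemma valid_le n m (c : {ffun 'I_n -> option (bool * 'I_m)}) : valid b c -> (m <= n)%N.
Proof.
move=> /validP[surj _]; have [f fP] := fin_all_exists surj.
have inj : injective f.
  by move=> j j' e; have [s] := fP j; have [s'] := fP j'; rewrite e => -> [].
by have := leq_card f inj; rewrite !card_ord.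
Qed.

Definition singletons n : {ffun 'I_n -> option (bool * 'I_n)} := [ffun i => Some (false, i)].

Lemma singletons_valid n : valid b (singletons n).
Proof.
apply/validP; split; first by move=> j; exists j, false; rewrite ffunE.
by right=> i; exists i; rewrite ffunE.
Qed.

Lemma flat_dims_dim n U e : flat_dims n U e -> \dim U = e.
Proof.
move=> h; rewrite (h n (singletons n) U (singletons_valid n)) ?subnn ?subn0 // => v.
split=> [vU|[]//]; split=> //; exists (fun i => inner v (y i)) => i.
by rewrite ffunE /= mul1r.
Qed.

Definition extend_new n m (c : {ffun 'I_n -> option (bool * 'I_m)}) :
    {ffun 'I_n.+1 -> option (bool * 'I_m.+1)} :=
  [ffun i => if unlift ord_max i is Some i'
    then omap (fun p => (p.1, lift ord_max p.2)) (c i') else Some (false, ord_max)].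

(** The deleted form can be kept as a block of its own, which leaves the flat
    and the number [n - m] unchanged. *)
Lemma flat_dims_pred n U e : flat_dims n.+1 U e -> flat_dims n U e.
Proof.
move=> h m c L vc memL; have /validP[surj typ] := vc.
have cl i : extend_new c (lift ord_max i) = omap (fun p => (p.1, lift ord_max p.2)) (c i).
  by rewrite ffunE liftK.
have cm : extend_new c ord_max = Some (false, ord_max) by rewrite ffunE unlift_none.
rewrite (h _ (extend_new c) L) ?subSS // => [|v].
  apply/validP; split.
    move=> j; case: (unliftP ord_max j) => [j'|] ->.
      by have [i [s ci]] := surj j'; exists (lift ord_max i), s; rewrite cl ci.
    by exists ord_max, false.
  case: typ => [hb|ht]; [by left|right=> i].
  case: (unliftP ord_max i) => [i'|] ->; last by exists ord_max.
  by have [j cj] := ht i'; exists (lift ord_max j); rewrite cl cj.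
rewrite memL; split=> -[vU [phi hphi]]; split=> //.
  exists (fun j => if unlift ord_max j is Some j' then phi j' else inner v (y n)) => i.
  case: (unliftP ord_max i) => [i'|] ->.
    rewrite cl lift_max hphi; case: (c i') => [[s j]|] //=.
    by rewrite liftK.
  by rewrite cm /= mul1r unlift_none.
exists (fun j => phi (lift ord_max j)) => i.
have := hphi (lift ord_max i); rewrite lift_max cl => ->.
by case: (c i) => [[s j]|].
Qed.

Definition extend_old n m (l : option (bool * 'I_n)) (c : {ffun 'I_n -> option (bool * 'I_m)}) :
    {ffun 'I_n.+1 -> option (bool * 'I_m)} :=
  [ffun i => if unlift ord_max i is Some i' then c i'
    else if l is Some (s, i') then twist s (c i') else None].

(** On the hyperplane where the last form agrees with [l], it joins the block
    of [l]. *)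
Lemma flat_dims_perp n U e l : flat_dims n.+1 U e.+1 -> l \in pm_labels n ->
  flat_dims n (U :&: perpv (y n - pm_form l)) e.
Proof.
move=> h hl m c L vc memL; have /validP[surj typ] := vc.
rewrite mem_pm_labels in hl.
have [l' [fl' bl']] : exists l' : option (bool * 'I_n),
    pm_form l = (if l' is Some (s, i) then (-1) ^+ s *: y i else 0) /\
    (b \/ exists i, l' = Some (false, i)).
  case: (l) hl => [[s i]|] /=; last by move=> hb; exists None; split=> //; left.
  move=> /andP[hi hs]; exists (Some (s, Ordinal hi)); split=> //.
  by case/orP: hs => [|/negbTE->]; [left|right; exists (Ordinal hi)].
have cl i : extend_old l' c (lift ord_max i) = c i by rewrite ffunE liftK.
have cm : extend_old l' c ord_max = if l' is Some (s, i') then twist s (c i') else None.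
  by rewrite ffunE unlift_none.
rewrite (h _ (extend_old l' c) L).
- by have := valid_le vc; lia.
- apply/validP; split.
    by move=> j; have [i [s ci]] := surj j; exists (lift ord_max i), s; rewrite cl.
  case: bl' typ => [hb|[i0 e0]] typ; [by left|]; case: typ => [hb|ht]; [by left|right=> i].
  case: (unliftP ord_max i) => [i'|] ->; first by have [j cj] := ht i'; exists j; rewrite cl.
  by rewrite cm e0; have [j ->] := ht i0; exists j.
move=> v; rewrite memL memv_cap mem_perpv innerBr subr_eq0 fl'; split.
  move=> [/andP[vU /eqP vn] [phi hphi]]; split=> //; exists phi => i.
  case: (unliftP ord_max i) => [i'|] ->; first by rewrite cl lift_max.
  rewrite cm /= vn; case: (l') => [[s i']|]; last by rewrite inner0r.
  by rewrite ev_twist innerZr hphi.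
move=> [vU [phi hphi]].
have hi (i : 'I_n) : inner v (y i) = ev phi (c i).
  by have := hphi (lift ord_max i); rewrite lift_max cl.
split; last by exists phi.
rewrite vU /=; have /= -> := hphi ord_max; rewrite cm.
case: (l') => [[s i']|]; last by rewrite inner0r.
by rewrite ev_twist innerZr hi.
Qed.

(** In dimension zero any hyperplane contains the whole space and leaves no
    region. *)
Fixpoint region_count (n e : nat) : nat :=
  if n is n'.+1 then
    if e is e'.+1
    then (region_count n' e + size (pm_labels n') * region_count n' e')%N
    else if size (pm_labels n') == 0%N then region_count n' 0 else 0%N
  else 1%N.

(** The hyperplanes of the new form cut as many new regions as they carry
    regions of the old arrangement, each of them being again in general
    position in one dimension less. *)
Theorem regions_arrangement n U e : flat_dims n U e ->
  regions U (arrangement n) = region_count n e.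
Proof.
elim: n U e => [|n ih] U e hU.
  rewrite /regions /cnt /=; rewrite (_ : `[< _ >]) //; apply/asboolP.
  by exists 0; rewrite ?mem0v.
case: e hU => [|e] hU.
  have U0 u : u \in U -> u = 0.
    by have /eqP := flat_dims_dim hU; rewrite dimv_eq0 => /eqP ->; rewrite memv0 => /eqP.
  rewrite /=; have := ih U 0%N (flat_dims_pred hU).
  case: (pm_labels n) => [//|l s _] /=.
  by rewrite regions_cons0 // => u /U0 ->; rewrite inner0l.
have dimU := flat_dims_dim hU.
rewrite /= regions_add_block.
- rewrite (ih U e.+1 (flat_dims_pred hU)) big_map; congr (_ + _)%N.
  rewrite (eq_big_seq (fun=> region_count n e)).
    by rewrite big_const_seq count_predT iter_addn_0 mulnC.
  by move=> l hl; apply: ih; exact: flat_dims_perp.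
- move=> _ /mapP[l hl ->]; apply: contrapT => nu.
  have : (U <= U :&: perpv (y n - pm_form l))%VS.
    apply/subvP => u uU; rewrite memv_cap uU mem_perpv.
    by apply/negPn/negP => un; apply: nu; exists u.
  by move=> /dimvS; rewrite dimU (flat_dims_dim (flat_dims_perp hU hl)) ltnn.
- rewrite pairwise_map; have := pm_labels_uniq n; rewrite uniq_pairwise.
  apply: sub_in_pairwise (allss _) => l l' hl hl' ne; apply/asboolP.
  exact: pm_form_diff.
Qed.

End RegionCount.

(** * Region numbers and Stirling numbers *)

Section RegionNumbers.
Variable b : bool.
Implicit Types n e i j k : nat.

Let s n : nat := if b then n.*2.+1 else n.

(** The unsigned coefficients of the characteristic polynomial, counted from
    the top. *)
Fixpoint char_coef n j : nat :=
  if n is n'.+1 then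
    (char_coef n' j + (if j is j'.+1 then s n' * char_coef n' j' else 0))%N
  else (j == 0%N).

Lemma char_coef_gt n j : (n < j)%N -> char_coef n j = 0%N.
Proof.
elim: n j => [|n ih] [|j] //= nj; rewrite !ih ?muln0 //; lia.
Qed.

Definition char_poly_nat n : {poly nat} := \prod_(i < n) ('X + (s i)%:R%:P).

Lemma char_poly_natP n k : (char_poly_nat n)`_k =
  if (k <= n)%N then char_coef n (n - k) else 0%N.
Proof.
rewrite /char_poly_nat; elim: n k => [|n ih] k.
  by rewrite big_ord0 coef1; case: k.
rewrite big_ord_recr /= mulrDr coefD coefMX coefMC !ih.
rewrite -[(s n)%:R]/(s n)%:R natn.
case: k => [|k] /=.
  rewrite !subn0 (char_coef_gt (ltnSn n)).
  by rewrite /GRing.add /= /GRing.mul /= mulnC.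
rewrite ltnS subSS; case: (ltngtP k n) => [kn|kn|->].
- rewrite (_ : (n - k = (n - k.+1).+1)%N); last by lia.
  by rewrite /GRing.add /= /GRing.mul /= mulnC.
- by rewrite /GRing.add /= /GRing.mul /= mul0n.
- by rewrite subnn /GRing.add /= /GRing.mul /= mul0n.
Qed.

Definition half_sum n e : nat :=
  (\sum_(0 <= i < e) (if i.*2 < e then char_coef n (e.-1 - i.*2) else 0))%N.

Lemma half_sum_widen n e N : (e <= N)%N -> half_sum n e =
  (\sum_(0 <= i < N) (if i.*2 < e then char_coef n (e.-1 - i.*2) else 0))%N.
Proof.
move=> eN; rewrite (big_cat_nat (leq0n e) eN) /= [X in (_ + X)%N]big1_seq ?addn0 // => i.
by rewrite mem_index_iota => /andP[_ /andP[ei _]]; rewrite ifN // -leqNgt; lia.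
Qed.

Lemma half_sumS n e :
  half_sum n.+1 e.+1 = (half_sum n e.+1 + s n * half_sum n e)%N.
Proof.
rewrite (half_sum_widen n (leqnSn e)) /half_sum big_distrr -big_split /=.
apply: eq_bigr => i _; case: ifP => h; last by rewrite ifN ?muln0 //; lia.
case: ifP => h'; last by rewrite (_ : (e - i.*2 = 0)%N) ?muln0 //; lia.
by rewrite (_ : (e - i.*2 = (e.-1 - i.*2).+1)%N) //; lia.
Qed.

Lemma half_sum_base n e : (forall j, char_coef n j = (j <= 1)%N) -> half_sum n e.+1 = 1%N.
Proof.
move=> h; rewrite /half_sum big_mkord.
have he : (e./2 < e.+1)%N by rewrite ltnS -[leqRHS]odd_double_half; lia.
rewrite (bigD1 (Ordinal he)) //= big1 ?addn0.
  rewrite h; have := odd_double_half e; case: (odd e) => /= eo; rewrite ifT; lia.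
move=> i; rewrite -val_eqE /= => ne; rewrite h; have := odd_double_half e.
by case: ifP => // hi; case: (odd e) => /=; lia.
Qed.

Let n0 := if b then 1%N else 2.

(** Both sides satisfy the same recursion. It starts at the first [n] for which
    the characteristic polynomial has the root one, from where on the unsigned
    coefficients of even and of odd index have the same sum. *)
Lemma region_count_half_sum n e : (n0 <= n)%N ->
  region_count b n e = (2 * half_sum n e)%N.
Proof.
have sE k : size (pm_labels b k) = s k by exact: size_pm_labels.
have base j : char_coef n0 j = (j <= 1)%N.
  by rewrite /n0; case bE : b; case: j => [|[|[|j]]] //=; rewrite /s bE.
have sum0 k : half_sum k 0 = 0%N by rewrite /half_sum big_geq.
move=> /subnK <-; elim: (n - n0)%N e => [|k ih] e.
  rewrite add0n; case: e => [|e]; last first.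
    rewrite (half_sum_base _ base) /n0; case bE : b => //=.
    by case: e.
  by rewrite sum0 /n0; case bE : b.
rewrite addSn; case: e => [|e]; last by rewrite half_sumS /= sE !ih; lia.
rewrite sum0 /= sE ifN //; rewrite /n0 /s; case bE : b => //; lia.
Qed.
End RegionNumbers.

Lemma region_count_DA n d : (2 <= n)%N -> (d <= n)%N -> region_count false n d = DA n d.
Proof.
move=> n2 dn; rewrite region_count_half_sum // /DA; congr (2 * _)%N.
rewrite (half_sum_widen false n (leqW dn)); apply: eq_bigr => i _.
rewrite /stirling1 (_ : \prod_(i0 < n) _ = char_poly_nat false n) // char_poly_natP.
case: ifP => h.
  rewrite !ifT; [|lia|lia].
  by congr (char_coef _ _ _); lia.
by rewrite [in RHS]ifN //; apply/negP; lia.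
Qed.

Lemma region_count_DB n d : (1 <= n)%N -> (d <= n)%N -> region_count true n d = DB n d.
Proof.
move=> n1 dn; rewrite region_count_half_sum // /DB; congr (2 * _)%N.
rewrite (half_sum_widen true n (leqW dn)); apply: eq_bigr => i _.
rewrite /stirlingB (_ : \prod_(i0 < n) _ = char_poly_nat true n) // char_poly_natP.
case: ifP => h; last by rewrite ifN //; lia.
by rewrite ifT; [congr (char_coef _ _ _)|]; lia.
Qed.

(** * The mean over the cones of a tessellation *)

Section WeylTessellation.
Context {R : realType} {d : nat}.
Local Notation V := 'rV[R]_d.
Variables (b : bool) (n : nat) (y : 'I_n -> V).
Implicit Types (g h : {ffun 'I_n -> bool} * 'S_n) (S : {set 'I_n}) (u v w x : V).

(** The forms continued by zero, since the arrangement is built along the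
    natural numbers. *)
Definition nat_forms (i : nat) : V := if insub i is Some i' then y i' else 0.

Lemma nat_forms_ord (i : 'I_n) : nat_forms i = y i.
Proof. by rewrite /nat_forms valK. Qed.

Definition normals : seq V := arrangement b nat_forms n.

(** A wall is a difference of two signed forms, or a single one, so that
    [pm_form_diff] applies. *)
Lemma wall_normal g i : g \in weyl n b -> i \in wall b n ->
  exists2 a, a \in normals & exists2 c : R, c != 0 & walls y g i = c *: a.
Proof.
move=> gW iW; have gb (j : 'I_n) : b || ~~ g.1 j.
  by move: gW; rewrite inE => /orP[->//|/eqP->]; rewrite ffunE orbT.
have -> : walls y g i = pm_form nat_forms (Some (g.1 i, val (g.2 i))) -
    pm_form nat_forms (if (i.+1 < n)%N then Some (g.1 (ordS i), val (g.2 (ordS i))) else None).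
  rewrite /walls /type_B_increment; case: ifP => _; rewrite /= ?nat_forms_ord //.
  by rewrite subr0.
apply: (pm_form_diff (b := b)); first by rewrite mem_pm_labels gb ltn_ord.
  rewrite mem_pm_labels; move: iW; rewrite inE.
  by case: ifP => hi; rewrite ?gb ?ltn_ord ?orbF.
case: ifP => hi //; apply/eqP => -[_ /val_inj/perm_inj e].
by have := congr1 (@nat_of_ord n) e; rewrite val_ordS //; lia.
Qed.

(** The group permutes the normals up to sign, so they look the same in the
    coordinates sorted by [g]. *)
Lemma normal_sorted x g : x \in normals -> g \in weyl n b -> exists s : bool,
  (exists i j : 'I_n, (i < j)%N /\ forall v, inner v x =
     (-1) ^+ s * (sact g (coords y v) i - sact g (coords y v) j)) \/
  (b /\ exists i j : 'I_n, forall v, inner v x =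
     (-1) ^+ s * (sact g (coords y v) i + sact g (coords y v) j)) \/
  (b /\ exists i : 'I_n, forall v, inner v x = (-1) ^+ s * sact g (coords y v) i).
Proof.
move=> /arrangementP[i [l [i_n hl ->]]] gW; pose p (j : 'I_n) := (g.2)^-1%g j.
have cE v (j : 'I_n) : inner v (nat_forms j) =
    (-1) ^+ (g.1 (p j)) * sact g (coords y v) (p j).
  by rewrite nat_forms_ord /sact /p permKV mulrA -signr_addb addbb mul1r.
have ci v := cE v (Ordinal i_n); move: ci => /= ci.
rewrite mem_pm_labels in hl; case: l hl => [[e j]|] hl; last first.
  exists (g.1 (p (Ordinal i_n))); right; right; split=> //.
  by exists (p (Ordinal i_n)) => v; rewrite subr0 ci.
move: hl => /andP[ji he]; have j_n : (j < n)%N by lia.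
have cj v := cE v (Ordinal j_n); move: cj => /= cj.
set a := p (Ordinal i_n) in ci *; set c := p (Ordinal j_n) in cj *.
have ac : a != c by apply/eqP => /perm_inj /(congr1 val) /= e'; move: ji; rewrite e' ltnn.
have xE v : inner v (nat_forms i - pm_form nat_forms (Some (e, j))) =
    (-1) ^+ (g.1 a) * (sact g (coords y v) a -
      (-1) ^+ (g.1 a (+) (e (+) g.1 c)) * sact g (coords y v) c).
  by rewrite innerBr /= innerZr ci cj mulrBr !mulrA -!signr_addb addbA addbb addFb.
have [dlt|dlt] := boolP (g.1 a (+) (e (+) g.1 c)).
  exists (g.1 a); right; left; split.
    move: gW; rewrite inE => /orP[//|/eqP g0]; move: dlt he.
    by rewrite g0 !ffunE addFb addbF; case: (b) => //=; case: (e).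
  by exists a, c => v; rewrite xE dlt expr1 mulN1r opprK.
have [ac'|ca] := ltnP a c.
  by exists (g.1 a); left; exists a, c; split=> // v; rewrite xE (negbTE dlt) mul1r.
exists (~~ g.1 a); left; exists c, a; split.
  by rewrite ltn_neqAle ca andbT; apply: contra ac => /eqP/val_inj->.
by move=> v; rewrite xE (negbTE dlt) mul1r signrN mulNr -mulrN opprB.
Qed.

Lemma strictly_dominant_generic g v : g \in weyl n b ->
  strictly_dominant b (sact g (coords y v)) -> generic normals v.
Proof.
move=> gW sv; apply/allP => x /normal_sorted/(_ gW) [s [|[]]].
- move=> [i [j [ij ->]]]; rewrite mulf_neq0 ?signr_eq0 // subr_eq0 gt_eqF //.
  exact: strictly_dominant_lt sv ij.
- move=> [hb [i [j ->]]]; rewrite mulf_neq0 ?signr_eq0 // gt_eqF // addr_gt0 //;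
    exact: strictly_dominant_gt0 sv hb.
- move=> [hb [i ->]]; rewrite mulf_neq0 ?signr_eq0 // gt_eqF //.
  exact: strictly_dominant_gt0 sv hb.
Qed.

Lemma generic_strictly_dominant g v : g \in weyl n b -> generic normals v ->
  dominant b (sact g (coords y v)) -> strictly_dominant b (sact g (coords y v)).
Proof.
move=> gW /allP gv /forall_inP dv; apply/forall_inP => i iW.
rewrite lt0r dv // andbT -inner_walls.
have [a aN [c c0 ->]] := wall_normal gW iW.
by rewrite innerZr mulf_neq0 // gv.
Qed.

(** The chamber of [g] is cut out by its walls, since every normal is a
    nonnegative or nonpositive combination of them. Sorting the coordinates by
    [g] makes these signs visible. *)
Lemma closed_cell_cone g v : g \in weyl n b -> generic normals v ->
  dominant b (sact g (coords y v)) -> closed_cell normals v = cone (walls y g) (wall b n).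
Proof.
move=> gW gv dv; have sv := generic_strictly_dominant gW gv dv.
apply/seteqP; split=> w.
  move=> hw i iW; have [a aN [c c0 e]] := wall_normal gW iW.
  have : 0 < inner v (walls y g i).
    by rewrite inner_walls; exact: (forall_inP sv).
  have := hw a aN; rewrite e !innerZr => vw vi.
  rewrite -(pmulr_rge0 _ vi) mulrACA mulr_ge0 // -expr2 sqr_ge0 //.
move=> /mem_cone_walls dw x xN.
have sgn (s : bool) (p q : R) : 0 <= p -> 0 <= q -> 0 <= ((-1) ^+ s * p) * ((-1) ^+ s * q).
  by move=> p0 q0; rewrite mulrACA -signr_addb addbb mul1r mulr_ge0.
have [s [|[]]] := normal_sorted xN gW.
- move=> [i [j [ij e]]]; rewrite !e; apply: sgn; rewrite subr_ge0.
    exact: (dominant_anti dv (ltnW ij)).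
  exact: (dominant_anti dw (ltnW ij)).
- move=> [hb [i [j e]]]; rewrite !e; apply: sgn;
    by rewrite addr_ge0 ?(dominant_ge0 _ dv hb) ?(dominant_ge0 _ dw hb).
- move=> [hb [i e]]; rewrite !e; apply: sgn;
    by rewrite ?(dominant_ge0 _ dv hb) ?(dominant_ge0 _ dw hb).
Qed.

(** The image of the space in the coordinate space may miss some of the
    chambers of the group. *)
Definition is_chamber g : bool :=
  `[< exists v, strictly_dominant b (sact g (coords y v)) >].

Lemma cells_cones : [set closed_cell normals v | v in [set v | generic normals v]] =
  [set cone (walls y g) (wall b n) | g in [set g | (g \in weyl n b) && is_chamber g]].
Proof.
apply/seteqP; split=> C.
  move=> [v gv <-]; have [g gW dg] := exists_dominant b (coords y v).
  exists g; last by rewrite (closed_cell_cone gW gv dg).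
  rewrite /= gW; apply/asboolP; exists v; exact: generic_strictly_dominant.
move=> [g /andP[gW /asboolP[v sv]] <-].
have gv := strictly_dominant_generic gW sv.
exists v => //; apply: closed_cell_cone => //; exact: strictly_dominant_dominant.
Qed.

(** An element is recovered from an interior point of its chamber, by
    [dominant_unique] and [strictly_dominant_free]. *)
Lemma cone_walls_inj : {in [pred g | (g \in weyl n b) && is_chamber g] &,
  injective (fun g => cone (walls y g) (wall b n))}.
Proof.
move=> g h /andP[gW /asboolP[v sv]] /andP[hW _] e.
have : cone (walls y h) (wall b n) v.
  by rewrite -e; apply/mem_cone_walls; exact: strictly_dominant_dominant.
move=> /mem_cone_walls dh.
have kW : smul h (sinv g) \in weyl n b := smul_weyl hW (sinv_weyl gW).
have ke : sact (smul h (sinv g)) (sact g (coords y v)) =1 sact h (coords y v).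
  by move=> i; rewrite sact_smul (eq_sact h (sactK g (coords y v))).
have := dominant_unique kW (strictly_dominant_dominant sv).
rewrite (eq_dominant b ke) => /(_ dh) ke'.
have : smul (smul h (sinv g)) g = g.
  by rewrite (strictly_dominant_free kW sv ke') smul1.
by rewrite -smulA smulV smulg1.
Qed.

Hypotheses (gp : general_position b y) (n_gt0 : (0 < n)%N).

(** Every flat is cut out by walls of a single chamber, for which general
    position gives the dimension. *)
Lemma flat_dims_full : flat_dims b nat_forms n fullv d.
Proof.
move=> m c L vc memL; have m_le_n := valid_le vc.
have m_gt0 : b || (0 < m)%N.
  have /validP[_ [->//|ht]] := vc; have [j _] := ht (Ordinal n_gt0).
  by apply/orP; right; exact: leq_ltn_trans (ltn_ord j).
have [g [S [gW aS ec]]] := @valid_standard R b n m n_gt0 m_le_n m_gt0 c vc.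
have -> : L = flat (walls y g) S.
  apply/vspaceP => v; apply/idP/idP.
    move=> /memL[_ [phi h]]; apply/(flat_label y n_gt0 m_le_n m_gt0 g v aS).
    by rewrite -ec; exists phi => i; rewrite -h nat_forms_ord.
  move=> /(flat_label y n_gt0 m_le_n m_gt0 g v aS); rewrite -ec => -[phi h].
  by apply/memL; split; [exact: memvf|exists phi => i; rewrite nat_forms_ord; exact: h].
have [SW /eqP cS] := andP aS.
rewrite (dim_flat _ gp.1) ?cS // => T TW cT; exact: gp.2.
Qed.

Variable k : nat.
Hypotheses (hk : (0 < k <= d)%N) (dn : (d <= n)%N) (typ : b || (d < n)%N).

(** The elements whose chamber is missed contribute nothing by
    [face_mass0_empty], so the sum extends over the whole group. *)
Lemma sum_Lambda_chambers :
  \sum_(C \in [set closed_cell normals v | v in [set v | generic normals v]]) Lambda k C =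
  \sum_(g in weyl n b) \sum_(S : {set 'I_n} | (S \subset wall b n) && (#|S| == (d - k)%N))
     face_mass (walls y g) (wall b n) S.
Proof.
rewrite cells_cones (@fsbig_image_finType _ _ _
  (fun g => (g \in weyl n b) && is_chamber g)); last exact: cone_walls_inj.
have d0 : (0 < d)%N by move: hk; lia.
rewrite [RHS](bigID is_chamber) /= [X in _ + X]big1 ?addr0.
  apply: eq_bigr => g /andP[gW _]; apply: Lambda_cone => //; last exact: gp.1.
  by move=> T TW cT; exact: gp.2.
move=> g /andP[gW nc]; apply: big1 => S /andP[SW /eqP cS].
apply: (face_mass0_empty (fun T TW cT => gp.2 g T gW TW cT) gp.1 d0 hk) => // -[v hv].
move/asboolP: nc; apply; exists v; apply/forall_inP => i iW.
by rewrite -inner_walls hv.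
Qed.

(** The numerator is [sum_face_mass] and the denominator is
    [regions_arrangement]; neither depends on [y]. *)
Theorem mean_Lambda (N : set V) :
  (forall v, (exists2 x, N x & inner v x = 0) <->
             exists2 x, x \in normals & inner v x = 0) ->
  let W := tessellation N in
  (#|` fset_set W|%fset%:R)^-1 * \sum_(C \in W) Lambda k C =
  #|weyl n b|%:R * ('C(#|wall b n|, d - k))%:R / #|weyl (n - (d - k)) b|%:R
    / (region_count b n d)%:R.
Proof.
move=> hN W; rewrite /W (tessellation_cells hN) (card_cells normals).2.
rewrite (regions_arrangement flat_dims_full) sum_Lambda_chambers.
rewrite -(sum_face_mass gp n_gt0 hk dn typ) mulrC; congr (_ / _).
rewrite mulrAC divff ?mul1r // pnatr_eq0 card_weyl.
by rewrite muln_eq0 expn_eq0 /= -lt0n fact_gt0.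
Qed.

End WeylTessellation.

(** * Almost surely constant functions *)

Section AlmostSurelyConstant.
Context {disp : measure_display} {T : measurableType disp} {R : realType}.
Variable P : probability T R.
Import HBNNSimple.

(** The integral of a nonnegative function is the supremum of those of the
    simple functions below it. Comparing these with the constant almost
    everywhere avoids the measurability of [X], which for a random tessellation
    is far from evident. *)
Lemma expectation_ae_constant (X : T -> R) (c : R) : (forall w, 0 <= X w) -> 0 <= c ->
  {ae P, forall w, X w = c} -> expectation P X = c%:E.
Proof.
move=> X0 c0 [N [mN N0 XN]].
have XE w : ~ N w -> X w = c by move=> nNw; apply: contrapT => h; apply: nNw; exact: XN.
rewrite unlock ge0_integralTE => [|w]; last by rewrite lee_fin.
have cE : (\int[P]_w c%:E = c%:E)%E.
  rewrite integral_cst // [X in (_ * X)%E](_ : _ = 1%E) ?mule1 //.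
  exact: probability_setT.
have sE (h : {nnsfun T >-> R}) : sintegral P h = (\int[P]_w (h w)%:E)%E.
  by rewrite (integral_nnsfun P measurableT h) patch_setT.
apply/le_anti/andP; split.
  apply: ge_ereal_sup => _ [h hX <-]; rewrite sE -cE.
  apply: ae_ge0_le_integral => //.
  - by move=> w _; rewrite lee_fin; exact: fun_ge0.
  - by apply/measurable_realfun.measurable_EFinP.
  - exists N; split=> // w /= h'; apply: contrapT => nN; apply: h' => _.
    by rewrite -(XE w nN); exact: hX.
pose h : {nnsfun T >-> R} := scale_nnsfun (indic_nnsfun R (measurableC mN)) c0.
have hE w : h w = c * (w \in ~` N)%:R by [].
apply: le_trans (_ : sintegral P h <= _)%E; last first.
  apply: ereal_sup_ubound; exists h => // w; rewrite lee_fin hE.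
  case: (boolP (w \in ~` N)) => [wN|_]; last by rewrite mulr0.
  by rewrite mulr1 XE //; move: wN; rewrite inE.
rewrite sE -cE; apply: ae_ge0_le_integral => //.
- by move=> w _; rewrite lee_fin; exact: fun_ge0.
- by apply/measurable_realfun.measurable_EFinP.
exists N; split=> // w /= h'; apply: contrapT => nN; apply: h' => _.
have : c <= h w by rewrite hE mem_set // mulr1.
by rewrite -lee_fin.
Qed.

Lemma ae_exists (Q : T -> Prop) : {ae P, forall w, Q w} -> exists w, Q w.
Proof.
move=> [N [mN N0 QN]]; apply: contrapT => nQ.
have NT : N = setT by apply/seteqP; split=> // w _; apply: QN => Qw; apply: nQ; exists w.
have := probability_setT P; rewrite -NT N0 => /eqP.
by rewrite eqe eq_sym oner_eq0.
Qed.
End AlmostSurelyConstant.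

(** * The types A and B *)

Section GeneralPosition.
Context {R : realType} {d : nat}.
Local Notation V := 'rV[R]_d.
Variables (n : nat) (y : 'I_n -> V).

Lemma card_wall b : (0 < n)%N -> #|wall b n| = (if b then n else n.-1).
Proof.
move=> n0; case: b.
  by rewrite -[RHS]card_ord; apply: eq_card => i; rewrite !inE.
have h : (n.-1 < n)%N by rewrite ltn_predL.
have -> : wall false n = ~: [set Ordinal h].
  apply/setP => i; rewrite !inE -val_eqE /=; case: i => i /= hi.
  by apply/idP/idP; lia.
by rewrite cardsC1 card_ord.
Qed.

(** Without signs the increments of type B are, at the walls, those of type A.
    *)
Lemma type_A_general : type_A_general_position y -> general_position false y.
Proof.
move=> [dn h]; split; first by rewrite card_wall; move: dn; clear; lia.
move=> g S; rewrite inE /= => /eqP g0 SW cS.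
rewrite (_ : [seq walls y g i | i in S] = [seq y (g.2 i) - y (g.2 (ordS i)) | i in S]).
  by apply: h cS _ => i /(fintype.subsetP SW); rewrite inE.
apply/eq_in_map => i; rewrite mem_enum => /(fintype.subsetP SW); rewrite inE /= => hi.
by rewrite /walls /type_B_increment hi g0 !ffunE expr0 !scale1r.
Qed.

Lemma type_B_general : (0 < n)%N -> type_B_general_position y -> general_position true y.
Proof.
move=> n0 [dn h]; split; first by rewrite card_wall.
by move=> g S _ _; exact: h.
Qed.

Lemma normals_A_perp v : (exists2 x, normals_A y x & inner v x = 0) <->
  (exists2 x, x \in normals false y & inner v x = 0).
Proof.
split=> [[_ [i [j [ij ->]]] vx]|[x /arrangementP[j [l [jn hl ->]]] vx]].
  exists (nat_forms y j - pm_form (nat_forms y) (Some (false, val i))).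
    by apply/arrangementP; exists j, (Some (false, val i)); rewrite mem_pm_labels ltn_ord ij.
  by rewrite /= scale1r !nat_forms_ord -opprB innerNr vx oppr0.
move: hl vx; rewrite mem_pm_labels; case: l => [[e i]|] //= /andP[ij /negbTE->] vx.
have i_n : (i < n)%N by lia.
exists (y (Ordinal i_n) - y (Ordinal jn)); first by exists (Ordinal i_n), (Ordinal jn).
move: vx; rewrite scale1r -[i]/(val (Ordinal i_n)) -[j]/(val (Ordinal jn)) !nat_forms_ord.
by rewrite -opprB innerNr => /eqP; rewrite oppr_eq0 => /eqP.
Qed.

Lemma normals_B_perp v : (exists2 x, normals_B y x & inner v x = 0) <->
  (exists2 x, x \in normals true y & inner v x = 0).
Proof.
split=> [[x hx vx]|[x /arrangementP[j [l [jn hl ->]]] vx]].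
  case: hx vx => [[i [j [ij [->|->]]]]|[i ->]] vx.
  - exists (nat_forms y j - pm_form (nat_forms y) (Some (true, val i))).
      by apply/arrangementP; exists j, (Some (true, val i)); rewrite mem_pm_labels ltn_ord ij.
    by rewrite /= expr1 scaleN1r opprK !nat_forms_ord addrC.
  - exists (nat_forms y j - pm_form (nat_forms y) (Some (false, val i))).
      by apply/arrangementP; exists j, (Some (false, val i)); rewrite mem_pm_labels ltn_ord ij.
    by rewrite /= scale1r !nat_forms_ord -opprB innerNr vx oppr0.
  - exists (nat_forms y i - pm_form (nat_forms y) None).
      by apply/arrangementP; exists i, None; rewrite mem_pm_labels ltn_ord.
    by rewrite /= subr0 nat_forms_ord.
move: hl vx; rewrite mem_pm_labels; case: l => [[e i]|] /=; last first.
  move=> _ vx; exists (y (Ordinal jn)); first by right; exists (Ordinal jn).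
  by move: vx; rewrite subr0 -[j]/(val (Ordinal jn)) nat_forms_ord.
move=> /andP[ij _] vx; have i_n : (i < n)%N by lia.
move: vx; rewrite -[i]/(val (Ordinal i_n)) -[j]/(val (Ordinal jn)) !nat_forms_ord.
case: e => vx.
  exists (y (Ordinal i_n) + y (Ordinal jn)).
    by left; exists (Ordinal i_n), (Ordinal jn); split=> //; left.
  by move: vx; rewrite expr1 scaleN1r opprK addrC.
exists (y (Ordinal i_n) - y (Ordinal jn)).
  by left; exists (Ordinal i_n), (Ordinal jn); split=> //; right.
by move: vx; rewrite scale1r -opprB innerNr => /eqP; rewrite oppr_eq0 => /eqP.
Qed.

End GeneralPosition.

Section NonnegativeAverage.
Context {R : realType} {d : nat}.

Lemma solid_angle_ge0 (C : set 'rV[R]_d) : 0 <= solid_angle C.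
Proof. by rewrite /solid_angle fine_ge0. Qed.

Lemma average_Lambda_ge0 k (W : set (set 'rV[R]_d)) :
  0 <= (#|` fset_set W|%fset%:R)^-1 * \sum_(C \in W) Lambda k C.
Proof.
rewrite mulr_ge0 ?invr_ge0 // fsumr_ge0 // => C _.
by rewrite /Lambda fsumr_ge0 // => F _; exact: solid_angle_ge0.
Qed.

End NonnegativeAverage.

Theorem corollary1p11 (R : realType) (d k : nat) (hd : (2 <= d)%N)
    (hk : (1 <= k <= d)%N) :
  (forall (n : nat) (disp : measure_display) (T : measurableType disp)
      (P : probability T R) (Y : 'I_n -> {RV P >-> borel R d}),
    {ae P, forall w, type_A_general_position (fun i => Y i w : 'rV[R]_d)} ->
    expectation_uniform_cone P
      (fun w => weyl_tessellation_A (fun i => Y i w : 'rV[R]_d)) (Lambda k) =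
    ((n`! * 'C(n.-1, d - k))%:R / ((n - d + k)`!)%:R * (1 / (DA n d)%:R))%:E)
  /\
  (forall (n : nat) (disp : measure_display) (T : measurableType disp)
      (P : probability T R) (Y : 'I_n -> {RV P >-> borel R d}),
    {ae P, forall w, type_B_general_position (fun i => Y i w : 'rV[R]_d)} ->
    expectation_uniform_cone P
      (fun w => weyl_tessellation_B (fun i => Y i w : 'rV[R]_d)) (Lambda k) =
    ((2 ^ (d - k) * n`! * 'C(n, d - k))%:R / ((n - d + k)`!)%:R
       * (1 / (DB n d)%:R))%:E).
Proof.
split=> n disp T P Y gpY; have [w gpw] := ae_exists gpY.
  have dn : (d < n)%N by have [] := gpw.
  apply: expectation_ae_constant => [w'||]; first exact: average_Lambda_ge0.
    by rewrite !mulr_ge0 ?divr_ge0.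
  apply: filterS gpY => w' /type_A_general gpA.
  rewrite (mean_Lambda (k := k) gpA _ _ _ _ (normals_A_perp _)) //; try lia.
  rewrite !card_weyl card_wall; last by lia.
  rewrite region_count_DA; [|lia|lia].
  rewrite !mul0n !expn0 !mul1n div1r natrM (_ : (n - (d - k) = n - d + k)%N) //.
  by lia.
have dn : (d <= n)%N by have [] := gpw.
apply: expectation_ae_constant => [w'||]; first exact: average_Lambda_ge0.
  by rewrite !mulr_ge0 ?divr_ge0.
apply: filterS gpY => w' /type_B_general gpB.
have {}gpB := gpB (leq_trans (ltnW hd) dn).
rewrite (mean_Lambda (k := k) gpB _ _ _ _ (normals_B_perp _)) //; try lia.
rewrite !card_weyl card_wall; last by lia.
rewrite region_count_DB; [|lia|lia].
rewrite !mul1n div1r (_ : (n - (d - k) = n - d + k)%N); last by lia.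
have e : (2 ^ n = 2 ^ (d - k) * 2 ^ (n - d + k))%N by rewrite -expnD; congr expn; lia.
rewrite e !natrM; congr (_ / _).
have a0 : (2 ^ (n - d + k))%:R != 0 :> R by rewrite pnatr_eq0 expn_eq0.
have b0 : ((n - d + k)`!)%:R != 0 :> R by rewrite pnatr_eq0 -lt0n fact_gt0.
by field; rewrite a0 b0.
Qed.
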